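(* Let $\Omega\subset\mathbb{R}^N$ be a bounded domain, $1<p<\infty$, $h\in W^{-1,p'}(\Omega)$, and let $f:\Omega\times\mathbb{R}\to\mathbb{R}$ be a Carathéodory function such that $\sup_{|s|\le R}|f(\cdot,s)|\in L^1_{loc}(\Omega)$ for all $R>0$. Put $F(x,s)=\int_0^sf(x,t)\,dt$, $\Psi(u)=\int_\Omega F(x,u)\,dx$ and let $\Phi:W_0^{1,p}(\Omega)\to\overline{\mathbb{R}}$, $\Phi(u)=\frac1p\int_\Omega|\nabla u|^p\,dx-\int_\Omega F(x,u)\,dx-\langle h,u\rangle$. If $u\in W_0^{1,p}(\Omega)$ is a critical point of $\Phi$ in the sense of Degiovanni–Marzocchi such that $\Psi(u)\in\mathbb{R}$, then $u$ is a weak solution of the problem $-\Delta_pu=f(x,u)+h$ in $\Omega$, $u=0$ on $\partial\Omega$.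
   Context: Notation: $p'$ is the conjugate exponent of $p$; $\langle\cdot,\cdot\rangle$ is the duality pairing between $W^{-1,p'}(\Omega)$ and $W^{1,p}_0(\Omega)$; $\|\cdot\|_{1,p}$ is the usual norm of $W^{1,p}_0(\Omega)$; $\Delta_p u=\operatorname{div}(|\nabla u|^{p-2}\nabla u)$, viewed as a map $W^{1,p}_0(\Omega)\to W^{-1,p'}(\Omega)$. Convention: if $\int_\Omega F(x,u)^+\,dx=\int_\Omega F(x,u)^-\,dx=+\infty$, then in the definition of $\Phi$ the integral $\int_\Omega(-F(x,u))\,dx$ is taken to be $+\infty$, so $\Phi(u)=+\infty$. Critical points: let $(E,d)$ be a metric space and $g:E\to\overline{\mathbb{R}}$. Let $\operatorname{epi}(g)=\{(w,\mu)\in E\times\mathbb{R}: g(w)\le\mu\}$, with $E\times\mathbb{R}$ carrying the metric $\operatorname{dist}((w,\mu),(w',\mu'))=(d(w,w')^2+(\mu-\mu')^2)^{1/2}$, and let $B_\sigma(u,\lambda)$ be the open ball of radius $\sigma$ about $(u,\lambda)$ in $E\times\mathbb{R}$. A point $u$ with $g(u)\in\mathbb{R}$ is $\delta$-regular ($\delta>0$) if there exist $\sigma>0$ and a continuous map $\nu:(B_\sigma(u,g(u))\cap\operatorname{epi}(g))\times[0,\sigma]\to E$ such that for all $(w,\mu)\in B_\sigma(u,g(u))\cap\operatorname{epi}(g)$ and $t\in[0,\sigma]$: $d(\nu((w,\mu),t),w)\le t$ and $g(\nu((w,\mu),t))\le\mu-\delta t$. The point $u$ is critical (in the sense of Degiovanni–Marzocchi)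 if it is not $\delta$-regular for any $\delta>0$. Here $E=W_0^{1,p}(\Omega)$ and $g=\Phi$. Weak solutions: let $L^\infty_0(\Omega)$ be the set of $v\in L^\infty(\Omega)$ vanishing a.e. outside a compact subset of $\Omega$. For $u\in W^{1,p}_0(\Omega)$ let $V_u=\{v\in W^{1,p}_0(\Omega)\cap L^\infty_0(\Omega):\ u\in L^\infty(\{x\in\Omega: v(x)\ne0\})\}$ and $A_u=\{v\in W_0^{1,p}(\Omega):\ f(x,u)v\in L^1(\Omega)\}$. Both are dense linear subspaces of $W^{1,p}_0(\Omega)$ and $V_u\subset A_u$. One says $f(x,u)\in W^{-1,p'}(\Omega)$ if $\sup\{\int_\Omega f(x,u)v\,dx:\ v\in A_u,\ \|v\|_{1,p}\le1\}<+\infty$ (the supremum over $V_u$ has the same value); then $f(x,u)$ is identified with the unique continuous linear extension to $W_0^{1,p}(\Omega)$ of $v\mapsto\int_\Omega f(x,u)v\,dx$, $v\in V_u$. A function $u\in W_0^{1,p}(\Omega)$ is a weak solution of the problem if $f(x,u)\in W^{-1,p'}(\Omega)$ in this sense and $-\Delta_pu=f(x,u)+h$ holds in $W^{-1,p'}(\Omega)$; in particular $\int_\Omega|\nabla u|^{p-2}\nabla u\cdot\nabla v\,dx=\int_\Omega f(x,u)v\,dx+\langle h,v\rangle$ for all $v\in A_u$. *)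

(* Defs.v *)
From HB Require Import structures.
From mathcomp Require Import all_boot all_order all_algebra.
From mathcomp Require Import all_classical all_reals all_analysis.

Set Implicit Arguments.
Unset Strict Implicit.
Unset Printing Implicit Defensive.

Import Order.TTheory GRing.Theory Num.Theory.
Import numFieldNormedType.Exports.

Local Open Scope classical_set_scope.
Local Open Scope ring_scope.

(* The ambient space is 'rV[R]_N.+1, i.e. R^(N+1), so that the dimension is
   positive. *)

(** * Complete Lebesgue measure *)

Section lebesgue_outer_measure.
Context {R : realType} {N : nat}.
Implicit Types (a b : 'rV[R]_N.+1) (A : set 'rV[R]_N.+1).

Definition box a b : set 'rV[R]_N.+1 :=
  [set x | forall i, a ord0 i < x ord0 i <= b ord0 i].

Definition box_volume a b : R := \prod_i Num.max 0 (b ord0 i - a ord0 i).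

Definition box_cover A : set (nat -> 'rV[R]_N.+1 * 'rV[R]_N.+1) :=
  [set c | A `<=` \bigcup_k box (c k).1 (c k).2].

Definition leb_outer A : \bar R :=
  ereal_inf [set (\sum_(k <oo) (box_volume (c k).1 (c k).2)%:E)%E
            | c in box_cover A].

Local Open Scope ereal_scope.

Let vol (c : 'rV[R]_N.+1 * 'rV[R]_N.+1) : \bar R := (box_volume c.1 c.2)%:E.

Let vol_ge0 c : 0 <= vol c.
Proof. by rewrite lee_fin prodr_ge0// => i _; rewrite le_max lexx. Qed.

Lemma leb_outer_ge0 A : 0 <= leb_outer A.
Proof.
by apply: le_ereal_inf_tmp => _ [c _ <-]; apply: nneseries_ge0 => *; exact: vol_ge0.
Qed.

Lemma le_leb_outer : {homo leb_outer : A B / A `<=` B >-> A <= B}.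
Proof.
move=> A B AB; apply/ereal_inf_le_tmp => _ [c Bc <-].
by exists c => //; exact: subset_trans AB Bc.
Qed.

Lemma leb_outer0 : leb_outer set0 = 0.
Proof.
apply/eqP; rewrite eq_le leb_outer_ge0 andbT.
apply: ereal_inf_lbound; exists (fun=> (0, 0)%R) => //=.
rewrite eseries0// => k _ _; rewrite /box_volume big_ord_recl.
by rewrite subrr maxxx mul0r.
Qed.

Lemma leb_outer_sigma_subadditive : sigma_subadditive leb_outer.
Proof.
move=> A; have [[i ioo]|] := pselect (exists i, leb_outer (A i) = +oo).
  rewrite (eseries_pinfty _ _ ioo) ?leey// => n _.
  by rewrite -ltNye (lt_le_trans _ (leb_outer_ge0 _)).
rewrite -forallNE => Aoo.
suff add2e (e : {posnum R}) :
    leb_outer (\bigcup_n A n) <= \sum_(i <oo) leb_outer (A i) + e%:num%:E.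
  by apply/lee_addgt0Pr => _/posnumP[].
rewrite (le_trans _ (epsilon_trick _ _ _))//; last first.
  by move=> n; exact: leb_outer_ge0.
pose P n c := box_cover (A n) c /\
  \sum_(k <oo) vol (c k) <= leb_outer (A n) + (e%:num / (2 ^ n.+1)%:R)%:E.
have [G PG] : {G : nat -> nat -> _ & forall n, P n (G n)}.
  apply: (@choice _ _ P) => n; rewrite /P /leb_outer.
  set S := (X in ereal_inf X); move infS : (ereal_inf S) => iS.
  case: iS infS => [r Sr|Soo|Soo].
  - have en1 : (0 < e%:num / (2 ^ n.+1)%:R)%R by [].
    have /(lb_ereal_inf_adherent en1) : ereal_inf S \is a fin_num by rewrite Sr.
    move=> [x [B AnB muBx] xS].
    by exists B; split => //; rewrite muBx -Sr; exact/ltW.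
  - by have := Aoo n; rewrite /leb_outer Soo.
  - suff : lbound S 0 by move/le_ereal_inf_tmp; rewrite Soo.
    by move=> /= _ [c _ <-]; apply: nneseries_ge0 => *; exact: vol_ge0.
have muG_ge0 x : 0 <= (vol \o uncurry G) x by exact: vol_ge0.
apply: (@le_trans _ _ (\esum_(i in setT) (vol \o uncurry G) i)).
  apply: ereal_inf_lbound => /=.
  have /card_esym/ppcard_eqP[f] := card_nat2.
  exists (uncurry G \o f).
    apply: (@subset_trans _ (\bigcup_n \bigcup_k box (G n k).1 (G n k).2)).
      by move=> t [i _] /((PG i).1) [j _ ?]; exists i => //; exists j.
    move=> t [i _ [j _ Bijt]]; exists (f^-1%FUN (i, j)) => //=.
    by rewrite invK ?inE.
  rewrite -(esum_pred_image (vol \o uncurry G) _ xpredT) ?[fun=> _]set_true//.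
  by rewrite image_eq.
rewrite (_ : esum _ _ = \sum_(i <oo) \sum_(j <oo) vol (G i j)); last first.
  pose J : nat -> set (nat * nat) := fun i => [set (i, j) | j in setT].
  rewrite (_ : setT = \bigcup_k J k); last first.
    by rewrite predeqE => -[a b]; split => // _; exists a => //; exists b.
  rewrite esum_bigcupT /=; last 2 first.
    - apply/trivIsetP => i j _ _ ij.
      rewrite predeqE => -[n m] /=; split => //= -[] [_] _ [<-{n} _].
      by move=> [m' _] [] /esym/eqP; rewrite (negbTE ij).
    - by move=> /= [n m]; exact: vol_ge0.
  rewrite -(image_id [set: nat]) -fun_true esum_pred_image//; last first.
    by move=> n _; exact: esum_ge0.
  apply: eq_eseriesr => /= j _.
  rewrite -(esum_pred_image (vol \o uncurry G) (pair j) predT)//=; last first.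
    by move=> ? ? _ _; exact: (@can_inj _ _ _ snd).
  by congr esum; rewrite predeqE => -[a b]; split; move=> [i _ <-]; exists i.
apply: lee_lim.
- apply: is_cvg_nneseries => n *.
  by apply: nneseries_ge0 => m *; exact: (muG_ge0 (n, m)).
- by apply: is_cvg_nneseries => n *; apply: adde_ge0 => //; exact: leb_outer_ge0.
- by near=> n; apply: lee_sum => i _; exact: (PG i).2.
Unshelve. all: by end_near. Qed.

HB.instance Definition _ := isOuterMeasure.Build R _ leb_outer
  leb_outer0 leb_outer_ge0 le_leb_outer leb_outer_sigma_subadditive.

End lebesgue_outer_measure.

(* 'rV[R]_N.+1 with the sigma-algebra of Lebesgue (Caratheodory) measurable
   sets. *)
Definition leb_type (R : realType) (N : nat) :=
  caratheodory_type (@leb_outer R N).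

HB.instance Definition _ (R : realType) (N : nat) :=
  Measurable.on (leb_type R N).

Definition leb (R : realType) (N : nat) : set (leb_type R N) -> \bar R :=
  @leb_outer R N.

HB.instance Definition _ (R : realType) (N : nat) :=
  isMeasure.Build _ (leb_type R N) R (@leb R N)
    (@caratheodory_measure0 _ _ (@leb_outer R N))
    (@caratheodory_measure_ge0 _ _ (@leb_outer R N))
    (@caratheodory_measure_sigma_additive _ _ (@leb_outer R N)).

(** * Sobolev spaces *)

(* Functions are represented by total functions on 'rV[R]_N.+1 of which only
   the values on Omega matter; a.e. equal functions are not identified, they
   are at distance 0 from each other. *)

Section sobolev.
Context {R : realType} {N : nat}.
Local Notation V := 'rV[R]_N.+1.
Local Notation T := (leb_type R N).
Local Notation mu := (@leb R N).
Implicit Types (Omega : set V) (p : R) (u v phi : V -> R) (G : V -> V).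

Definition bounded_domain Omega :=
  [/\ open Omega, connected Omega, Omega !=set0 & bounded_set Omega].

Definition edot (x y : V) : R := \sum_i x ord0 i * y ord0 i.

(* Euclidean norm; the library norm on V is the max norm. *)
Definition enorm (x : V) : R := Num.sqrt (edot x x).

Definition partial (i : 'I_N.+1) u : V -> R := 'D_(delta_mx ord0 i) u.

(* All iterated partial derivatives exist and are differentiable. *)
Definition smooth u :=
  forall (s : seq 'I_N.+1) (x : V), differentiable (foldr partial u s) x.

Definition test_function Omega phi :=
  [/\ smooth phi, compact (closure [set x | phi x != 0]) &
      closure [set x | phi x != 0] `<=` Omega].

Definition in_Lp Omega p u :=
  measurable_fun (Omega : set T) (u : T -> R) /\
  (\int[mu]_(x in Omega) (`|u x| `^ p)%:E < +oo)%E.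

Definition is_weak_gradient Omega p u G :=
  (forall i, in_Lp Omega p (fun x => G x ord0 i)) /\
  (forall phi i, test_function Omega phi ->
     \int[mu]_(x in Omega) (u x * partial i phi x) =
     - \int[mu]_(x in Omega) (G x ord0 i * phi x)).

Definition W1p Omega p u :=
  in_Lp Omega p u /\ exists G, is_weak_gradient Omega p u G.

(* A weak gradient, unique up to a.e. equality in Omega. *)
Definition grad Omega p u : V -> V := xget (cst 0) (is_weak_gradient Omega p u).

Definition sobolev_norm Omega p u : R :=
  (\int[mu]_(x in Omega) (`|u x| `^ p) +
   \int[mu]_(x in Omega) (enorm (grad Omega p u x) `^ p)) `^ p^-1.

(* The closure of the test functions in W1p. *)
Definition W1p0 Omega p : set (V -> R) :=
  [set u | W1p Omega p u /\
    forall e, 0 < e -> exists2 phi, test_function Omega phi &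
      sobolev_norm Omega p (u \- phi) < e].

(* L belongs to the topological dual of W1p0; only the values of L on W1p0
   matter. *)
Definition dual_W1p0 Omega p (L : (V -> R) -> R) :=
  (forall (a : R) u v, W1p0 Omega p u -> W1p0 Omega p v ->
     L (fun x => a * u x + v x) = a * L u + L v) /\
  (exists C : R, forall u, W1p0 Omega p u -> `|L u| <= C * sobolev_norm Omega p u).

(* <- Delta_p u, v>; the integrand is 0 where grad u = 0, for every p > 1. *)
Definition neg_plaplacian Omega p u v : R :=
  \int[mu]_(x in Omega)
    (enorm (grad Omega p u x) `^ (p - 2) *
     edot (grad Omega p u x) (grad Omega p v x)).

(* u is in L^oo(A), for u known to be measurable. *)
Definition ess_bounded (A : set V) u :=
  exists M : R, {ae mu, forall x, A x -> `|u x| <= M}.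

Definition Linf0 Omega v :=
  [/\ measurable_fun (Omega : set T) (v : T -> R), ess_bounded Omega v &
      exists K : set V, [/\ compact K, K `<=` Omega &
        {ae mu, forall x, Omega x -> ~ K x -> v x = 0}]].

End sobolev.

(** * Critical points of extended-real functions on a metric space *)

(* The metric space is a set E of points of X, with distance d. *)

Section critical_point.
Context {R : realType} {X : Type}.
Variables (E : set X) (d : X -> X -> R) (g : X -> \bar R).

Definition epi : set (X * R) := [set z | E z.1 /\ (g z.1 <= z.2%:E)%E].

Definition dist_prod (z z' : X * R) : R :=
  Num.sqrt (d z.1 z'.1 ^+ 2 + (z.2 - z'.2) ^+ 2).

Definition delta_regular (delta : R) (u : X) :=
  exists sigma, 0 < sigma /\ exists nu : X * R -> R -> X,
    let B := [set z | dist_prod z (u, fine (g u)) < sigma] `&` epi in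
    let I := `[0, sigma]%classic : set R in
    [/\ (forall z t, B z -> I t -> E (nu z t)),
        (forall z t, B z -> I t -> forall e, 0 < e -> exists2 eta, 0 < eta &
           forall z' t', B z' -> I t' -> dist_prod z z' < eta ->
             `|t - t'| < eta -> d (nu z t) (nu z' t') < e) &
        (forall z t, B z -> I t ->
           d (nu z t) z.1 <= t /\ (g (nu z t) <= (z.2 - delta * t)%:E)%E)].

Definition critical_point (u : X) :=
  [/\ E u, g u \is a fin_num & forall delta, 0 < delta -> ~ delta_regular delta u].

End critical_point.

(** * The problem *)

Section problem.
Context {R : realType} {N : nat}.
Local Notation V := 'rV[R]_N.+1.
Local Notation T := (leb_type R N).
Local Notation mu := (@leb R N).
Variables (Omega : set V) (p : R) (f : V -> R -> R) (h : (V -> R) -> R).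
Implicit Types u v : V -> R.

Definition caratheodory :=
  (forall s, measurable_fun (Omega : set T) (f ^~ s : T -> R)) /\
  {ae mu, forall x, Omega x -> continuous (f x)}.

Definition L1loc (g : V -> \bar R) :=
  forall K : set V, compact K -> K `<=` Omega -> mu.-integrable K g.

Definition sup_abs (r : R) (x : V) : \bar R :=
  ereal_sup [set `|f x s|%:E | s in [set s | `|s| <= r]].

Definition primitive (x : V) (s : R) : R :=
  if 0 <= s then \int[lebesgue_measure]_(t in `[0, s]) f x t
  else - \int[lebesgue_measure]_(t in `[s, 0]) f x t.

Definition Psi u : \bar R := (\int[mu]_(x in Omega) (primitive x (u x))%:E)%E.

(* In \bar R one has +oo - +oo = -oo. So Psi u = -oo, hence Phi u = +oo, when
   the positive and the negative part of F(x, u) both have integral +oo, see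
   Phi_both_infinite below. *)
Definition Phi u : \bar R :=
  ((p^-1)%:E * \int[mu]_(x in Omega) (enorm (grad Omega p u x) `^ p)%:E
   - Psi u - (h u)%:E)%E.

Lemma Phi_both_infinite u : 0 < p ->
  (\int[mu]_(x in Omega) (fun y => (primitive y (u y))%:E)^\+ x = +oo)%E ->
  (\int[mu]_(x in Omega) (fun y => (primitive y (u y))%:E)^\- x = +oo)%E ->
  Phi u = +oo%E.
Proof.
move=> p0 Fp Fn.
have I0 : (0 <= (p^-1)%:E *
    \int[mu]_(x in Omega) (enorm (grad Omega p u x) `^ p)%:E)%E.
  apply: mule_ge0; first by rewrite lee_fin invr_ge0 ltW.
  by apply: integral_ge0 => x _; rewrite lee_fin powR_ge0.
have PsiNy : Psi u = -oo%E by rewrite /Psi integralE Fp Fn.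
by rewrite /Phi PsiNy /= addey ?addye// gt_eqF// (lt_le_trans _ I0)// ltNy0.
Qed.

Definition V_space u : set (V -> R) :=
  [set v | [/\ W1p0 Omega p v, Linf0 Omega v &
               ess_bounded [set x | Omega x /\ v x != 0] u]].

Definition A_space u : set (V -> R) :=
  [set v | W1p0 Omega p v /\
           mu.-integrable Omega (fun x => (f x (u x) * v x)%:E)].

Definition pairing_f u v : R := \int[mu]_(x in Omega) (f x (u x) * v x).

(* f(x, u) belongs to W^{-1,p'} *)
Definition f_in_dual u :=
  (ereal_sup [set (pairing_f u v)%:E |
     v in [set v | A_space u v /\ (sobolev_norm Omega p v <= 1)%R]] < +oo)%E.

(* L is the element of W^{-1,p'} with which f(x, u) is identified. *)
Definition f_extension u (L : (V -> R) -> R) :=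
  dual_W1p0 Omega p L /\ forall v, V_space u v -> L v = pairing_f u v.

Definition weak_solution u :=
  [/\ W1p0 Omega p u, f_in_dual u &
      exists2 L, f_extension u L &
        forall v, W1p0 Omega p v -> neg_plaplacian Omega p u v = L v + h v].

End problem.

(* Main.v *)
Require Import Defs.
From HB Require Import structures.
From mathcomp Require Import all_boot all_order all_algebra.
From mathcomp Require Import all_classical all_reals all_analysis.
From mathcomp Require Import measurable_realfun ring lra.

(* Suppose that v is bounded with compact support, that u is bounded where v <> 0,
   and that <- Delta_p u - f(x, u) - h, v> is negative.  Multiplying v by a cutoff
   of w gives a direction y(w), depending continuously on w in W^{1,p}_0, along
   which f(x, w + t y(w)) y(w) has a fixed integrable majorant; so
   (w, t) |-> w + t y(w) decreases Phi at a uniform rate near u, and u is not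
   critical.  Hence the derivative vanishes on V_u, that is, f(x, u) agrees there
   with the functional - Delta_p u - h.  An arbitrary v in A_u is approximated,
   through test functions phi_k -> v, by functions z_k of V_u that are dominated
   by |v|, bounded in W^{1,p}_0 and converge a.e. to v / 2; dominated convergence
   then bounds the pairing of f(x, u) with v.

   The work is done with representatives: [W0 Omega p u G] says that (u, G) is a
   limit of pairs (phi, grad phi) of test functions, and [energy] is the p-th
   power of a norm on such pairs, equivalent to the Sobolev norm. *)

Set Implicit Arguments.
Unset Strict Implicit.
Unset Printing Implicit Defensive.

Import Order.TTheory GRing.Theory Num.Theory.
Import numFieldNormedType.Exports.

Local Open Scope classical_set_scope.
Local Open Scope ring_scope.

(** * Lebesgue measure *)

(** The obstacle is that [Phi] may take both infinite values near u, and f(x, w) need not be locally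
    integrable for w near u. Hence [Phi] is never differentiated: only the increment F(x, w + t y) -
    F(x, w) is integrated. The cutoff acts on the moving point w, not on u. Where y(w) is nonzero, w
    is bounded by a fixed constant, so f is evaluated only at bounded arguments over the compact
    support of v. An infinite Psi(w) is unchanged by an integrable increment. Regularity also
    demands a displacement of at most t, that is, a direction of norm at most 1; v is rescaled for
    this, which is harmless because the derivative is homogeneous in v. The limit v / 2 has its
    origin in s t^2 / (s^2 + t^2 + e): it is a differentiable substitute for a minimum, and at t =
    s, as e tends to 0, it gives s / 2. Finally, [grad] is a choice among a.e. equal fields and is
    linear only almost everywhere. Every passage between it and an explicit gradient rests on
    uniqueness of weak gradients, hence on the du Bois-Reymond lemma, proved here with smooth
    multipliers and measurable hulls. *)

Lemma box_volume_ge0 (R : realType) (N : nat) (a b : 'rV[R]_N.+1) : 0 <= box_volume a b.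
Proof. by rewrite prodr_ge0// => i _; rewrite le_max lexx. Qed.

Definition set_coord (R : realType) (N : nat) (a : 'rV[R]_N.+1) (i : 'I_N.+1) (s : R) : 'rV[R]_N.+1 :=
  \row_j (if j == i then s else a ord0 j).

Lemma box_gt_coord (R : realType) (N : nat) (a b : 'rV[R]_N.+1) i s :
  box a b `&` [set x | s < x ord0 i] = box (set_coord a i (Num.max (a ord0 i) s)) b.
Proof.
apply/seteqP; split => x /=.
  move=> [xab sx] j; rewrite mxE; case: eqP => [->|_]; last exact: xab.
  by have /andP[h ->] := xab i; rewrite gt_max h sx.
move=> xab; split => [j|].
  have := xab j; rewrite mxE; case: eqP => [->|//].
  by rewrite gt_max -andbA => /and3P[-> _ ->].
by have := xab i; rewrite mxE eqxx gt_max -andbA => /and3P[_ -> _].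
Qed.

Lemma box_le_coord (R : realType) (N : nat) (a b : 'rV[R]_N.+1) i s :
  box a b `&` ~` [set x | s < x ord0 i] = box a (set_coord b i (Num.min (b ord0 i) s)).
Proof.
apply/seteqP; split => x /=.
  move=> [xab /negP]; rewrite -leNgt => sx j; rewrite mxE; case: eqP => [->|_]; last exact: xab.
  by have /andP[-> h] := xab i; rewrite le_min h sx.
move=> xab; split => [j|].
  have := xab j; rewrite mxE; case: eqP => [->|//].
  by rewrite le_min => /and3P[-> ->].
by have := xab i; rewrite mxE eqxx le_min => /and3P[_ _ h]; apply/negP; rewrite -leNgt.
Qed.

Lemma box_volume_split (R : realType) (N : nat) (a b : 'rV[R]_N.+1) i s :
  box_volume a b = box_volume (set_coord a i (Num.max (a ord0 i) s)) b +
                   box_volume a (set_coord b i (Num.min (b ord0 i) s)).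
Proof.
rewrite /box_volume (bigD1 i)//= [in RHS](bigD1 i)//= [X in _ = _ + X](bigD1 i)//=.
rewrite !mxE eqxx.
set P := (X in _ * X = _).
rewrite [X in _ = _ * X + _](_ : _ = P); last first.
  by apply: eq_bigr => j /negbTE ji; rewrite mxE ji.
rewrite [X in _ = _ + _ * X](_ : _ = P); last first.
  by apply: eq_bigr => j /negbTE ji; rewrite mxE ji.
rewrite -mulrDl; congr (_ * _).
case: (leP (a ord0 i) s) => h1; case: (leP (b ord0 i) s) => h2;
  case: (leP 0 (b ord0 i - a ord0 i)) => h3.
all: repeat match goal with |- context [Num.max 0 ?x] => case: (leP 0 x) end; lra.
Qed.

Section leb_measurable.
Context {R : realType} {N : nat}.
Local Notation V := 'rV[R]_N.+1.
Local Notation T := (leb_type R N).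
Local Notation mu := (@leb R N).
Local Open Scope ereal_scope.

(** Cutting each box of a cover of X by the hyperplane yields covers of the two parts of X with the
    same total volume; the infimum over covers gives the nontrivial Caratheodory inequality. *)
Lemma measurable_leb_half (i : 'I_N.+1) (s : R) :
  measurable ([set x : V | (s < x ord0 i)%R] : set T).
Proof.
apply: (@le_caratheodory_measurable R V (@leb_outer R N)) => X.
apply: le_ereal_inf_tmp => _ [c Xc <-].
under eq_eseriesr do rewrite (box_volume_split _ _ i s) EFinD.
rewrite nneseriesD; last 2 first.
- by move=> *; rewrite lee_fin box_volume_ge0.
- by move=> *; rewrite lee_fin box_volume_ge0.
apply: leeD; apply: ereal_inf_lbound.
  exists (fun k => (set_coord (c k).1 i (Num.max ((c k).1 ord0 i) s), (c k).2)) => //.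
  by move=> x [/Xc[k _ ckx] sx]; exists k => //=; rewrite -box_gt_coord.
exists (fun k => ((c k).1, set_coord (c k).2 i (Num.min ((c k).2 ord0 i) s))) => //.
by move=> x [/Xc[k _ ckx] sx]; exists k => //=; rewrite -box_le_coord.
Qed.

Lemma leb_outer_box (a b : V) : leb_outer (box a b) <= (box_volume a b)%:E.
Proof.
apply: ereal_inf_lbound; exists (fun k => if k == 0%N then (a, b) else (0, 0)%R).
  by move=> x xab; exists 0%N.
rewrite (nneseries_split _ 1) ?add0n; last first.
  by move=> k _; rewrite lee_fin box_volume_ge0.
rewrite big_nat1 /= eseries0 ?adde0//.
move=> [|k]// _ _ /=; rewrite /box_volume big_ord_recl.
by rewrite subrr maxxx mul0r.
Qed.

End leb_measurable.

(** * Open, closed, compact and bounded sets *)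

Section leb_open.
Context {R : realType} {N : nat}.
Local Notation V := 'rV[R]_N.+1.
Local Notation T := (leb_type R N).
Local Notation mu := (@leb R N).

Definition obox (a b : V) : set V := [set x | forall i, a ord0 i < x ord0 i < b ord0 i].

Definition rat_row (q : 'rV[rat]_N.+1) : V := \row_i ratr (q ord0 i).

Lemma measurable_leb_coord (i : 'I_N.+1) :
  measurable_fun setT ((fun x : V => x ord0 i) : T -> R).
Proof.
move=> mT; apply: (measurability _ (RGenOInfty.measurableE R)) => //.
move=> /= _ [_ [s ->] <-]; rewrite setTI.
rewrite [X in measurable X](_ : _ = [set x : V | s < x ord0 i]).
  exact: measurable_leb_half.
by apply/seteqP; split => x /=; rewrite in_itv /= andbT.
Qed.

Lemma measurable_obox (a b : V) : measurable (obox a b : set T).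
Proof.
rewrite (_ : obox a b = \bigcap_(i in [set: 'I_N.+1])
   ((fun x : V => x ord0 i) @^-1` `]a ord0 i, b ord0 i[%classic)).
  apply: fin_bigcap_measurable => [|i _]; first exact: finite_finset.
  by rewrite -[X in measurable X]setTI; apply: measurable_leb_coord.
apply/seteqP; split => x /= h i; first by move=> _; rewrite /= in_itv /=.
by have := h i I; rewrite /= in_itv.
Qed.

Lemma open_rat_obox (O : set V) (x : V) : open O -> O x ->
  exists q r : 'rV[rat]_N.+1, obox (rat_row q) (rat_row r) x /\
    obox (rat_row q) (rat_row r) `<=` O.
Proof.
rewrite openE => /(_ x) /[apply]; rewrite /interior -nbhs_ballE => -[e /= e0 xeO].
have hq (i : 'I_N.+1) : {q : rat | x ord0 i - e < ratr q < x ord0 i}.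
  apply: cid; have [q] := @rat_in_itvoo R (x ord0 i - e) (x ord0 i) (ltac:(by rewrite ltrBlDr ltrDl)).
  by rewrite in_itv /=; exists q.
have hr (i : 'I_N.+1) : {q : rat | x ord0 i < ratr q < x ord0 i + e}.
  apply: cid; have [q] := @rat_in_itvoo R (x ord0 i) (x ord0 i + e) (ltac:(by rewrite ltrDl)).
  by rewrite in_itv /=; exists q.
exists (\row_i sval (hq i)), (\row_i sval (hr i)); split.
  move=> i; rewrite !mxE; case: (hq i) (hr i) => q /= /andP[_ ->] [r /= /andP[-> _]] //.
move=> y yqr; apply: xeO; split => // i j; rewrite (ord1 i).
have := yqr j; rewrite !mxE; case: (hq j) (hr j) => q /= /andP[h1 _] [r /= /andP[_ h2]].
move=> /andP[h3 h4]; rewrite /ball /= ltr_norml; apply/andP; split; lra.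
Qed.

(** An open set is the union of the open boxes with rational corners that it contains, a countable
    family. *)
Lemma measurable_leb_open (O : set V) : open O -> measurable (O : set T).
Proof.
move=> oO.
rewrite (_ : O = \bigcup_(qr : 'rV[rat]_N.+1 * 'rV[rat]_N.+1)
  (if `[< obox (rat_row qr.1) (rat_row qr.2) `<=` O >]
   then obox (rat_row qr.1) (rat_row qr.2) else set0)).
  apply: (@countable_bigcupT_measurable _ T) => [|qr]; first exact: countableP.
  by case: ifP => _; [exact: measurable_obox | exact: measurable0].
apply/seteqP; split => x.
  move=> /(open_rat_obox oO)[q [r [xqr qrO]]]; exists (q, r) => //=.
  by move/asboolP : (qrO) => ->.
by move=> [[q r] _ /=]; case: ifPn => // /asboolP; exact.
Qed.

Lemma measurable_leb_closed (F : set V) : closed F -> measurable (F : set T).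
Proof.
move=> /closed_openC/measurable_leb_open mF.
by rewrite -(setCK (F : set T)); exact: measurableC.
Qed.

Lemma measurable_leb_compact (K : set V) : compact K -> measurable (K : set T).
Proof.
move=> cK; apply: measurable_leb_closed; apply: compact_closed => //.
Qed.

Lemma continuous_leb_measurable (u : V -> R) : continuous u ->
  measurable_fun setT (u : T -> R).
Proof.
move=> /continuousP cu mT; apply: (measurability _ (RGenOpens.measurableE R)) => //.
move=> _ [_ [a [b ->] <-]]; rewrite setTI.
by apply: measurable_leb_open; apply: cu; exact: interval_open.
Qed.

Lemma le_coord_norm (x : V) i : `|x ord0 i| <= `|x|.
Proof.
by rewrite [leRHS]/Num.norm /= mx_normrE; apply/bigmax_geP; right; exists (ord0, i).
Qed.

Lemma leb_bounded (A : set V) : bounded_set A -> (leb_outer A < +oo)%E.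
Proof.
move=> [M [Mr hM]].
have {}hM x i : A x -> `|x ord0 i| < M + 2.
  move=> Ax; apply: (@le_lt_trans _ _ `|x|); last first.
    by apply: (@le_lt_trans _ _ (M + 1)); [apply: hM => //; rewrite ltrDl|rewrite ltrD2l ltr1n].
  exact: le_coord_norm.
apply: (@le_lt_trans _ _ (leb_outer (box (const_mx (- (M + 2))) (const_mx (M + 2)) : set V))).
  apply: le_leb_outer => x Ax i; rewrite !mxE.
  by have := hM x i Ax; rewrite ltr_norml => /andP[-> /ltW ->].
by apply: (le_lt_trans (leb_outer_box _ _)); rewrite ltry.
Qed.

End leb_open.

(** * Translation invariance of Lebesgue measure *)

Section leb_translation.
Context {R : realType} {N : nat}.
Local Notation V := 'rV[R]_N.+1.
Local Notation T := (leb_type R N).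
Local Notation mu := (@leb R N).

Let shiftr (c : V) : V -> V := fun x => x + c.

Let leb_outer_shift_le (c : V) (A : set V) :
  (leb_outer (shiftr c @^-1` A) <= leb_outer A)%E.
Proof.
apply: le_ereal_inf_tmp => _ [b Ab <-]; apply: ereal_inf_lbound.
exists (fun k => ((b k).1 - c, (b k).2 - c)).
  move=> x /Ab[k _ xb]; exists k => // i; rewrite !mxE /=.
  by have := xb i; rewrite mxE ltrBlDr lerBrDr.
apply: eq_eseriesr => k _; congr EFin; apply: eq_bigr => i _; rewrite !mxE /=.
by congr Num.max; ring.
Qed.

Lemma leb_outer_shift (c : V) (A : set V) :
  leb_outer ((fun x => x + c) @^-1` A) = leb_outer A.
Proof.
apply/eqP; rewrite eq_le leb_outer_shift_le /=.
rewrite -[X in (_ X <= _)%E](_ : shiftr (- c) @^-1` (shiftr c @^-1` A) = _).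
  exact: leb_outer_shift_le.
by apply/seteqP; split => x /=; rewrite /shiftr subrK.
Qed.

Lemma measurable_leb_shift (c : V) :
  measurable_fun setT ((fun x : V => x + c) : T -> T).
Proof.
move=> _ A mA; rewrite setTI.
have {}mA : (@leb_outer R N).-caratheodory (A : set V) by exact: mA.
suff : (@leb_outer R N).-caratheodory (shiftr c @^-1` (A : set V)) by exact.
move=> X.
have h (Y : set V) : (shiftr (- c) @^-1` (Y `&` shiftr c @^-1` A)) =
    (shiftr (- c) @^-1` Y) `&` A.
  by apply/seteqP; split => x /=; rewrite /shiftr subrK.
rewrite -(leb_outer_shift (- c) X) (mA (shiftr (- c) @^-1` X)).
congr (_ + _)%E; rewrite -[RHS](leb_outer_shift (- c)); congr leb_outer.
  by apply/seteqP; split => x /=; rewrite /shiftr subrK.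
by apply/seteqP; split => x /=; rewrite /shiftr subrK.
Qed.

Lemma Rintegral_leb_shift (c : V) (f : V -> R) :
  measurable_fun setT (f : T -> R) ->
  mu.-integrable setT (fun x : T => (f ((x : V) + c))%:E) ->
  \int[mu]_x f ((x : V) + c) = \int[mu]_x f x.
Proof.
move=> mf intf; rewrite /Rintegral; congr fine.
have mfE : measurable_fun setT (EFin \o (f : T -> R)) by exact/measurable_EFinP.
rewrite -(@integral_pushforward _ _ T T R _ (measurable_leb_shift c) mu setT _ mfE)//.
apply: (@eq_measure_integral _ T R setT mu
  (measure_function_pushforward__canonical__measure_function_Measure mu (measurable_leb_shift c))).
by move=> A mA _; exact: leb_outer_shift.
Qed.

End leb_translation.

(** * Measurable hulls *)

Section leb_hull.
Context {R : realType} {N : nat}.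
Local Notation V := 'rV[R]_N.+1.
Local Notation T := (leb_type R N).
Local Notation mu := (@leb R N).

Definition half_spaces : set (set V) :=
  [set H | exists i s, H = [set x : V | s < x ord0 i]].

Lemma box_sigma_half (a b : V) : <<s half_spaces >> (box a b).
Proof.
have sa := smallest_sigma_algebra (@setT V) half_spaces.
rewrite (_ : box a b = \bigcap_(i in [set: 'I_N.+1])
   ([set x : V | a ord0 i < x ord0 i] `\` [set x : V | b ord0 i < x ord0 i])); last first.
  apply/seteqP; split => x /= h i.
    by move=> _ /=; have /andP[-> h2] := h i; split => //; apply/negP; rewrite -leNgt.
  by have [/= -> /negP] := h i I; rewrite -leNgt.
apply: (@fin_bigcap_measurable _ (g_sigma_algebraType half_spaces)) => [|i _].
  exact: finite_finset.
by apply: measurableD; apply: sub_sigma_algebra; eexists; eexists.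
Qed.

(** B is the intersection of covers by boxes whose total volumes exceed the measure of A by less
    than 1 / (n + 1). That B lies in the sigma-algebra generated by half spaces is the point: an
    arbitrary measurable A is only known through Caratheodory's condition, whereas statements about
    B can be proved on generators. *)
Lemma leb_hull (A : set V) : measurable (A : set T) -> (mu A < +oo)%E ->
  exists B : set V, [/\ <<s half_spaces >> B, A `<=` B, measurable (B : set T) &
    mu (B `\` A) = 0%E].
Proof.
move=> mA Afin.
have A_fin : leb_outer A \is a fin_num by rewrite ge0_fin_numE// leb_outer_ge0.
have hc (n : nat) : {c | box_cover A c /\
    (\sum_(k <oo) (box_volume (c k).1 (c k).2)%:E < leb_outer A + (n.+1%:R^-1)%:E)%E}.
  apply: cid; have n0 : 0 < n.+1%:R^-1 :> R by [].
  by have [_ [c cA <-] h] := lb_ereal_inf_adherent n0 A_fin; exists c.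
pose B := \bigcap_n \bigcup_k box (sval (hc n) k).1 (sval (hc n) k).2.
have sB : <<s half_spaces >> B.
  apply: (@bigcapT_measurable _ (g_sigma_algebraType half_spaces)) => n.
  apply: bigcupT_measurable => k; exact: box_sigma_half.
have AB : A `<=` B.
  by move=> x Ax n _; case: (hc n) => c /= [cA _]; exact: cA.
have mB : measurable (B : set T).
  suff : <<s half_spaces >> `<=` @measurable _ T by exact.
  apply: smallest_sub; first exact: sigma_algebra_measurable.
  by move=> _ [i [s ->]]; exact: measurable_leb_half.
have BA : (mu B <= mu A)%E.
  apply/lee_addgt0Pr => e e0.
  have [n ne] : exists n : nat, n.+1%:R^-1 < e.
    have [n _ /(_ _ (leqnn _)) h] := near_infty_natSinv_lt (PosNum e0).
    by exists n.
  apply: (@le_trans _ _ (leb_outer A + (n.+1%:R^-1)%:E)%E); last first.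
    by rewrite leeD2l// lee_fin ltW.
  apply: (le_trans _ (ltW (svalP (hc n)).2)).
  apply: ereal_inf_lbound; exists (sval (hc n)) => //.
  by move=> x /(_ n I).
exists B; split => //.
rewrite measureD//; last by rewrite (le_lt_trans BA).
rewrite setIidr//; apply/eqP; rewrite sube_eq//; last first.
  by rewrite ge0_fin_numE ?(le_lt_trans BA)//; exact: leb_outer_ge0.
by rewrite add0e eq_le BA /=; exact: le_leb_outer.
Qed.

End leb_hull.

(** * Smooth cutoffs and test functions *)

Section smooth_algebra.
Context {R : realType} {N : nat}.
Local Notation V := 'rV[R]_N.+1.
Implicit Types (u v : V -> R).

(** A recursive counterpart of [smooth] that peels off the innermost derivative, so that closure
    under products, inverses and composition is an induction on the order. *)
Fixpoint Ck n u : Prop := (forall x, differentiable u x) /\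
  if n is n'.+1 then forall i, Ck n' (partial i u) else True.

Lemma smoothP u : smooth u <-> forall n, Ck n u.
Proof.
split.
  move=> + n; elim: n u => [|n IH] u su /=; first by split => // x; exact: (su [::]).
  split => [x|i]; first exact: (su [::]).
  by apply: IH => s x; have := su (rcons s i) x; rewrite foldr_rcons.
move=> + s; elim/last_ind: s u => [|s i IH] u cu x; first by case: (cu 0%N).
by rewrite foldr_rcons; apply: IH => n; have [_] := cu n.+1; exact.
Qed.

Lemma CkW n u : Ck n.+1 u -> Ck n u.
Proof.
by elim: n u => [|n IH] u [du Cu]; split => // i; apply: IH; exact: Cu.
Qed.

Lemma Ck_diff n u : Ck n u -> forall x, differentiable u x.
Proof. by case: n => [|n] []. Qed.

Lemma Ck_partial n i u : Ck n.+1 u -> Ck n (partial i u).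
Proof. by move=> [_]; exact. Qed.

Lemma smooth_diff u : smooth u -> forall x, differentiable u x.
Proof. by move=> su; exact: (su [::]). Qed.

Lemma smooth_continuous u : smooth u -> continuous u.
Proof. by move=> su x; apply: differentiable_continuous; exact: smooth_diff. Qed.

Lemma smooth_partial i u : smooth u -> smooth (partial i u).
Proof. by move=> su s x; have := su (rcons s i) x; rewrite foldr_rcons. Qed.

Lemma diff_partial u x i : differentiable u x -> derivable u x (delta_mx ord0 i).
Proof. by move=> du; exact: diff_derivable. Qed.

Lemma partial_add u v i x : differentiable u x -> differentiable v x ->
  partial i (fun y => u y + v y) x = partial i u x + partial i v x.
Proof. by move=> du dv; apply: deriveD; exact: diff_partial. Qed.

Lemma partial_mul u v i x : differentiable u x -> differentiable v x ->
  partial i (fun y => u y * v y) x = u x * partial i v x + v x * partial i u x.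
Proof. by move=> du dv; apply: deriveM; exact: diff_partial. Qed.

Lemma partial_inv u i x : differentiable u x -> u x != 0 ->
  partial i (fun y => (u y)^-1) x = - (u x) ^- 2 * partial i u x.
Proof. by move=> du ux; apply: deriveV => //; exact: diff_partial. Qed.

Lemma partial_comp (g : R -> R) u i x : differentiable u x -> derivable g (u x) 1 ->
  partial i (fun y => g (u y)) x = 'D_1 g (u x) * partial i u x.
Proof.
move=> du /derivable1_diffP dg; rewrite /partial.
rewrite deriveE; last exact: (@differentiable_comp _ _ _ _ u g).
rewrite (@diff_comp _ _ _ _ u g)//= -[in LHS]deriveE//.
set d := 'D__ u x; have -> : 'd u x (delta_mx ord0 i) = d *: (1 : R).
  by rewrite -deriveE// -[RHS]/(d * 1) mulr1.
by rewrite deriveE// linearZ /= -deriveE// -[LHS]/(_ * _) mulrC.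
Qed.

Lemma partial_cst (c : R) (i : 'I_N.+1) : partial i (fun=> c) = (fun=> 0).
Proof. by apply/funext => x; exact: derive_cst. Qed.

Lemma Ck_cst n (c : R) : Ck n (fun _ : V => c).
Proof.
elim: n c => [|n IH] c; (split; first by move=> x; exact: differentiable_cst) => // i.
by rewrite partial_cst.
Qed.

Lemma Ck_add n u v : Ck n u -> Ck n v -> Ck n (fun x => u x + v x).
Proof.
elim: n u v => [|n IH] u v [du Cu] [dv Cv];
  (split; first by move=> x; exact: differentiableD) => // i.
rewrite (_ : partial i _ = fun x => partial i u x + partial i v x).
  by apply: (IH (partial i u) (partial i v)); [exact: Cu|exact: Cv].
by apply/funext => x; rewrite partial_add.
Qed.

Lemma Ck_mul n u v : Ck n u -> Ck n v -> Ck n (fun x => u x * v x).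
Proof.
elim: n u v => [|n IH] u v Cu Cv;
  (split; first by move=> x; apply: differentiableM; [exact: Ck_diff Cu x|exact: Ck_diff Cv x]) => // i.
rewrite (_ : partial i _ = fun x => u x * partial i v x + v x * partial i u x).
  apply: Ck_add.
    by apply: (IH u (partial i v)); [exact: CkW|exact: Ck_partial].
  by apply: (IH v (partial i u)); [exact: CkW|exact: Ck_partial].
by apply/funext => x; rewrite partial_mul//; [exact: Ck_diff Cu x|exact: Ck_diff Cv x].
Qed.

Lemma Ck_inv n u : (forall x, u x != 0) -> Ck n u -> Ck n (fun x => (u x)^-1).
Proof.
move=> u0; elim: n => [|n IH] Cu;
  (split; first by move=> x; apply: differentiableV => //; exact: Ck_diff Cu x) => // i.
rewrite (_ : partial i _ = fun x => (-1) * (((u x)^-1 * (u x)^-1) * partial i u x)).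
  apply: Ck_mul; first exact: Ck_cst.
  have Cn := IH (CkW Cu).
  by apply: Ck_mul; [exact: Ck_mul|exact: Ck_partial].
apply/funext => x; rewrite partial_inv//; last exact: Ck_diff Cu x.
by rewrite -exprVn expr2 mulN1r mulNr.
Qed.

(** G lists a function of one variable together with all its successive derivatives. *)
Definition derivatives (G : nat -> R -> R) := forall k y, is_derive y (1 : R) (G k) (G k.+1 y).

Lemma Ck_comp n (G : nat -> R -> R) k u : derivatives G ->
  Ck n u -> Ck n (fun x => G k (u x)).
Proof.
move=> dG; have dGk j y : derivable (G j) y 1 by have [] := dG j y.
elim: n k => [|n IH] k Cu.
  split => // x; apply: (@differentiable_comp _ _ _ _ u (G k)); first exact: Ck_diff Cu x.
  exact/derivable1_diffP.
split => [x|i].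
  apply: (@differentiable_comp _ _ _ _ u (G k)); first exact: Ck_diff Cu x.
  exact/derivable1_diffP.
rewrite (_ : partial i _ = fun x => G k.+1 (u x) * partial i u x).
  by apply: Ck_mul; [apply: IH; exact: CkW|exact: Ck_partial].
apply/funext => x; rewrite partial_comp//; last exact: Ck_diff Cu x.
by congr (_ * _); have [_ ->] := dG k (u x).
Qed.

Lemma smooth_cst (c : R) : smooth (fun _ : V => c).
Proof. by apply/smoothP => n; exact: Ck_cst. Qed.

Lemma smooth_add u v : smooth u -> smooth v -> smooth (fun x => u x + v x).
Proof. by move=> /smoothP su /smoothP sv; apply/smoothP => n; exact: Ck_add. Qed.

Lemma smooth_mul u v : smooth u -> smooth v -> smooth (fun x => u x * v x).
Proof. by move=> /smoothP su /smoothP sv; apply/smoothP => n; exact: Ck_mul. Qed.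

Lemma smooth_inv u : (forall x, u x != 0) -> smooth u -> smooth (fun x => (u x)^-1).
Proof. by move=> u0 /smoothP su; apply/smoothP => n; exact: Ck_inv. Qed.

Lemma smooth_comp (G : nat -> R -> R) u : derivatives G -> smooth u ->
  smooth (fun x => G 0%N (u x)).
Proof. by move=> dG /smoothP su; apply/smoothP => n; exact: Ck_comp. Qed.

Lemma smooth_opp u : smooth u -> smooth (fun x => - u x).
Proof.
move=> su; rewrite (_ : (fun _ => _) = fun x => (-1) * u x).
  by apply: smooth_mul => //; exact: smooth_cst.
by apply/funext => x; rewrite mulN1r.
Qed.

Lemma smooth_sub u v : smooth u -> smooth v -> smooth (fun x => u x - v x).
Proof. by move=> su sv; apply: smooth_add => //; exact: smooth_opp. Qed.

Lemma smooth_prod (I : finType) (w : I -> V -> R) : (forall i, smooth (w i)) ->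
  smooth (fun x => \prod_i w i x).
Proof.
move=> sw; elim: (index_enum I) => [|i r IH].
  by under eq_fun do rewrite big_nil; exact: smooth_cst.
by under eq_fun do rewrite big_cons; exact: smooth_mul.
Qed.

Lemma smooth_coord i : smooth (fun x : V => x ord0 i).
Proof.
apply/smoothP => -[|n]; (split; first by move=> x; exact: differentiable_coord) => // j.
rewrite (_ : partial j _ = fun=> (delta_mx ord0 j : V) ord0 i); first exact: Ck_cst.
apply/funext => x; rewrite /partial deriveE; last exact: differentiable_coord.
have @f : {linear V -> R}.
  by exists (fun y : V => y ord0 i); do 2![eexists]; do ?[constructor];
     rewrite ?mxE// => ? *; rewrite ?mxE//; move=> ?; rewrite !mxE.
rewrite (_ : (fun _ => _) = f)// diff_lin//; exact: coord_continuous.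
Qed.

End smooth_algebra.

(** * The flat function exp(-1/x) and a smooth step *)

Section flat_function.
Context {R : realType}.
Implicit Types P : {poly R}.

(** The functions P(1/x) exp(-1/x), extended by 0 to x <= 0, form a class stable under
    differentiation; this yields all derivatives of exp(-1/x) at once. *)
Definition flat_poly P (x : R) : R := if 0 < x then P.[x^-1] * expR (- x^-1) else 0.

Lemma exprn_expRN_bounded k : exists C : R, forall y, 0 <= y -> y ^+ k * expR (- y) <= C.
Proof.
case: k => [|k].
  by exists 1 => y y0; rewrite expr0 mul1r -expR0 ler_expR oppr_le0.
exists (k.+1`!%:R) => y y0; rewrite expRN ler_pdivrMr ?expR_gt0//.
rewrite -ler_pdivrMl ?ltr0n ?fact_gt0// mulrC.
by apply: le_trans (expR_ge1Dxn k y0); rewrite lerDr.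
Qed.

Lemma horner_expRN_bounded P k :
  exists C : R, forall y, 0 <= y -> `|P.[y]| * y ^+ k * expR (- y) <= C.
Proof.
elim/poly_ind: P k => [|P c IH] k.
  by exists 0 => y y0; rewrite horner0 normr0 !mul0r.
have [C1 h1] := IH k.+1; have [C2 h2] := exprn_expRN_bounded k.
exists (C1 + `|c| * C2) => y y0; rewrite !hornerE.
have e0 := expR_ge0 (- y); have yk := exprn_ge0 k y0.
apply: (@le_trans _ _ ((`|P.[y]| * y + `|c|) * y ^+ k * expR (- y))).
  by rewrite !ler_wpM2r// (le_trans (ler_normD _ _))// normrM (ger0_norm y0).
rewrite [leLHS](_ : _ = `|P.[y]| * y ^+ k.+1 * expR (- y) + `|c| * (y ^+ k * expR (- y))); last first.
  by rewrite exprS; ring.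
by rewrite lerD ?h1// ler_wpM2l ?h2.
Qed.

(** With y = 1/x this is the boundedness of |P(y)| y^2 exp(-y). Quadratic decay makes the derivative
    at 0 exist and vanish. *)
Lemma flat_poly_bound P : exists C : R, forall x, `|flat_poly P x| <= C * x ^+ 2.
Proof.
have [C hC] := horner_expRN_bounded P 2.
have C0 : 0 <= C by apply: le_trans (hC 0 (lexx _)); rewrite !mulr_ge0// expR_ge0.
exists C => x; rewrite /flat_poly; case: ifPn => [x0|_]; last first.
  by rewrite normr0 mulr_ge0// sqr_ge0.
rewrite normrM [X in _ * X]ger0_norm ?expR_ge0//.
rewrite -ler_pdivrMr ?exprn_gt0// -exprVn mulrAC.
by apply: hC; rewrite invr_ge0 ltW.
Qed.

(** The derivative of P(1/x) exp(-1/x) is x^-2 (P - P')(1/x) exp(-1/x). *)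
Definition next_poly P := 'X^2 * (P - P^`()).

Lemma is_derive_flat_poly P (x : R) :
  is_derive x (1 : R) (flat_poly P) (flat_poly (next_poly P) x).
Proof.
have [x0|x0|->] := ltgtP x 0.
- rewrite {2}/flat_poly ltNge (ltW x0) /=.
  have d0 := @is_derive_cst R R R 0 x 1.
  apply: near_eq_is_derive d0.
  near=> y; rewrite /flat_poly /= ltNge ifN// negbK.
  by apply: ltW; near: y; exact: lt_nbhsl.
- rewrite {2}/flat_poly x0.
  have xn0 : x != 0 by rewrite gt_eqF.
  have dV : is_derive x (1 : R) (fun y : R => y^-1) (- x ^- 2 *: 1).
    exact: (@is_deriveV R id x 1 1).
  have d1 : is_derive x (1 : R) (fun y : R => P.[y^-1]) (P^`().[x^-1] * (- x ^- 2 *: 1)).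
    exact: (@is_derive1_comp R (horner P) (fun y : R => y^-1)).
  have dVN : is_derive x (1 : R) (fun y : R => - y^-1) (- (- x ^- 2 *: 1)).
    exact: (@is_deriveN _ _ _ (fun y : R => y^-1)).
  have d2 : is_derive x (1 : R) (fun y : R => expR (- y^-1)) (expR (- x^-1) * (- (- x ^- 2 *: 1))).
    exact: (@is_derive1_comp R expR (fun y : R => - y^-1)).
  have d3 : is_derive x (1 : R) (fun y : R => P.[y^-1] * expR (- y^-1))
     ((next_poly P).[x^-1] * expR (- x^-1)).
    apply: is_derive_eq (is_deriveM d1 d2) _.
    by rewrite /next_poly !hornerE -exprVn /GRing.scale /=; ring.
  apply: near_eq_is_derive d3.
  near=> y; rewrite /flat_poly ifT//.
  by near: y; exact: lt_nbhsr.
(* At the origin the slope function is the quotient by z itself; its value at z = 0 is 0 by the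
   convention for division by 0, which is the derivative sought. *)
- apply/is_derive1_caratheodory.
  exists (fun z => flat_poly P z / z); split.
  + move=> z; rewrite {2}/flat_poly ltxx !subr0.
    have [->|z0] := eqVneq z 0; last by rewrite divfK.
    by rewrite mulr0 /flat_poly ltxx.
  + have [C hC] := flat_poly_bound P.
    have C0 : 0 <= C by have := hC 1; rewrite expr1n mulr1; exact: le_trans.
    apply/cvgrPdist_le => e e0 /=.
    rewrite /flat_poly ltxx mul0r -/(flat_poly P _).
    near=> z; rewrite sub0r normrN -/(flat_poly P z).
    have [->|z0] := eqVneq z 0; first by rewrite invr0 mulr0 normr0 ltW.
    rewrite normrM normfV ler_pdivrMr ?normr_gt0//.
    apply: (le_trans (hC z)); rewrite -real_normK ?num_real// expr2 mulrA.
    rewrite ler_wpM2r//.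
    apply: (@le_trans _ _ ((C + 1) * `|z|)); first by rewrite ler_wpM2r// lerDl.
    rewrite -ler_pdivlMl ?ltr_wpDl// mulrC.
    near: z; apply: (@nbhs0_le _ R^o); by rewrite divr_gt0// ltr_wpDl.
  + by rewrite /flat_poly ltxx mul0r.
Unshelve. all: by end_near. Qed.

Definition flat_derivative k : R -> R := flat_poly (iter k next_poly 1).

Lemma flat_derivatives : derivatives flat_derivative.
Proof. by move=> k y; rewrite /flat_derivative iterS; exact: is_derive_flat_poly. Qed.

Definition flat : R -> R := flat_derivative 0.

Lemma flatE x : flat x = if 0 < x then expR (- x^-1) else 0.
Proof. by rewrite /flat /flat_derivative /flat_poly /=; case: ifP; rewrite ?hornerE. Qed.

Lemma flat_ge0 x : 0 <= flat x.
Proof. by rewrite flatE; case: ifP => // _; exact: expR_ge0. Qed.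

Lemma flat_gt0 x : (0 < flat x) = (0 < x).
Proof. by rewrite flatE; case: ifP; rewrite ?expR_gt0 ?ltxx. Qed.

Lemma flat_eq0 x : x <= 0 -> flat x = 0.
Proof. by rewrite flatE ltNge => ->. Qed.

Lemma flat_denom_gt0 x : 0 < flat x + flat (1 - x).
Proof.
have [x0|x0] := ltP 0 x; first by rewrite ltr_pwDl ?flat_gt0 ?flat_ge0.
by rewrite ltr_wpDl ?flat_ge0// flat_gt0; lra.
Qed.

Definition step x := flat x * (flat x + flat (1 - x))^-1.

Lemma step_eq0 x : x <= 0 -> step x = 0.
Proof. by move=> x0; rewrite /step flat_eq0// mul0r. Qed.

Lemma step_eq1 x : 1 <= x -> step x = 1.
Proof.
move=> x1; have := flat_denom_gt0 x; rewrite /step (@flat_eq0 (1 - x)) ?addr0; last lra.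
by move=> h; rewrite divff// gt_eqF.
Qed.

Lemma step_gt0 x : (0 < step x) = (0 < x).
Proof. by rewrite /step pmulr_lgt0 ?flat_gt0// invr_gt0 flat_denom_gt0. Qed.

Lemma step_ge0 x : 0 <= step x.
Proof. by rewrite /step mulr_ge0 ?invr_ge0 ?(ltW (flat_denom_gt0 _))// flat_ge0. Qed.

Lemma step_le1 x : step x <= 1.
Proof. by rewrite /step ler_pdivrMr ?flat_denom_gt0// mul1r lerDl flat_ge0. Qed.

End flat_function.

(** * Smooth functions of one real variable *)

Section smooth_real_functions.
Context {R : realType} {N : nat}.
Local Notation V := 'rV[R]_N.+1.
Implicit Types (g dg h dh : R -> R).

(** Smoothness of g is recorded only through what is used: an explicit continuous first derivative,
    and stability of [smooth] under composition with g. *)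
Definition smooth1 g dg := [/\ forall x, is_derive x (1 : R) g (dg x), continuous dg &
  forall u : V -> R, smooth u -> smooth (fun x => g (u x))].

Lemma is_derive_continuous g x (d : R) : is_derive x (1 : R) g d -> {for x, continuous g}.
Proof. by move=> [+ _] => /derivable1_diffP/differentiable_continuous. Qed.

Lemma smooth1_continuous g dg : smooth1 g dg -> continuous g.
Proof. by move=> [d _ _] x; exact: is_derive_continuous (d x). Qed.

Lemma smooth1_ext g g' dg : smooth1 g dg -> g =1 g' -> smooth1 g' dg.
Proof. by move=> + /funext <-. Qed.

Lemma smooth1_flat : smooth1 (@flat R) (flat_derivative 1).
Proof.
split.
- exact: flat_derivatives.
- by move=> x; exact: is_derive_continuous (flat_derivatives 1 x).
- by move=> u su; exact: (smooth_comp flat_derivatives su).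
Qed.

Lemma smooth1_id : smooth1 id (fun=> 1).
Proof. by split => // x; [exact: is_derive_id|exact: cst_continuous]. Qed.

Lemma smooth1_add g dg h dh : smooth1 g dg -> smooth1 h dh ->
  smooth1 (fun x => g x + h x) (fun x => dg x + dh x).
Proof.
move=> [d1 c1 s1] [d2 c2 s2]; split => [x|x|u su].
- exact: is_deriveD.
- by apply: cvgD; [exact: c1|exact: c2].
- by apply: smooth_add; [exact: s1|exact: s2].
Qed.

Lemma smooth1_mul g dg h dh : smooth1 g dg -> smooth1 h dh ->
  smooth1 (fun x => g x * h x) (fun x => g x * dh x + h x * dg x).
Proof.
move=> sg sh; have cg := smooth1_continuous sg; have ch := smooth1_continuous sh.
case: sg sh => [d1 c1 s1] [d2 c2 s2]; split => [x|x|u su].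
- exact: is_deriveM.
- by apply: cvgD; apply: cvgM; [exact: cg|exact: c2|exact: ch|exact: c1].
- by apply: smooth_mul; [exact: s1|exact: s2].
Qed.

Lemma smooth1_inv g dg : (forall x, g x != 0) -> smooth1 g dg ->
  smooth1 (fun x => (g x)^-1) (fun x => - (g x) ^- 2 * dg x).
Proof.
move=> g0 sg; have cg := smooth1_continuous sg; case: sg => [d1 c1 s1]; split => [x|x|u su].
- exact: is_deriveV.
- apply: cvgM; last exact: c1.
  apply: cvgN; apply: cvgV; first by rewrite expf_neq0.
  by rewrite expr2; under eq_fun do rewrite expr2; apply: cvgM; exact: cg.
- by apply: (@smooth_inv _ _ (fun x => g (u x))) => //; exact: s1.
Qed.

Lemma smooth1_affine (a b : R) g dg : smooth1 g dg ->
  smooth1 (fun x => g (a * x + b)) (fun x => dg (a * x + b) * a).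
Proof.
move=> sg; have cg := smooth1_continuous sg; case: sg => [d1 c1 s1].
have daff x : is_derive x (1 : R) (fun x : R => a * x + b) a.
  have /is_derive_eq : is_derive x (1 : R) ((a \*: id) + cst b) (a *: 1 + 0).
    by apply: is_deriveD.
  by apply; rewrite addr0 /GRing.scale /= mulr1.
split => [x|x|u su].
- exact: (@is_derive1_comp R g (fun x : R => a * x + b)).
- apply: cvgM; last exact: cvg_cst.
  apply: (@continuous_comp _ _ _ (fun x : R => a * x + b) dg); last exact: c1.
  exact: is_derive_continuous (daff x).
- apply: (s1 (fun x => a * u x + b)); apply: smooth_add; last exact: smooth_cst.
  by apply: smooth_mul => //; exact: smooth_cst.
Qed.

Lemma smooth1_step : exists dg, smooth1 (@step R) dg.
Proof.
eexists; rewrite /step.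
apply: smooth1_mul smooth1_flat _; apply: smooth1_inv.
  by move=> x; rewrite gt_eqF// flat_denom_gt0.
apply: smooth1_add smooth1_flat _.
by apply: smooth1_ext (smooth1_affine (-1) 1 smooth1_flat) _ => x; congr flat; ring.
Qed.

Lemma smooth1_supp_bounded g dg (L : R) : smooth1 g dg ->
  (forall x, L < `|x| -> g x = 0) -> exists C, forall x, `|dg x| <= C.
Proof.
move=> [d1 c1 _] gL.
have dg0 x : L < `|x| -> dg x = 0.
  move=> Lx; have [_ <-] := d1 x.
  rewrite (@near_eq_derive _ _ _ g (cst 0)) ?derive_cst//.
  near=> y; apply: gL; near: y.
  have : {for x, continuous (fun y : R => `|y|)} by exact: norm_continuous.
  by move=> /cvgr_gt; apply.
have [L0|L0] := ltP L 0.
  by exists 0 => x; rewrite dg0 ?normr0// (lt_le_trans L0).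
have cabs : {within `[(- L), L], continuous (fun x => `|dg x|)}.
  apply: continuous_subspaceT => x; apply: cvg_norm; exact: c1.
have [c _ hc] := @EVT_max R _ (- L) L (ltac:(lra)) cabs.
exists (Num.max 0 `|dg c|) => x; have [Lx|xL] := ltP L `|x|.
  by rewrite dg0// normr0 le_max lexx.
by rewrite le_max hc ?orbT// in_itv /= -ler_norml.
Unshelve. all: by end_near. Qed.

End smooth_real_functions.

(** * Smooth cutoffs on the line *)

Section plateau.
Context {R : realType}.

Definition plateau (M x : R) := step (M + 1 - x) * step (M + 1 + x).

(** A smooth replacement for truncation at level M: the identity up to M, it returns to 0 beyond M +
    1 instead of becoming constant. *)
Definition clip (M x : R) := x * plateau M x.

Lemma plateau_ge0 M x : 0 <= plateau M x.
Proof. by rewrite mulr_ge0// step_ge0. Qed.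

Lemma plateau_le1 M x : plateau M x <= 1.
Proof. by rewrite mulr_ile1// ?step_ge0// step_le1. Qed.

Lemma plateau_eq1 M x : `|x| <= M -> plateau M x = 1.
Proof. by rewrite ler_norml => /andP[h1 h2]; rewrite /plateau !step_eq1 ?mulr1//; lra. Qed.

Lemma plateau_eq0 M x : M + 1 <= `|x| -> plateau M x = 0.
Proof.
rewrite ler_normr => /orP[h|h]; rewrite /plateau.
  by rewrite [X in X * _]step_eq0 ?mul0r//; lra.
by rewrite [X in _ * X]step_eq0 ?mulr0//; lra.
Qed.

Lemma clip_le M x : `|clip M x| <= `|x|.
Proof.
rewrite normrM ler_piMr// ger0_norm ?plateau_ge0// plateau_le1 //.
Qed.

Lemma clip_bounded M x : 0 <= M -> `|clip M x| <= M + 1.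
Proof.
move=> M0; have [h|h] := leP (M + 1) `|x|.
  by rewrite /clip plateau_eq0// mulr0 normr0 addr_ge0.
exact: le_trans (clip_le _ _) (ltW h).
Qed.

Lemma clip_id M x : `|x| <= M -> clip M x = x.
Proof. by move=> h; rewrite /clip plateau_eq1// mulr1. Qed.

Lemma smooth1_plateau (N : nat) M : exists dg, @smooth1 R N (plateau M) dg.
Proof.
have [dg sg] := @smooth1_step R N; eexists; rewrite /plateau.
apply: smooth1_mul.
  by apply: smooth1_ext (smooth1_affine (-1) (M + 1) sg) _ => x; congr step; ring.
by apply: smooth1_ext (smooth1_affine 1 (M + 1) sg) _ => x; congr step; ring.
Qed.

Lemma plateau_smooth (N : nat) M : exists dg, @smooth1 R N (plateau M) dg /\
  exists C, forall x, `|dg x| <= C.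
Proof.
have [dg sg] := @smooth1_plateau N M; exists dg; split => //.
by apply: (smooth1_supp_bounded (L := M + 1) sg) => x h; rewrite plateau_eq0// ltW.
Qed.

Lemma clip_smooth (N : nat) M : exists dg, @smooth1 R N (clip M) dg /\
  exists C, forall x, `|dg x| <= C.
Proof.
have [dg sg] := @smooth1_plateau N M; have sM := smooth1_mul (@smooth1_id R N) sg.
eexists; split; first exact: sM.
by apply: (smooth1_supp_bounded (L := M + 1) sM) => x h; rewrite plateau_eq0 ?mulr0// ltW.
Qed.

End plateau.

Lemma closure_sub_closed (T : topologicalType) (A F : set T) : closed F -> A `<=` F ->
  closure A `<=` F.
Proof. by move=> /closure_id {2}-> /closure_subset. Qed.

(** * Test functions and a countable family of bumps *)

Section test_functions.
Context {R : realType} {N : nat}.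
Local Notation V := 'rV[R]_N.+1.
Variable Omega : set V.
Implicit Types (phi psi : V -> R).

Lemma test_smooth phi : test_function Omega phi -> smooth phi.
Proof. by case. Qed.

(** The support of g lies in the union of the two compact supports. One criterion serves sums,
    products and all images H(phi, psi) with H(0, 0) = 0. *)
Lemma test_function_support phi psi (g : V -> R) :
  test_function Omega phi -> test_function Omega psi -> smooth g ->
  (forall x, phi x = 0 -> psi x = 0 -> g x = 0) -> test_function Omega g.
Proof.
move=> [_ c1 s1] [_ c2 s2] sg g0.
pose K := closure [set x | phi x != 0] `|` closure [set x | psi x != 0].
have cK : compact K by exact: compactU.
have gK : closure [set x | g x != 0] `<=` K.
  rewrite /K -closureU; apply: closure_subset => x /=.
  have [p0|p0 _] := eqVneq (phi x) 0; last by left.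
  by have [q0|q0 _] := eqVneq (psi x) 0; [rewrite g0// eqxx|right].
split => //.
  by apply: subclosed_compact cK gK; exact: closed_closure.
by move=> x /gK[/s1|/s2].
Qed.

Lemma test_mul (eta phi : V -> R) : smooth eta -> test_function Omega phi ->
  test_function Omega (fun x => eta x * phi x).
Proof.
move=> se tp; apply: (test_function_support tp tp).
  by apply: smooth_mul => //; exact: test_smooth.
by move=> x -> _; rewrite mulr0.
Qed.

Lemma test_add phi psi : test_function Omega phi -> test_function Omega psi ->
  test_function Omega (fun x => phi x + psi x).
Proof.
move=> tp tq; apply: (test_function_support tp tq).
  by apply: smooth_add; exact: test_smooth.
by move=> x -> ->; rewrite addr0.
Qed.

Lemma test_scale (a : R) phi : test_function Omega phi ->
  test_function Omega (fun x => a * phi x).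
Proof. by apply: test_mul; exact: smooth_cst. Qed.

Lemma test_partial i phi : test_function Omega phi -> test_function Omega (partial i phi).
Proof.
move=> [sp cp pO].
have h : [set x | partial i phi x != 0] `<=` closure [set x | phi x != 0].
  move=> x /= /eqP; apply: contra_notP => xK.
  rewrite /partial (@near_eq_derive _ _ _ phi (cst 0)) ?derive_cst//.
  have : open (~` closure [set x | phi x != 0]) by apply: closed_openC; exact: closed_closure.
  rewrite openE => /(_ x xK); apply: filterS => y /= hy.
  by apply/eqP/negPn/negP => py; apply: hy; exact: subset_closure.
have {}h : closure [set x | partial i phi x != 0] `<=` closure [set x | phi x != 0].
  by apply: closure_sub_closed h; exact: closed_closure.
split; first exact: smooth_partial.
  by apply: subclosed_compact cp h; exact: closed_closure.
exact: subset_trans h pO.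
Qed.

Lemma test_bounded phi : test_function Omega phi -> exists C : R, forall x, `|phi x| <= C.
Proof.
move=> [sp cp pO].
have cabs : {within closure [set x | phi x != 0], continuous (fun x => `|phi x|)}.
  have cphi := smooth_continuous sp.
  apply: continuous_subspaceT => x.
  exact: (continuous_comp (cphi x) (@norm_continuous _ _ _)).
have [[y Ky]|K0] := pselect (closure [set x | phi x != 0] !=set0); last first.
  exists 0 => x; have [->|px] := eqVneq (phi x) 0; first by rewrite normr0.
  by exfalso; apply: K0; exists x; exact: subset_closure.
have [c _ hc] := EVT_max_rV (ex_intro _ y Ky) cp cabs.
exists `|phi c| => x; have [->|px] := eqVneq (phi x) 0; first by rewrite normr0.
by apply: hc; rewrite inE; exact: subset_closure.
Qed.

Lemma test_support_Omega phi x : test_function Omega phi -> ~ Omega x -> phi x = 0.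
Proof.
move=> [_ _ pO] xO; apply/eqP/negPn/negP => px; apply: xO.
by apply: pO; exact: subset_closure.
Qed.

Definition box_bump (a b : V) (x : V) :=
  \prod_i (step (x ord0 i - a ord0 i) * step (b ord0 i - x ord0 i)).

Lemma smooth_bump a b : smooth (box_bump a b).
Proof.
have [dg [_ _ sg]] := @smooth1_step R N.
apply: smooth_prod => i; apply: smooth_mul.
  apply: (sg (fun x => x ord0 i - a ord0 i)).
  by apply: smooth_sub; [exact: smooth_coord|exact: smooth_cst].
apply: (sg (fun x => b ord0 i - x ord0 i)).
by apply: smooth_sub; [exact: smooth_cst|exact: smooth_coord].
Qed.

Lemma bump_neq0 a b x : (box_bump a b x != 0) <-> obox a b x.
Proof.
rewrite /box_bump; split => [/prodf_neq0 h i|h].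
  have := h i isT; rewrite mulf_eq0 negb_or => /andP[h1 h2].
  have : 0 < step (x ord0 i - a ord0 i) by rewrite lt0r h1 step_ge0.
  have : 0 < step (b ord0 i - x ord0 i) by rewrite lt0r h2 step_ge0.
  by rewrite !step_gt0 !subr_gt0 => -> ->.
apply/prodf_neq0 => i _; have /andP[h1 h2] := h i.
by rewrite mulf_neq0// gt_eqF// step_gt0 subr_gt0.
Qed.

Lemma test_bump a b (y : V) (e : R) : 0 < e -> obox a b `<=` ball y (e / 2) ->
  ball y e `<=` Omega -> test_function Omega (box_bump a b).
Proof.
have -> : obox a b = [set x | box_bump a b x != 0].
  by apply/seteqP; split => x /bump_neq0.
move=> e0 be eO; have e20 : 0 < e / 2 by rewrite divr_gt0.
have cb : closure [set x | box_bump a b x != 0] `<=` [set x | `|y - x| <= e / 2].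
  rewrite -[X in _ `<=` X]/(closed_ball_ (fun x : V => `|x|) y (e / 2)) -closed_ballE//.
  apply: closure_sub_closed; first exact: closed_ball_closed.
  exact: subset_trans be (@subset_closed_ball _ _ _ _).
split; first exact: smooth_bump.
  apply: bounded_closed_compact; last exact: closed_closure.
  exists (`|y| + e / 2); split; first exact: num_real.
  move=> M yM x /cb /= xy; apply: ltW; apply: le_lt_trans yM.
  rewrite -[x in `|x| <= _](subrK y) addrC (le_trans (ler_normD _ _))// lerD2l.
  by rewrite distrC.
move=> x /cb /= xy; apply: eO; rewrite -ball_normE /=; apply: (le_lt_trans xy).
by rewrite ltr_pdivrMr// ltr_pMr// ltr1n.
Qed.

(** Rational corners make the family of bumps countable, so that the exceptional null sets attached
    to the bumps can be united. *)
Lemma test_bump_cover x : open Omega -> Omega x -> exists q r : 'rV[rat]_N.+1,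
  obox (rat_row q) (rat_row r) x /\ test_function Omega (box_bump (rat_row q) (rat_row r)).
Proof.
move=> oO Ox; have := oO; rewrite openE => /(_ x Ox).
rewrite /interior -nbhs_ballE => -[e /= e0 xeO].
have e20 : 0 < e / 2 by rewrite divr_gt0.
have [q [r [xqr qrO]]] := @open_rat_obox R N (ball x (e / 2)) x (ball_open _ _) (ballxx _ e20).
by exists q, r; split => //; exact: test_bump e0 qrO xeO.
Qed.

End test_functions.

(** * Real-valued integrals and weak derivatives *)

Section real_integration.
Context {d : measure_display} {T : measurableType d} {R : realType}.
Context (mu : {measure set T -> \bar R}) (D : set T) (mD : measurable D).
Implicit Types f g : T -> R.
Local Notation Ig f := (mu.-integrable D (EFin \o f)).

Lemma Ig_measurable f : Ig f -> measurable_fun D f.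
Proof. by move=> /measurable_int/measurable_EFinP. Qed.

Lemma Ig_le f g : measurable_fun D f -> (forall x, D x -> `|f x| <= g x) -> Ig g -> Ig f.
Proof.
move=> mf fg; apply: le_integrable => //; first exact/measurable_EFinP.
by move=> x Dx /=; rewrite lee_fin (le_trans (fg x Dx))// ler_norm.
Qed.

Lemma Ig_ext f g : (forall x, D x -> f x = g x) -> Ig f -> Ig g.
Proof.
by move=> fg; apply: eq_integrable => // x; rewrite inE => Dx /=; rewrite fg.
Qed.

Lemma Ig_add f g : Ig f -> Ig g -> Ig (fun x => f x + g x).
Proof. by move=> If Ig; have := integrableD mD If Ig. Qed.

Lemma Ig_scale (c : R) f : Ig f -> Ig (fun x => c * f x).
Proof. by move=> If; have := integrableZl mD c If. Qed.

Lemma Ig_opp f : Ig f -> Ig (fun x => - f x).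
Proof. by move=> /(Ig_scale (-1)); apply: Ig_ext => x _; rewrite mulN1r. Qed.

Lemma Ig_sub f g : Ig f -> Ig g -> Ig (fun x => f x - g x).
Proof. by move=> If Ig; apply: Ig_add => //; exact: Ig_opp. Qed.

Lemma Ig_abs f : Ig f -> Ig (fun x => `|f x|).
Proof. by move=> /integrable_abse. Qed.

Lemma Ig_cst (c : R) : (mu D < +oo)%E -> Ig (fun=> c).
Proof.
move=> Dfin; apply/integrableP; split; first exact/measurable_EFinP/measurable_cst.
by rewrite integral_cst// lte_mul_pinfty// ?lee_fin.
Qed.

Lemma Ig_0 : Ig (fun=> 0).
Proof. exact: integrable0. Qed.

Lemma Ig_sum (I : finType) (F : I -> T -> R) : (forall i, Ig (F i)) ->
  Ig (fun x => \sum_i F i x).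
Proof.
move=> IF; elim: (index_enum I) => [|i r IH].
  by apply: Ig_ext Ig_0 => x _; rewrite big_nil.
by apply: Ig_ext (Ig_add (IF i) IH) => x _; rewrite big_cons.
Qed.

Lemma Ig_ge0_lty f : measurable_fun D f -> (forall x, D x -> 0 <= f x) ->
  (\int[mu]_(x in D) (f x)%:E < +oo)%E -> Ig f.
Proof.
move=> mf f0 If; apply/integrableP; split; first exact/measurable_EFinP.
rewrite (eq_integral (fun x => (f x)%:E))// => x; rewrite inE => Dx /=.
by rewrite ger0_norm// f0.
Qed.

Lemma Ig_lty f : (forall x, D x -> 0 <= f x) -> Ig f -> (\int[mu]_(x in D) (f x)%:E < +oo)%E.
Proof. by move=> f0 /integrable_lty; apply. Qed.

Lemma RintegralE_Ig f : Ig f -> (\int[mu]_(x in D) f x)%:E = (\int[mu]_(x in D) (f x)%:E)%E.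
Proof. by move=> If; rewrite fineK//; exact: integrable_fin_num. Qed.

Lemma ae_eq_Rintegral f g : measurable_fun D f -> measurable_fun D g ->
  {ae mu, forall x, D x -> f x = g x} -> \int[mu]_(x in D) f x = \int[mu]_(x in D) g x.
Proof.
move=> mf mg fg; congr fine; apply: ae_eq_integral => //.
- exact/measurable_EFinP.
- exact/measurable_EFinP.
by apply: filterS fg => x fg Dx; rewrite fg.
Qed.

Lemma Ig_le_ae f (g : T -> \bar R) : measurable_fun D f -> mu.-integrable D g ->
  {ae mu, forall x, D x -> (`|f x|%:E <= g x)%E} -> Ig f.
Proof.
move=> mf Ig fg; apply/integrableP; split; first exact/measurable_EFinP.
case/integrableP : (Ig) => mg; apply: le_lt_trans.
apply: ae_ge0_le_integral => //.
- by apply: measurableT_comp => //; exact/measurable_EFinP.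
- exact: measurableT_comp.
- by apply: filterS fg => x fg Dx; apply: (le_trans (fg Dx)); exact: lee_abs.
Qed.

(** The majorant is extended-valued because it will be built from the sum of a series, which may be
    infinite on a null set. *)
Lemma Rintegral_cvg_dominated (f_ : nat -> T -> R) f (g : T -> \bar R) :
  (forall n, measurable_fun D (f_ n)) -> measurable_fun D f ->
  {ae mu, forall x, D x -> f_ n x @[n --> \oo] --> f x} ->
  mu.-integrable D g ->
  {ae mu, forall x, D x -> forall n, (`|f_ n x|%:E <= g x)%E} ->
  [/\ Ig f, (forall n, Ig (f_ n)) & \int[mu]_(x in D) f_ n x @[n --> \oo] --> \int[mu]_(x in D) f x].
Proof.
move=> mf_ mf cf Ig fg.
have m1 n : measurable_fun D (EFin \o f_ n) by exact/measurable_EFinP.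
have m2 : measurable_fun D (EFin \o f) by exact/measurable_EFinP.
have c2 : {ae mu, forall x, D x -> (EFin \o f_ n) x @[n --> \oo] --> (EFin \o f) x}.
  by apply: filterS cf => x h Dx; apply: cvg_EFin (h Dx); exact: nearW.
have b2 : {ae mu, forall x n, D x -> (`|(EFin \o f_ n) x| <= g x)%E}.
  by apply: filterS fg => x h n Dx; exact: h.
have [If _ cI] := dominated_convergence mD m1 m2 c2 Ig b2.
split => //.
  by move=> n; apply: Ig_le_ae Ig _ => //; apply: filterS fg => x h Dx; exact: h.
by apply: fine_cvg; rewrite fineK//; exact: integrable_fin_num.
Qed.

End real_integration.

Lemma Ig_bounded_supp d (T : measurableType d) (R : realType) (mu : {measure set T -> \bar R})
    (f : T -> R) (C : R) (A : set T) :
  measurable_fun setT f -> measurable A -> (mu A < +oo)%E ->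
  (forall x, `|f x| <= C) -> (forall x, ~ A x -> f x = 0) ->
  mu.-integrable setT (EFin \o f).
Proof.
move=> mf mA Afin fC f0.
have C0 : 0 <= C by apply: le_trans (fC point).
have h := (integrable_mkcond _ mA).1 (Ig_cst mA C Afin).
apply: le_integrable h => //; first exact/measurable_EFinP.
move=> x _; rewrite patchE /=; case: ifPn => [_|/negP xA].
  by rewrite lee_fin (le_trans (fC x))// ler_norm.
have -> : f x = 0 by apply: f0 => Ax; apply: xA; rewrite inE.
by rewrite lee_fin normr0.
Qed.

Lemma Ig_cst_indic d (T : measurableType d) (R : realType) (mu : {measure set T -> \bar R})
    (C : R) (A : set T) : measurable A -> (mu A < +oo)%E ->
  mu.-integrable setT (EFin \o (fun x => C * \1_A x)).
Proof.
move=> mA Afin; apply: (Ig_bounded_supp (C := `|C|) _ mA Afin).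
- by apply: measurable_funM; [exact: measurable_cst|exact: measurable_indic].
- by move=> x; rewrite normrM ler_piMr// indicE; case: (_ \in _); rewrite ?normr1 ?normr0.
- by move=> x xA; rewrite indicE memNset// mulr0.
Qed.

Lemma cvg_seq_dnbhs (R : realType) (h : nat -> R) : h n @[n --> \oo] --> (0 : R) ->
  (forall n, h n != 0) -> h n @[n --> \oo] --> (0 : R)^'.
Proof.
move=> h0 hn A; rewrite /dnbhs /within /= => hA.
suff : \forall n \near \oo, A (h n) by [].
have : \forall n \near \oo, h n != 0 -> A (h n) by exact: (h0 _ hA).
by apply: filterS => n /(_ (hn n)).
Qed.

Lemma Rintegral_cvg_dominatedW d (T : measurableType d) (R : realType)
    (mu : {measure set T -> \bar R}) (D : set T) (f_ : nat -> T -> R) (f g : T -> R) :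
  measurable D ->
  (forall n, measurable_fun D (f_ n)) -> measurable_fun D f ->
  (forall x, D x -> f_ n x @[n --> \oo] --> f x) ->
  mu.-integrable D (EFin \o g) ->
  (forall x n, D x -> `|f_ n x| <= g x) ->
  \int[mu]_(x in D) f_ n x @[n --> \oo] --> \int[mu]_(x in D) f x.
Proof.
move=> mD mf_ mf cf Ig fg.
have [] // := @Rintegral_cvg_dominated _ T R mu D mD f_ f (EFin \o g) mf_ mf _ Ig.
- exact: aeW.
- by apply: aeW => x Dx n; rewrite /= lee_fin fg.
Qed.

(** * The integral of a partial derivative of a test function *)

Section integral_partial.
Context {R : realType} {N : nat}.
Local Notation V := 'rV[R]_N.+1.
Local Notation T := (leb_type R N).
Local Notation mu := (@leb R N).
Implicit Types (theta : V -> R) (Omega : set V).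

Lemma test_measurable Omega phi : test_function Omega phi ->
  measurable_fun setT (phi : T -> R).
Proof. by move=> /test_smooth/smooth_continuous; exact: continuous_leb_measurable. Qed.

Lemma test_integrable Omega phi : test_function Omega phi ->
  mu.-integrable setT (EFin \o (phi : T -> R)).
Proof.
move=> tp; have [C hC] := test_bounded tp.
have [sp cp _] := tp.
apply: (@Ig_bounded_supp _ T R mu _ _ _ (test_measurable tp) (measurable_leb_compact cp) _ hC).
  by apply: leb_bounded; exact: compact_bounded.
move=> x xK; apply/eqP/negPn/negP => px; apply: xK; exact: subset_closure.
Qed.

Lemma is_derive_line theta x (v : V) (s : R) : differentiable theta (x + s *: v) ->
  is_derive s (1 : R) (fun r : R => theta (x + r *: v)) ('D_v theta (x + s *: v)).
Proof.
move=> dt; have := diff_derivable (v := v) dt; rewrite /derivable => ct.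
have E : (fun h : R => h^-1 *: (((fun r : R => theta (x + r *: v)) \o shift s) (h *: 1) - theta (x + s *: v))) =
         (fun h : R => h^-1 *: ((theta \o shift (x + s *: v)) (h *: v) - theta (x + s *: v))).
  apply/funext => h /=; congr (_ *: (theta _ - _)).
  by rewrite -[h%:A]/(h * 1) mulr1 scalerDl addrCA.
by apply: DeriveDef; rewrite /derivable /derive E.
Qed.

Lemma difference_le theta (v : V) (C : R) : (forall x, differentiable theta x) ->
  (forall x, `|'D_v theta x| <= C) -> forall x (s : R), 0 <= s ->
  `|theta (x + s *: v) - theta x| <= C * s.
Proof.
move=> dt hC x s s0.
have d1 (r : R) : is_derive r (1 : R) (fun r : R => theta (x + r *: v)) ('D_v theta (x + r *: v)).
  exact: is_derive_line.
have cl : {within `[0, s], continuous (fun r : R => theta (x + r *: v))}.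
  by apply: continuous_subspaceT => r; exact: is_derive_continuous (d1 r).
have := MVT_segment s0 (fun r _ => d1 r) cl; rewrite scale0r addr0 => -[c _ ->].
by rewrite subr0 normrM (ger0_norm s0) ler_wpM2r.
Qed.

(** Difference quotients have integral 0 by translation invariance. The mean value theorem bounds
    them by a constant on one bounded set, and dominated convergence passes to the derivative. *)
Lemma Rintegral_partial_eq0 Omega theta i : test_function Omega theta ->
  \int[mu]_x partial i theta x = 0.
Proof.
move=> tt; pose v : V := delta_mx ord0 i.
have st := test_smooth tt; have dt := smooth_diff st.
have tp := test_partial i tt; have [C hC] := test_bounded tp.
(* One bounded set contains all translates of the support by at most one unit. The support lies in
   the ball of radius M + 1 and the shift adds at most 1, so an open ball of radius M + 3 is large
   enough. *)
have [K [bK mK thK]] : exists K : set V, [/\ bounded_set K, measurable (K : set T) &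
    forall x (s : R), 0 <= s <= 1 -> theta (x + s *: v) != 0 -> K x].
  have [_ /compact_bounded[M [_ hM]] _] := tt.
  exists (ball (0 : V) (M + 3)); split.
  - exists (M + 3); split; first exact: num_real.
    move=> t Mt x; rewrite -ball_normE /= sub0r normrN => h; exact: ltW (lt_trans h Mt).
  - by apply: measurable_leb_open; exact: ball_open.
  - move=> x s /andP[s0 s1] tx; rewrite -ball_normE /= sub0r normrN.
    have h : `|x + s *: v| <= M + 1 by apply: hM; [rewrite ltrDl|exact: subset_closure].
    have -> : x = (x + s *: v) - s *: v by rewrite addrK.
    have v1 : `|v| <= 1.
      rewrite [leLHS]/Num.norm /= mx_normrE; apply/bigmax_leP; split => // -[j k] _ /=.
      by rewrite mxE; case: (_ && _); rewrite ?normr1 ?normr0.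
    have : `|s *: v| <= 1 by rewrite normrZ (ger0_norm s0) mulr_ile1.
    have := ler_normB (x + s *: v) (s *: v); lra.
pose h n : R := n.+1%:R^-1.
have h0 n : 0 < h n by rewrite /h invr_gt0.
have h1 n : h n <= 1 by rewrite /h invf_le1// ler1n.
pose q n x : R := (h n)^-1 * (theta (x + h n *: v) - theta x).
have mth : measurable_fun setT (theta : T -> R) by exact: test_measurable tt.
have msh n : measurable_fun setT ((fun x : V => theta (x + h n *: v)) : T -> R).
  exact: (measurableT_comp mth (measurable_leb_shift (h n *: v))).
have mq n : measurable_fun setT (q n : T -> R).
  by apply: measurable_funM; [exact: measurable_cst|exact: measurable_funB].
have Kfin : (mu K < +oo)%E by exact: leb_bounded.
have Ith := test_integrable tt.
have [Cth hCth] := test_bounded tt.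
have Ish n : mu.-integrable setT (fun x : T => (theta ((x : V) + h n *: v))%:E).
  apply: (@Ig_bounded_supp _ T R mu (fun x : V => theta (x + h n *: v)) Cth K (msh n)) => //.
  move=> x xK; apply/eqP/negPn/negP => px; apply: xK; apply: thK px.
  by rewrite (ltW (h0 n)) h1.
have q_int n : \int[mu]_x q n x = 0.
  have := @Ig_sub _ T R mu setT measurableT _ _ (Ish n) Ith => Id.
  have -> : \int[mu]_x q n x = (h n)^-1 * \int[mu]_x (theta (x + h n *: v) - theta x).
    exact: (@RintegralZl _ T R mu setT).
  rewrite (@RintegralB _ T R mu setT _ _ measurableT (Ish n) Ith).
  by rewrite Rintegral_leb_shift// subrr mulr0.
have Ig := @Ig_cst_indic _ T R mu C K mK Kfin.
have hd : h n @[n --> \oo] --> (0 : R)^'.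
  by apply: cvg_seq_dnbhs; [exact: cvg_harmonic|move=> n; rewrite gt_eqF].
have cq x : q n x @[n --> \oo] --> partial i theta x.
  have dx : derivable theta x v by exact: diff_derivable.
  have := cvg_comp _ _ hd dx; apply: cvg_trans; apply: near_eq_cvg.
  near=> n; rewrite /q /= /shift /= [X in theta X - _]addrC; reflexivity.
have bq x n : (`|q n x| <= C * \1_K x).
  rewrite indicE; case: (boolP (x \in K)) => [_|/negP xK]; rewrite ?mulr1 ?mulr0.
    rewrite /q normrM gtr0_norm ?invr_gt0// ler_pdivrMl//.
    rewrite mulrC; apply: (difference_le dt hC); exact: ltW.
  have t0 s : 0 <= s <= 1 -> theta (x + s *: v) = 0.
    by move=> s01; apply/eqP/negPn/negP => tx; apply: xK; rewrite inE; exact: thK tx.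
  rewrite /q t0 ?(ltW (h0 n)) ?h1//.
  have := t0 0; rewrite lexx ler01 scale0r addr0 => ->//.
  by rewrite subrr mulr0 normr0.
have := @Rintegral_cvg_dominatedW _ T R mu setT q (partial i theta) _ measurableT mq
  (test_measurable tp) (fun x _ => cq x) Ig (fun x n _ => bq x n).
rewrite (_ : (fun n => _) = fun=> 0); last by apply/funext => n; exact: q_int.
by move=> /cvg_lim <- //; rewrite lim_cst.
Unshelve. all: by end_near. Qed.

End integral_partial.

(** * Densities orthogonal to a class of functions *)

Section vanishing_density.
Context {d : measure_display} {T : measurableType d} {R : realType}.
Variables (mu : {measure set T -> \bar R}) (S : set (T -> R)) (q : T -> R).
Hypothesis Iq : forall eta, S eta -> mu.-integrable setT (EFin \o (fun x => eta x * q x)).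
Hypothesis q0 : forall eta, S eta -> \int[mu]_x (eta x * q x) = 0.

(* The indicator of B is a bounded limit of multipliers preserving S. *)
Definition approximable (B : set T) := exists s : nat -> T -> R,
  [/\ forall n, measurable_fun setT (s n), forall n x, `|s n x| <= 1,
      forall n eta, S eta -> S (fun x => s n x * eta x) &
      forall x, s n x @[n --> \oo] --> (\1_B x : R)].

Let multiplier (m : T -> R) := [/\ measurable_fun setT m, (forall x, `|m x| <= 1) &
  forall eta, S eta -> \int[mu]_x (m x * (eta x * q x)) = 0].

Let Im (m eta : T -> R) : measurable_fun setT m ->
  (forall x, `|m x| <= 1) -> S eta ->
  mu.-integrable setT (EFin \o (fun x => m x * (eta x * q x))).
Proof.
move=> mm m1 se; apply: (@Ig_le _ T R mu setT measurableT _ (fun x => `|eta x * q x|)).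
- by apply: measurable_funM => //; exact: (Ig_measurable (Iq se)).
- by move=> x _; rewrite normrM ler_piMl.
- exact: (Ig_abs (Iq se)).
Qed.

Let cvg_int0 (m_ : nat -> T -> R) (m eta : T -> R) : S eta ->
  (forall n, measurable_fun setT (m_ n)) -> (forall n x, `|m_ n x| <= 1) ->
  (forall n, \int[mu]_x (m_ n x * (eta x * q x)) = 0) ->
  measurable_fun setT m ->
  (forall x, m_ n x @[n --> \oo] --> m x) -> \int[mu]_x (m x * (eta x * q x)) = 0.
Proof.
move=> se mm_ m1 i0 mm cm; have mq := Ig_measurable (Iq se).
have h : \int[mu]_x (m_ n x * (eta x * q x)) @[n --> \oo] --> \int[mu]_x (m x * (eta x * q x)).
  apply: (@Rintegral_cvg_dominatedW _ T R mu setT _ _ (fun x => `|eta x * q x|)) => //.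
  - by move=> n; exact: measurable_funM.
  - exact: measurable_funM.
  - by move=> x _; apply: cvgMl; exact: cm.
  - exact: (Ig_abs (Iq se)).
  - by move=> x n _; rewrite normrM ler_piMl.
rewrite -(cvg_lim _ h)//; under eq_fun do rewrite i0; exact: lim_cst.
Qed.

(** Asking that the indicator preserve all annihilating multipliers, and not only that it annihilate
    the density itself, is what makes the class stable under intersection. *)
Let Mset (B : set T) := measurable B /\ forall m, multiplier m -> multiplier (fun x => m x * \1_B x).

Let indic1 (B : set T) x : `|\1_B x : R| <= 1.
Proof. by rewrite indicE; case: (_ \in _); rewrite ?normr1 ?normr0. Qed.

Let mul1 (a b : R) : `|a| <= 1 -> `|b| <= 1 -> `|a * b| <= 1.
Proof. by move=> *; rewrite normrM mulr_ile1. Qed.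

Let Mset_approximable B : measurable B -> approximable B -> Mset B.
Proof.
move=> mB [s [ms s1 sS cs]]; split => // m [mm m1 m0]; split.
- by apply: measurable_funM => //; exact: measurable_indic.
- by move=> x; apply: mul1.
move=> eta se; apply: (@cvg_int0 (fun n x => m x * s n x)) => //.
- by move=> n; exact: measurable_funM.
- by move=> n x; apply: mul1.
- move=> n; rewrite -(m0 _ (sS n eta se)); apply: eq_Rintegral => x _; ring.
- by apply: measurable_funM => //; exact: measurable_indic.
- by move=> x; apply: cvgMr; exact: cs.
Qed.

Let MsetC B : Mset B -> Mset (~` B).
Proof.
move=> [mB hB]; split; first exact: measurableC.
move=> m Mm; have [_ _ mB0] := hB m Mm; have [mm m1 m0] := Mm.
split => [|x|eta se].
- by apply: measurable_funM => //; apply: measurable_indic; exact: measurableC.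
- by apply: mul1.
have -> : \int[mu]_x (m x * \1_(~` B) x * (eta x * q x)) =
    \int[mu]_x (m x * (eta x * q x) - m x * \1_B x * (eta x * q x)).
  apply: eq_Rintegral => x _; rewrite !indicE in_setC.
  by case: (x \in B) => /=; ring.
rewrite RintegralB//.
- by rewrite m0// mB0// subrr.
- exact: Im.
- apply: Im => // [|x]; last by apply: mul1.
  by apply: measurable_funM => //; exact: measurable_indic.
Qed.

Let MsetI A B : Mset A -> Mset B -> Mset (A `&` B).
Proof.
move=> [mA hA] [mB hB]; split; first exact: measurableI.
move=> m /hA/hB; congr multiplier; apply/funext => x.
by rewrite !indicE in_setI; case: (x \in A) (x \in B) => -[]; rewrite ?mulr1 ?mulr0.
Qed.

Let MsetT : Mset setT.
Proof.
split => // m; congr multiplier; apply/funext => x.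
by rewrite indicE in_setT mulr1.
Qed.

Let Mset_bigcap (B : nat -> set T) : (forall n, Mset (B n)) -> Mset (\bigcap_n B n).
Proof.
move=> MB; have mcap : measurable (\bigcap_n B n).
  by apply: bigcapT_measurable => n; case: (MB n).
pose C n := \bigcap_(k < n) B k.
have MC n : Mset (C n).
  elim: n => [|n IH]; first by rewrite /C bigcap_mkord big_ord0.
  by rewrite /C bigcap_mkord big_ord_recr /= -bigcap_mkord; exact: MsetI.
split => // m Mm; have [mm m1 m0] := Mm.
split => [|x|eta se].
- by apply: measurable_funM => //; exact: measurable_indic.
- by apply: mul1.
apply: (@cvg_int0 (fun n x => m x * \1_(C n) x)) => //.
- by move=> n; have [_ /(_ m Mm)[]] := MC n.
- by move=> n x; apply: mul1.
- by move=> n; have [_ /(_ m Mm)[_ _]] := MC n; exact.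
- by apply: measurable_funM => //; exact: measurable_indic.
move=> x; apply: cvgMr; apply: cvg_near_cst.
have [xB|] := pselect (forall k, B k x).
  apply: nearW => n; rewrite !indicE !mem_set// => k _; exact: xB.
move=> /existsNP[k xk]; exists k.+1 => // n /= kn; rewrite !indicE !memNset// => /(_ k) h; apply: xk; exact: h.
Qed.

(** The class [Mset] is a full sigma-algebra and not merely a Dynkin class, so generators that are
    not stable under intersection, such as half spaces, are admissible. *)
Lemma Rintegral_sigma_eq0 (H : set (set T)) : S (cst 1) ->
  (forall B, H B -> measurable B /\ approximable B) ->
  forall B, <<s H >> B -> \int[mu]_x (\1_B x * q x) = 0.
Proof.
move=> S1 HB; have sM : sigma_algebra setT Mset.
  split.
  - by rewrite -setCT; exact: MsetC.
  - by move=> A MA; rewrite setTD; exact: MsetC.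
  - move=> A MA; rewrite -[X in Mset X]setCK setC_bigcup; apply: MsetC.
    by apply: Mset_bigcap => n; exact: MsetC.
move=> B sB; have [_ MB] : Mset B.
  suff h : <<s H >> `<=` Mset by exact: h.
  by apply: smallest_sub => // A /HB[]; exact: Mset_approximable.
have M1 : multiplier (cst 1).
  split => [|x|eta se]; first exact: measurable_cst.
    by rewrite normr1.
  by under eq_Rintegral do rewrite mul1r; exact: q0.
have [_ _ /(_ _ S1)] := MB _ M1.
by move=> <-; apply: eq_Rintegral => x _ /=; rewrite !mul1r.
Qed.

End vanishing_density.

(** The integrals of q over A and over its hull B agree, since B differs from A by a null set. Thus
    q has integral 0 over every measurable subset of D, which forces q = 0 a.e. in D. *)
Lemma ae_eq0_hull d (T : measurableType d) (R : realType) (mu : {measure set T -> \bar R})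
    (D : set T) (q : T -> R) : measurable D -> mu.-integrable setT (EFin \o q) ->
  (forall A, measurable A -> A `<=` D -> exists B, [/\ A `<=` B, measurable B,
     mu (B `\` A) = 0%E & \int[mu]_x (\1_B x * q x) = 0]) ->
  {ae mu, forall x, D x -> q x = 0}.
Proof.
move=> mD Iq hull.
have IqD : mu.-integrable D (EFin \o q) by exact: integrableS Iq.
suff h : ae_eq mu D (EFin \o q) (cst 0%E).
  by apply: filterS h => x + Dx => /(_ Dx)[].
apply: integral_ae_eq => // E ED mE.
rewrite integral0; have IE : mu.-integrable E (EFin \o q) by exact: integrableS Iq.
have [B [AB mB BA0 B0]] := hull E mE ED.
rewrite -(RintegralE_Ig mE IE); congr EFin; rewrite -B0 Rintegral_mkcond.
have mq : measurable_fun setT q by exact: Ig_measurable Iq.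
apply: ae_eq_Rintegral => //.
- by apply/measurable_restrict => //; rewrite setTI; exact: measurable_funS mq.
- by apply: measurable_funM => //; exact: measurable_indic.
exists (B `\` E); split => //; first exact: measurableD.
move=> x /= /not_implyP[_]; rewrite patchE indicE.
case: (boolP (x \in E)) => [xE|xE].
  by rewrite (_ : x \in B) ?mul1r// inE; apply: AB; rewrite inE in xE.
case: (boolP (x \in B)) => [|xB]; last by rewrite mul0r.
by rewrite inE; split => //; move=> Ex; move/negP : xE; apply; rewrite inE.
Qed.

Lemma Ig_mul_bounded d (T : measurableType d) (R : realType) (mu : {measure set T -> \bar R})
    (D : set T) (g m : T -> R) (C : R) : measurable D -> mu.-integrable D (EFin \o g) ->
  measurable_fun D m -> (forall x, D x -> `|m x| <= C) ->
  mu.-integrable D (EFin \o (fun x => g x * m x)).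
Proof.
move=> mD Ig mm mC; apply: (@Ig_le _ T R mu D mD _ (fun x => C * `|g x|)) => //.
- by apply: measurable_funM => //; exact: Ig_measurable Ig.
- by move=> x Dx; rewrite normrM mulrC ler_wpM2r// mC.
- by apply: Ig_scale => //; exact: Ig_abs.
Qed.

Lemma Ig_restrict d (T : measurableType d) (R : realType) (mu : {measure set T -> \bar R})
    (D : set T) (g : T -> R) : measurable D -> mu.-integrable D (EFin \o g) ->
  mu.-integrable setT (EFin \o (fun x => g x * \1_D x)).
Proof.
move=> mD /integrable_mkcond => /(_ mD); apply: eq_integrable => // x _.
by rewrite patchE /= indicE; case: (x \in D); rewrite ?mulr1 ?mulr0.
Qed.

Lemma Rintegral_restrict d (T : measurableType d) (R : realType) (mu : {measure set T -> \bar R})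
    (D : set T) (g : T -> R) : \int[mu]_x (g x * \1_D x) = \int[mu]_(x in D) g x.
Proof.
rewrite [RHS]Rintegral_mkcond; apply: eq_Rintegral => x _; rewrite patchE /= indicE.
by case: (x \in D); rewrite ?mulr1 ?mulr0.
Qed.

(** * The du Bois-Reymond lemma *)

Section du_bois_reymond.
Context {R : realType} {N : nat}.
Local Notation V := 'rV[R]_N.+1.
Local Notation T := (leb_type R N).
Local Notation mu := (@leb R N).
Variable Omega : set V.
Hypothesis oO : open Omega.
Hypothesis bO : bounded_set Omega.

(** At each point step(n (x_i - s)) equals the indicator once n is large: it is 0 for x_i <= s and 1
    as soon as n (x_i - s) >= 1. *)
Lemma half_space_approximable (i : 'I_N.+1) (s : R) :
  @approximable _ T R (@smooth R N) ([set x : V | s < x ord0 i] : set T).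
Proof.
have [dg [_ _ sg]] := @smooth1_step R N.
have ss n : smooth (fun x : V => step (n%:R * (x ord0 i - s))).
  apply: (sg (fun x => n%:R * (x ord0 i - s))).
  apply: smooth_mul; first exact: smooth_cst.
  by apply: smooth_sub; [exact: smooth_coord|exact: smooth_cst].
exists (fun n (x : V) => step (n%:R * (x ord0 i - s))); split.
- by move=> n; apply: continuous_leb_measurable; exact: smooth_continuous.
- by move=> n x; rewrite ger0_norm ?step_ge0// step_le1.
- by move=> n eta se; apply: smooth_mul.
move=> x; apply: cvg_near_cst; have [sx|sx] := ltP s (x ord0 i).
  have sx0 : 0 < x ord0 i - s by rewrite subr_gt0.
  near=> n; rewrite indicE mem_set// step_eq1//.
  rewrite -ler_pdivrMr// mul1r; near: n; exact: nbhs_infty_ger.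
apply: nearW => n; rewrite indicE memNset ?step_eq0//.
  by rewrite mulr_ge0_le0// subr_le0.
by move=> /= h; move: sx; rewrite leNgt h.
Unshelve. all: by end_near. Qed.

(** For a fixed test function psi, the product of psi with any smooth eta is again a test function.
    The density g psi is therefore orthogonal to all smooth functions, hence to the indicators of
    sets generated by half spaces, and vanishes a.e. Countably many bumps psi, one of them nonzero
    at each point of Omega, then give g = 0. *)
Lemma weak_zero (g : V -> R) : mu.-integrable (Omega : set T) (EFin \o (g : T -> R)) ->
  (forall phi, test_function Omega phi -> \int[mu]_(x in Omega) (g x * phi x) = 0) ->
  {ae mu, forall x : T, Omega x -> g x = 0}.
Proof.
move=> Ig g0; have mO : measurable (Omega : set T) by exact: measurable_leb_open.
pose gO x : R := g x * \1_Omega x.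
have IgO : mu.-integrable setT (EFin \o (gO : T -> R)) by exact: (@Ig_restrict _ T R mu).
have Iphi phi : test_function Omega phi ->
    mu.-integrable setT (EFin \o ((fun x => gO x * phi x) : T -> R)).
  move=> tp; have [C hC] := test_bounded tp.
  by apply: (@Ig_mul_bounded _ T R mu setT gO phi C) => //; exact: (test_measurable tp).
have zphi phi : test_function Omega phi -> \int[mu]_x (gO x * phi x) = 0.
  move=> tp; rewrite -(g0 _ tp) -[RHS](@Rintegral_restrict _ T R mu Omega).
  by apply: eq_Rintegral => x _; rewrite /gO; ring.
have key psi : test_function Omega psi -> {ae mu, forall x : T, Omega x -> gO x * psi x = 0}.
  move=> tp; have te eta : smooth eta -> test_function Omega (fun x => eta x * psi x).
    by move=> se; exact: test_mul.
  apply: (@ae_eq0_hull _ T R mu Omega) => //; first exact: Iphi.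
  move=> A mA AO.
  have Afin : (mu A < +oo)%E.
    by apply: le_lt_trans (leb_bounded bO); exact: le_leb_outer.
  have [B [sB AB mB BA0]] := leb_hull mA Afin.
  exists B; split => //.
  apply: (@Rintegral_sigma_eq0 _ T R mu (@smooth R N) (fun x => gO x * psi x) _ _
    (half_spaces (R := R) (N := N))) sB.
  - move=> eta /te /Iphi; apply: (@Ig_ext _ T R mu setT measurableT) => x _; ring.
  - by move=> eta /te /zphi <-; apply: eq_Rintegral => x _; ring.
  - exact: smooth_cst.
  - move=> _ [i [s ->]]; split; first exact: measurable_leb_half.
    exact: half_space_approximable.
(* Pairs of rational corners are enumerated through their codes, which turns countably many a.e.
   statements into one; an integer that codes no pair contributes a trivial statement. *)
pose b (n : nat) (x : T) := if unpickle n is Some (q, r) then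
  test_function Omega (box_bump (rat_row q) (rat_row r)) -> Omega x ->
    gO x * box_bump (rat_row q) (rat_row r) x = 0 else True.
have /ae_foralln hb : forall n, {ae mu, forall x, b n x}.
  move=> n; rewrite /b; case: (unpickle n) => [[q r]|]; last exact: aeW.
  have [tqr|] := pselect (test_function Omega (box_bump (rat_row q) (rat_row r))).
    by apply: filterS (key _ tqr) => x h _.
  by move=> h; apply: aeW => x /h.
apply: filterS hb => x hb Ox.
have [q [r [xqr tqr]]] := test_bump_cover oO Ox.
have := hb (pickle (q, r)); rewrite /b pickleK => /(_ tqr Ox)/eqP.
rewrite mulf_eq0 => /orP[|/eqP h]; last by move/bump_neq0 : xqr; rewrite h eqxx.
by rewrite /gO indicE mem_set// mulr1 => /eqP.
Qed.

End du_bois_reymond.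

(** * Energies *)

Section powR_lemmas.
Context {R : realType}.
Variable p : R.
Hypothesis p1 : 1 < p.
Implicit Types a b c : R.

Let p0 : 0 < p. Proof. exact: lt_trans p1. Qed.

Lemma powR_mono a b : 0 <= a -> a <= b -> a `^ p <= b `^ p.
Proof.
by move=> a0 ab; apply: ge0_ler_powR; rewrite ?nnegrE ?(ltW p0)//; exact: le_trans ab.
Qed.

Lemma powR_ltP a b : 0 <= a -> 0 <= b -> (a `^ p < b `^ p) = (a < b).
Proof.
move=> a0 b0; apply/idP/idP.
  by apply: contraTT; rewrite -!leNgt => ba; exact: powR_mono.
by move=> ab; apply: gt0_ltr_powR; rewrite ?nnegrE.
Qed.

Lemma powRK a : 0 <= a -> (a `^ p) `^ p^-1 = a.
Proof. by move=> a0; rewrite -powRrM mulfV ?gt_eqF// powRr1. Qed.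

Lemma powRVK a : 0 <= a -> (a `^ p^-1) `^ p = a.
Proof. by move=> a0; rewrite -powRrM mulVf ?gt_eqF// powRr1. Qed.

(** The sum is at most four times its largest term, and the p-th power of that term is one of the
    four powers; hence the constant (4 C)^p. *)
Lemma powR_max4 C a1 a2 a3 a4 b : 0 <= C -> 0 <= b ->
  0 <= a1 -> 0 <= a2 -> 0 <= a3 -> 0 <= a4 ->
  b <= C * (a1 + a2 + a3 + a4) ->
  b `^ p <= (C * 4) `^ p * (a1 `^ p + a2 `^ p + a3 `^ p + a4 `^ p).
Proof.
move=> C0 b0 h1 h2 h3 h4 hb.
pose M := Num.max (Num.max a1 a2) (Num.max a3 a4).
have M1 : a1 <= M by rewrite !le_max lexx.
have M2 : a2 <= M by rewrite !le_max lexx orbT.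
have M3 : a3 <= M by rewrite !le_max lexx !orbT.
have M4 : a4 <= M by rewrite !le_max lexx !orbT.
have M0 : 0 <= M by exact: le_trans M1.
apply: (@le_trans _ _ ((C * 4 * M) `^ p)).
  apply: powR_mono => //; apply: (le_trans hb); rewrite -mulrA ler_wpM2l//; lra.
rewrite powRM ?mulr_ge0// ler_wpM2l ?powR_ge0//.
have q1 := powR_ge0 a1 p; have q2 := powR_ge0 a2 p.
have q3 := powR_ge0 a3 p; have q4 := powR_ge0 a4 p.
by rewrite /M; case: (leP a1 a2) => _; case: (leP a3 a4) => _;
  match goal with |- context [Num.max ?x ?y] => case: (leP x y) => _ end; lra.
Qed.

(** The constant 4^p is the one of the four-term bound, used with two zero terms. *)
Lemma powR_normD a b : `|a + b| `^ p <= 4 `^ p * (`|a| `^ p + `|b| `^ p).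
Proof.
have := @powR_max4 1 `|a| `|b| 0 0 `|a + b|.
by rewrite powR0 ?gt_eqF// !addr0 !mul1r; apply => //; exact: ler_normD.
Qed.

Lemma ler_1DpowR a : 0 <= a -> a <= 1 + a `^ p.
Proof.
move=> a0; have [a1|a1] := leP a 1; first by rewrite ler_wpDr// powR_ge0.
by apply: ler_wpDl => //; apply: le1r_powR; exact: ltW.
Qed.

Lemma cvg_powR0 (a_ : nat -> R) : a_ n @[n --> \oo] --> 0 ->
  `|a_ n| `^ p @[n --> \oo] --> 0.
Proof.
move=> /cvgrPdist_lt ca; apply/cvgrPdist_lt => e e0.
have e1 : 0 < e `^ p^-1 by exact: powR_gt0.
apply: filterS (ca _ e1) => n; rewrite !sub0r !normrN => h.
rewrite ger0_norm ?powR_ge0// -[e in _ < e](powRVK (ltW e0)) powR_ltP//; exact: ltW.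
Qed.

Lemma cvg_powR0_inv (a_ : nat -> R) : `|a_ n| `^ p @[n --> \oo] --> 0 ->
  a_ n @[n --> \oo] --> 0.
Proof.
move=> /cvgrPdist_lt ca; apply/cvgrPdist_lt => e e0.
have e1 : 0 < e `^ p by exact: powR_gt0.
apply: filterS (ca _ e1) => n; rewrite !sub0r !normrN ger0_norm ?powR_ge0//.
by rewrite powR_ltP// ltW.
Qed.

(** A crude form of Young's inequality: the smaller of a and b is replaced by the larger. *)
Lemma powR_mulB1 a b : 0 <= a -> 0 <= b -> a `^ (p - 1) * b <= a `^ p + b `^ p.
Proof.
move=> a0 b0; have [ab|ba] := leP a b.
  apply: (@le_trans _ _ (b `^ (p - 1) * b)).
    by rewrite ler_wpM2r// ge0_ler_powR ?nnegrE// subr_ge0 ltW.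
  by rewrite mulrC mulr_powRB1// ler_wpDl// powR_ge0.
apply: (@le_trans _ _ (a `^ (p - 1) * a)).
  by rewrite ler_wpM2l ?powR_ge0// ltW.
by rewrite mulrC mulr_powRB1// ler_wpDr// powR_ge0.
Qed.

End powR_lemmas.

(** * Pairs of a function and a vector field in L^p *)

Section jets.
Context {d : measure_display} {T : measurableType d} {R : realType} {n : nat}.
Variables (mu : {measure set T -> \bar R}) (D : set T) (p : R).
Hypothesis mD : measurable D.
Hypothesis p1 : 1 < p.
Local Notation W := 'rV[R]_n.
Local Notation Ig f := (mu.-integrable D (EFin \o f)).
Implicit Types (u v : T -> R) (G K : T -> W).

Definition Lp u := measurable_fun D u /\ Ig (fun x => `|u x| `^ p).

Lemma measurable_norm_powR u : measurable_fun D u -> measurable_fun D (fun x => `|u x| `^ p).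
Proof.
move=> mu_; apply: (measurableT_comp (measurable_powR p)).
exact: (measurableT_comp (@normr_measurable R setT)).
Qed.

Lemma Lp_le u v : measurable_fun D u -> (forall x, D x -> `|u x| <= `|v x|) -> Lp v -> Lp u.
Proof.
move=> mu_ uv [mv Iv]; split => //.
apply: (Ig_le mD _ _ Iv); first exact: measurable_norm_powR.
by move=> x Dx; rewrite ger0_norm ?powR_ge0// powR_mono// uv.
Qed.

Lemma Lp_add u v : Lp u -> Lp v -> Lp (fun x => u x + v x).
Proof.
move=> [mu_ Iu] [mv Iv]; have muv : measurable_fun D (fun x => u x + v x) by exact: measurable_funD.
split => //; apply: (Ig_le mD _ _ (Ig_scale mD (4 `^ p) (Ig_add mD Iu Iv))).
  exact: measurable_norm_powR.
by move=> x Dx; rewrite ger0_norm ?powR_ge0//; exact: powR_normD.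
Qed.

Lemma Lp_mul_bounded u (m : T -> R) (C : R) : Lp u -> measurable_fun D m ->
  (forall x, D x -> `|m x| <= C) -> Lp (fun x => m x * u x).
Proof.
move=> [mu_ Iu] mm mC; have muv : measurable_fun D (fun x => m x * u x) by exact: measurable_funM.
split => //; apply: (Ig_le mD _ _ (Ig_scale mD (C `^ p) Iu)).
  exact: measurable_norm_powR.
move=> x Dx; rewrite ger0_norm ?powR_ge0// normrM powRM// ler_wpM2r ?powR_ge0//.
by apply: powR_mono => //; exact: mC.
Qed.

Lemma Lp_scale (c : R) u : Lp u -> Lp (fun x => c * u x).
Proof. by move=> Lu; apply: (@Lp_mul_bounded u (fun=> c) `|c|). Qed.

Lemma Lp_sub u v : Lp u -> Lp v -> Lp (fun x => u x - v x).
Proof.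
move=> Lu Lv; have := Lp_add Lu (Lp_scale (-1) Lv).
by congr Lp; apply/funext => x; rewrite mulN1r.
Qed.

Lemma Lp_Ig u : (mu D < +oo)%E -> Lp u -> Ig u.
Proof.
move=> Dfin [mu_ Iu]; apply: (Ig_le mD mu_ _ (Ig_add mD (Ig_cst mD 1 Dfin) Iu)).
by move=> x Dx; exact: ler_1DpowR.
Qed.

(** No relation between u and G is imposed here; that G is a weak gradient of u enters later. *)
Definition LpJ u G := Lp u /\ forall i, Lp (fun x => G x ord0 i).

(** Powers are taken coordinate by coordinate, so that estimates for pairs reduce to scalar ones. *)
Definition en u G x := `|u x| `^ p + \sum_i `|G x ord0 i| `^ p.

Definition energy u G : R := \int[mu]_(x in D) en u G x.

Lemma en_ge0 u G x : 0 <= en u G x.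
Proof. by rewrite addr_ge0 ?powR_ge0// sumr_ge0// => i _; exact: powR_ge0. Qed.

Lemma energy_ge0 u G : 0 <= energy u G.
Proof. by apply: Rintegral_ge0 => x _; exact: en_ge0. Qed.

Lemma Ig_en u G : LpJ u G -> Ig (en u G).
Proof.
by move=> [[_ Iu] LG]; apply: Ig_add => //; apply: Ig_sum => // i; case: (LG i).
Qed.

Lemma en_le_u u G x : `|u x| `^ p <= en u G x.
Proof. by rewrite lerDl sumr_ge0// => i _; exact: powR_ge0. Qed.

Lemma en_le_G u G x i : `|G x ord0 i| `^ p <= en u G x.
Proof.
rewrite /en (bigD1 i)//= addrCA lerDl addr_ge0 ?powR_ge0//.
by rewrite sumr_ge0// => j _; exact: powR_ge0.
Qed.

Lemma LpJ_add u G v K : LpJ u G -> LpJ v K ->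
  LpJ (fun x => u x + v x) (fun x => G x + K x).
Proof.
move=> [Lu LG] [Lv LK]; split => [|i]; first exact: Lp_add.
by under eq_fun do rewrite mxE; exact: Lp_add.
Qed.

Lemma LpJ_scale (c : R) u G : LpJ u G -> LpJ (fun x => c * u x) (fun x => c *: G x).
Proof.
move=> [Lu LG]; split => [|i]; first exact: Lp_scale.
by under eq_fun do rewrite mxE; exact: Lp_scale.
Qed.

Lemma LpJ_sub u G v K : LpJ u G -> LpJ v K ->
  LpJ (fun x => u x - v x) (fun x => G x - K x).
Proof.
move=> [Lu LG] [Lv LK]; split => [|i]; first exact: Lp_sub.
by under eq_fun do rewrite !mxE; exact: Lp_sub.
Qed.

Lemma en_add_le u G v K x :
  en (fun x => u x + v x) (fun x => G x + K x) x <= 4 `^ p * (en u G x + en v K x).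
Proof.
rewrite /en addrACA mulrDr; apply: lerD; first exact: powR_normD.
rewrite -big_split mulr_sumr; apply: ler_sum => i _ /=; rewrite mxE; exact: powR_normD.
Qed.

Lemma energy_add u G v K : LpJ u G -> LpJ v K ->
  energy (fun x => u x + v x) (fun x => G x + K x) <= 4 `^ p * (energy u G + energy v K).
Proof.
move=> LuG LvK; have I1 := Ig_en LuG; have I2 := Ig_en LvK.
rewrite /energy -RintegralD// -RintegralZl//; last exact: Ig_add.
apply: le_Rintegral => //.
- by apply: Ig_en; exact: LpJ_add.
- by apply: Ig_scale => //; exact: Ig_add.
- by move=> x _; exact: en_add_le.
Qed.

Lemma en_scale (c : R) u G x :
  en (fun x => c * u x) (fun x => c *: G x) x = `|c| `^ p * en u G x.
Proof.
rewrite /en mulrDr mulr_sumr normrM powRM//; congr (_ + _).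
by apply: eq_bigr => i _; rewrite mxE normrM powRM.
Qed.

Lemma energy_scale (c : R) u G : LpJ u G ->
  energy (fun x => c * u x) (fun x => c *: G x) = `|c| `^ p * energy u G.
Proof.
move=> L; rewrite /energy -RintegralZl//; last exact: Ig_en.
by apply: eq_Rintegral => x _; exact: en_scale.
Qed.

Lemma en_opp u G x : en (fun x => - u x) (fun x => - G x) x = en u G x.
Proof.
rewrite /en normrN; congr (_ + _).
by apply: eq_bigr => i _; rewrite mxE normrN.
Qed.

Lemma energy_subC u G v K : energy (fun x => u x - v x) (fun x => G x - K x) =
  energy (fun x => v x - u x) (fun x => K x - G x).
Proof.
apply: eq_Rintegral => x _; rewrite -en_opp; congr (en _ _ x).
  by apply/funext => y; rewrite opprB.
by apply/funext => y; rewrite opprB.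
Qed.

Lemma ae_eq_energy u G v K : LpJ u G -> LpJ v K ->
  {ae mu, forall x, D x -> u x = v x} -> {ae mu, forall x, D x -> G x = K x} ->
  energy u G = energy v K.
Proof.
move=> L1 L2 uv GK; apply: ae_eq_Rintegral => //.
- exact: Ig_measurable (Ig_en L1).
- exact: Ig_measurable (Ig_en L2).
apply: filterS2 uv GK => x uv GK Dx; rewrite /en uv// GK//.
Qed.

(** S is the sum of all the densities. It is integrable because the energies are bounded by a
    geometric series, hence finite a.e., so the densities tend to 0 a.e.; and S dominates each of
    them. Pointwise convergence and a common majorant come together, without extraction of a
    subsequence. *)
Lemma fast_cvg (u_ : nat -> T -> R) (G_ : nat -> T -> W) :
  (forall k, LpJ (u_ k) (G_ k)) -> (forall k, energy (u_ k) (G_ k) <= 2^-1 ^+ k) ->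
  exists S : T -> \bar R, [/\ mu.-integrable D S,
    (forall k x, ((en (u_ k) (G_ k) x)%:E <= S x)%E),
    {ae mu, forall x, D x -> u_ k x @[k --> \oo] --> 0} &
    {ae mu, forall x, D x -> forall i, G_ k x ord0 i @[k --> \oo] --> 0}].
Proof.
move=> L_ E_.
pose S x : \bar R := (\sum_(k <oo) (en (u_ k) (G_ k) x)%:E)%E.
have en0 k x : (0 <= (en (u_ k) (G_ k) x)%:E)%E by rewrite lee_fin en_ge0.
have men k : measurable_fun D (fun x => (en (u_ k) (G_ k) x)%:E).
  by apply/measurable_EFinP; exact: Ig_measurable (Ig_en (L_ k)).
have S0 x : (0 <= S x)%E by exact: nneseries_ge0.
have mS : measurable_fun D S.
  exact: (@ge0_emeasurable_sum _ T R D (fun k x => (en (u_ k) (G_ k) x)%:E) xpredT).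
have IS : mu.-integrable D S.
  apply/integrableP; split => //.
  rewrite (eq_integral S); last by move=> x _; rewrite gee0_abs.
  rewrite integral_nneseries//.
  apply: (@le_lt_trans _ _ (\sum_(k <oo) (2^-1 ^+ k)%:E)%E).
    apply: lee_nneseries => k _; first by move=> _; exact: integral_ge0.
    by rewrite -RintegralE_Ig ?lee_fin//; [exact: E_|exact: Ig_en].
  have -> : (\sum_(k <oo) (2^-1 ^+ k : R)%:E = (2 : R)%:E)%E; last by rewrite ltry.
  apply/cvg_lim => //; rewrite (_ : (fun _ => _) = EFin \o series (geometric 1 2^-1)); last first.
    apply/funext => k /=; rewrite /series /= -sumEFin; apply: eq_bigr => i _.
    by rewrite /geometric /= mul1r.
  apply: cvg_EFin; first exact: nearW.
  have h2 : `|2^-1 : R| < 1 by rewrite ger0_norm// invf_lt1// ltr1n.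
  have := @cvg_geometric_series _ (1 : R) _ h2.
  by have -> : 1 / (1 - 2^-1) = 2 :> R by field.
have c0 : {ae mu, forall x, D x -> en (u_ k) (G_ k) x @[k --> \oo] --> 0}.
  have := integrable_ae mD IS; apply: filterS => x + Dx => /(_ Dx) Sx.
  have Sfin : (\sum_(0 <= k <oo) (en (u_ k) (G_ k) x)%:E < +oo)%E.
    by rewrite ltey_eq Sx.
  have /fine_cvgP[_] := nneseries_tail_cvg Sfin (fun k _ => en0 k x).
  move=> h; apply: (squeeze_cvgr _ (cvg_cst 0) h).
  have /fine_cvgP[tfin _] := nneseries_tail_cvg Sfin (fun k _ => en0 k x).
  apply: filterS tfin => k tk; rewrite en_ge0 /= -lee_fin fineK//.
  rewrite (nneseries_split k 1)// addn1 big_nat1 leeDl//.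
  exact: nneseries_ge0.
exists S; split => //.
- move=> k x; rewrite /S (nneseries_split 0 k.+1)// add0n big_nat_recr//= -addeA.
  apply: (@le_trans _ _ (\sum_(0 <= i < k) (en (u_ i) (G_ i) x)%:E + (en (u_ k) (G_ k) x)%:E)%E).
    by rewrite leeDr// sume_ge0.
  by rewrite addeA leeDl// nneseries_ge0.
- apply: filterS c0 => x + Dx => /(_ Dx) h; apply: (cvg_powR0_inv p1).
  apply: (squeeze_cvgr _ (cvg_cst 0) h); apply: nearW => k.
  by rewrite powR_ge0 en_le_u.
- apply: filterS c0 => x + Dx => /(_ Dx) h i; apply: (cvg_powR0_inv p1).
  apply: (squeeze_cvgr _ (cvg_cst 0) h); apply: nearW => k.
  by rewrite powR_ge0 en_le_G.
Qed.

End jets.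

Lemma cvg_sum_fin (R : realType) (I : finType) (f_ : nat -> I -> R) (l : I -> R) :
  (forall i, f_ k i @[k --> \oo] --> l i) -> \sum_i f_ k i @[k --> \oo] --> \sum_i l i.
Proof.
move=> h; elim: (index_enum I) => [|i r IH].
  by under eq_fun do rewrite big_nil; rewrite big_nil; exact: cvg_cst.
by under eq_fun do rewrite big_cons; rewrite big_cons; apply: cvgD.
Qed.

Lemma Rintegral_cvg0_dominated d (T : measurableType d) (R : realType)
    (mu : {measure set T -> \bar R}) (D : set T) (f_ : nat -> T -> R) (g : T -> \bar R) :
  measurable D ->
  (forall n, measurable_fun D (f_ n)) ->
  {ae mu, forall x, D x -> f_ n x @[n --> \oo] --> 0} ->
  mu.-integrable D g ->
  {ae mu, forall x, D x -> forall n, (`|f_ n x|%:E <= g x)%E} ->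
  \int[mu]_(x in D) f_ n x @[n --> \oo] --> 0.
Proof.
move=> mD mf_ cf Ig fg.
have [_ _] := @Rintegral_cvg_dominated _ T R mu D mD f_ (cst 0) g mf_ (measurable_cst _) cf Ig fg.
by rewrite [X in _ --> X](_ : _ = 0)// /Rintegral /= integral0.
Qed.

(** * Composition of pairs with a map of two variables *)

Section chain.
Context {d : measure_display} {T : measurableType d} {R : realType} {n : nat}.
Variables (mu : {measure set T -> \bar R}) (D : set T) (p : R).
Hypothesis mD : measurable D.
Hypothesis p1 : 1 < p.
Local Notation W := 'rV[R]_n.
Local Notation Ig f := (mu.-integrable D (EFin \o f)).
Implicit Types (u v : T -> R) (G K : T -> W) (H : R -> R -> R).

Definition cont2 H := forall (s_ t_ : nat -> R) (s t : R),
  s_ k @[k --> \oo] --> s -> t_ k @[k --> \oo] --> t -> H (s_ k) (t_ k) @[k --> \oo] --> H s t.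

Definition meas2 H := forall u v, measurable_fun D u -> measurable_fun D v ->
  measurable_fun D (fun x => H (u x) (v x)).

(** [Ha] and [Hb] play the role of the two partial derivatives of [H], but only bounds, continuity
    and measurability are recorded; that they are derivatives is expressed on test functions by
    [test_chain]. *)
Record chain_map (C : R) H Ha Hb := ChainMap {
  chain_C0 : 0 <= C ;
  chain_cont : [/\ cont2 H, cont2 Ha & cont2 Hb] ;
  chain_meas : [/\ meas2 H, meas2 Ha & meas2 Hb] ;
  chain_growth : forall s t, `|H s t| <= C * (`|s| + `|t|) ;
  chain_boundl : forall s t, `|Ha s t| <= C ;
  chain_boundr : forall s t, `|Hb s t| <= C }.

Definition cgrad Ha Hb u G v K x : W := Ha (u x) (v x) *: G x + Hb (u x) (v x) *: K x.

Variables (C : R) (H Ha Hb : R -> R -> R).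
Hypothesis cH : chain_map C H Ha Hb.

Lemma LpJ_chain u G v K : LpJ mu D p u G -> LpJ mu D p v K ->
  LpJ mu D p (fun x => H (u x) (v x)) (cgrad Ha Hb u G v K).
Proof.
case: cH => C0 _ [m1 m2 m3] g1 g2 g3 [Lu LG] [Lv LK].
have [mu_ _] := Lu; have [mv _] := Lv.
have babs w : Lp mu D p w -> Lp mu D p (fun x => `|w x|).
  move=> Lw; apply: (Lp_le mD p1 _ _ Lw); last by move=> x _; rewrite normr_id.
  by apply: measurableT_comp => //; case: Lw.
split => [|i].
  have L := Lp_scale mD p1 C (Lp_add mD p1 (babs _ Lu) (babs _ Lv)).
  apply: (Lp_le mD p1 (m1 _ _ mu_ mv) _ L) => x _.
  by apply: (le_trans (g1 _ _)); rewrite ler_norm.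
under eq_fun do rewrite !mxE.
apply: (Lp_add mD p1).
  by apply: (Lp_mul_bounded mD p1 (LG i) (m2 _ _ mu_ mv)) => x _; exact: g2.
by apply: (Lp_mul_bounded mD p1 (LK i) (m3 _ _ mu_ mv)) => x _; exact: g3.
Qed.

(** Dominated convergence with the majorants of [fast_cvg]: the coefficients [Ha] and [Hb] converge
    a.e. while staying bounded, and the gradients they multiply converge a.e. under an integrable
    bound. *)
Lemma chain_cvg (u_ : nat -> T -> R) (G_ : nat -> T -> W) (v_ : nat -> T -> R)
    (K_ : nat -> T -> W) u G v K :
  (forall k, LpJ mu D p (u_ k) (G_ k)) -> (forall k, LpJ mu D p (v_ k) (K_ k)) ->
  LpJ mu D p u G -> LpJ mu D p v K ->
  (forall k, energy mu D p (fun x => u_ k x - u x) (fun x => G_ k x - G x) <= 2^-1 ^+ k) ->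
  (forall k, energy mu D p (fun x => v_ k x - v x) (fun x => K_ k x - K x) <= 2^-1 ^+ k) ->
  energy mu D p (fun x => H (u_ k x) (v_ k x) - H (u x) (v x))
     (fun x => cgrad Ha Hb (u_ k) (G_ k) (v_ k) (K_ k) x - cgrad Ha Hb u G v K x)
     @[k --> \oo] --> 0.
Proof.
move=> Lu_ Lv_ Lu Lv Eu Ev; case: (cH) => C0 [c1 c2 c3] _ g1 g2 g3.
have [S [IS Sd cu cG]] := fast_cvg mD p1 (fun k => LpJ_sub mD p1 (Lu_ k) Lu) Eu.
have [S' [IS' Sd' cv cK]] := fast_cvg mD p1 (fun k => LpJ_sub mD p1 (Lv_ k) Lv) Ev.
have L0 k := LpJ_sub mD p1 (LpJ_chain (Lu_ k) (Lv_ k)) (LpJ_chain Lu Lv).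
(* One factor n + 1 for the n + 1 scalar terms of [en], the 4 from the four-term power bound, and
   the 2 because the limit appears twice: in itself and in |u_k| <= |u_k - u| + |u|. *)
pose c := (C * 2 * 4) `^ p * n.+1%:R.
have c0 : 0 <= c by rewrite mulr_ge0// powR_ge0.
pose M x : \bar R := (c%:E * (S x + (en p u G x)%:E + S' x + (en p v K x)%:E))%E.
have IM : mu.-integrable D M.
  apply: integrableZl => //; have Iu := Ig_en mD Lu; have Iv := Ig_en mD Lv.
  exact: (integrableD mD (integrableD mD (integrableD mD IS Iu) IS') Iv).
apply: (@Rintegral_cvg0_dominated _ T R mu D _ M mD).
- by move=> k; exact: Ig_measurable (Ig_en mD (L0 k)).
- apply: filterS2 (filterI cu cv) (filterI cG cK) => x [hu hv] [hG hK] Dx.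
  have {}hu : u_ k x @[k --> \oo] --> u x by apply/subr_cvg0; exact: hu.
  have {}hv : v_ k x @[k --> \oo] --> v x by apply/subr_cvg0; exact: hv.
  have {}hG i : G_ k x ord0 i @[k --> \oo] --> G x ord0 i.
    by apply/subr_cvg0; have := hG Dx i; under eq_fun do rewrite !mxE.
  have {}hK i : K_ k x ord0 i @[k --> \oo] --> K x ord0 i.
    by apply/subr_cvg0; have := hK Dx i; under eq_fun do rewrite !mxE.
  rewrite /en -[X in _ --> X](addr0 0); apply: cvgD.
    by apply: cvg_powR0 => //; apply/subr_cvg0; exact: c1.
  rewrite -[X in _ --> X](@big1 R 0 +%R 'I_n (index_enum _) xpredT (fun=> 0))//.
  apply: cvg_sum_fin => i.
  apply: cvg_powR0 => //; under eq_fun do rewrite !mxE; apply/subr_cvg0.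
  by apply: cvgD; apply: cvgM => //; [exact: c2|exact: c3].
- exact: IM.
- apply: aeW => x Dx k; rewrite ger0_norm ?en_ge0//.
  have Sx := Sd k x; have Sx' := Sd' k x.
  apply: (@le_trans _ _ ((c * (en p (fun x => u_ k x - u x) (fun x => G_ k x - G x) x + en p u G x
    + en p (fun x => v_ k x - v x) (fun x => K_ k x - K x) x + en p v K x))%:E)); last first.
    by rewrite EFinM !EFinD lee_wpmul2l ?lee_fin// !leeD.
  rewrite lee_fin.
  set e1 := en p (fun x => u_ k x - u x) _ x; set e2 := en p u G x.
  set e3 := en p (fun x => v_ k x - v x) _ x; set e4 := en p v K x.
  have key (b a1 a2 a3 a4 : R) :
      `|b| <= C * (`|a1| + 2 * `|a2| + `|a3| + 2 * `|a4|) ->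
      `|a1| `^ p <= e1 -> `|a2| `^ p <= e2 -> `|a3| `^ p <= e3 -> `|a4| `^ p <= e4 ->
      `|b| `^ p <= (C * 2 * 4) `^ p * (e1 + e2 + e3 + e4).
    move=> hb h1 h2 h3 h4.
    apply: (@le_trans _ _ ((C * 2 * 4) `^ p * (`|a1| `^ p + `|a2| `^ p + `|a3| `^ p + `|a4| `^ p))).
      apply: powR_max4 => //; first by rewrite mulr_ge0.
      apply: (le_trans hb); rewrite -mulrA ler_wpM2l//.
      have := normr_ge0 a1; have := normr_ge0 a3; lra.
    by rewrite ler_wpM2l ?powR_ge0//; lra.
  have tri (a b : R) : `|a| <= `|a - b| + `|b| by rewrite -{1}(subrK b a) ler_normD.
  rewrite /c [leRHS](_ : _ = \sum_(i < n.+1) ((C * 2 * 4) `^ p * (e1 + e2 + e3 + e4))); last first.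
    by rewrite sumr_const card_ord -[RHS]mulr_natr mulrAC.
  rewrite big_ord_recl /en; apply: lerD.
    apply: (key _ (u_ k x - u x) (u x) (v_ k x - v x) (v x)).
    + apply: (le_trans (ler_normB _ _)).
      apply: (le_trans (lerD (g1 _ _) (g1 _ _))); rewrite -mulrDr ler_wpM2l//.
      have := tri (u_ k x) (u x); have := tri (v_ k x) (v x); lra.
    + exact: (en_le_u p (fun x => u_ k x - u x) _ x).
    + exact: en_le_u.
    + exact: (en_le_u p (fun x => v_ k x - v x) _ x).
    + exact: en_le_u.
  apply: ler_sum => i _.
  apply: (key _ (G_ k x ord0 i - G x ord0 i) (G x ord0 i) (K_ k x ord0 i - K x ord0 i) (K x ord0 i)).
  + rewrite !mxE; apply: (le_trans (ler_normB _ _)).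
    apply: (@le_trans _ _ (C * `|G_ k x ord0 i| + C * `|K_ k x ord0 i| + (C * `|G x ord0 i| + C * `|K x ord0 i|))).
      by apply: lerD; apply: (le_trans (ler_normD _ _)); rewrite !normrM lerD// ler_wpM2r.
    rewrite -!mulrDr ler_wpM2l//.
    have := tri (G_ k x ord0 i) (G x ord0 i); have := tri (K_ k x ord0 i) (K x ord0 i); lra.
  + by have := en_le_G p (fun x => u_ k x - u x) (fun x => G_ k x - G x) x i; rewrite !mxE.
  + exact: en_le_G.
  + by have := en_le_G p (fun x => v_ k x - v x) (fun x => K_ k x - K x) x i; rewrite !mxE.
  + exact: en_le_G.
Qed.

End chain.

(** * The Euclidean norm *)

Section enorm_theory.
Context {R : realType} {N : nat}.
Local Notation V := 'rV[R]_N.+1.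
Implicit Types a b c : V.

Lemma edotC a b : edot a b = edot b a.
Proof. by apply: eq_bigr => i _; rewrite mulrC. Qed.

Lemma edotDl a b c : edot (a + b) c = edot a c + edot b c.
Proof. by rewrite /edot -big_split; apply: eq_bigr => i _; rewrite mxE mulrDl. Qed.

Lemma edotZl (s : R) a b : edot (s *: a) b = s * edot a b.
Proof. by rewrite /edot mulr_sumr; apply: eq_bigr => i _; rewrite mxE mulrA. Qed.

Lemma edotDr a b c : edot c (a + b) = edot c a + edot c b.
Proof. by rewrite edotC edotDl !(edotC c). Qed.

Lemma edotZr (s : R) a b : edot b (s *: a) = s * edot b a.
Proof. by rewrite edotC edotZl (edotC b). Qed.

Lemma edot_ge0 a : 0 <= edot a a.
Proof. by apply: sumr_ge0 => i _; rewrite -expr2 sqr_ge0. Qed.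

Lemma enorm_ge0 a : 0 <= enorm a.
Proof. exact: sqrtr_ge0. Qed.

Lemma sqr_enorm a : enorm a ^+ 2 = edot a a.
Proof. by rewrite sqr_sqrtr ?edot_ge0. Qed.

Lemma coord_le_enorm a i : `|a ord0 i| <= enorm a.
Proof.
rewrite -sqrtr_sqr ler_wsqrtr// /edot (bigD1 i)//= expr2 lerDl.
by apply: sumr_ge0 => j _; rewrite -expr2 sqr_ge0.
Qed.

Lemma enorm_le_sum a : enorm a <= \sum_i `|a ord0 i|.
Proof.
have s0 : 0 <= \sum_i `|a ord0 i| by exact: sumr_ge0.
rewrite -[leRHS](ger0_norm s0) -sqrtr_sqr ler_wsqrtr// expr2 mulr_suml.
apply: ler_sum => i _; rewrite -[X in X <= _]ger0_norm ?normrM; last by rewrite -expr2 sqr_ge0.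
by rewrite ler_wpM2l// (bigD1 i)//= lerDl sumr_ge0.
Qed.

Lemma cauchy_schwarz a b : `|edot a b| <= enorm a * enorm b.
Proof.
have h : edot a b ^+ 2 <= edot a a * edot b b.
  have [b0|b0] := eqVneq (edot b b) 0.
    have bi i : b ord0 i = 0.
      apply/eqP; rewrite -normr_le0 (le_trans (coord_le_enorm b i))//.
      by rewrite /enorm b0 sqrtr0.
    rewrite b0 mulr0 /edot big1 ?expr0n// => i _; by rewrite bi mulr0.
  have b1 : 0 < edot b b by rewrite lt0r b0 edot_ge0.
  have := edot_ge0 (edot b b *: a + (- edot a b) *: b).
  rewrite edotDl !edotDr !edotZl !edotZr (edotC b a) => h.
  have : 0 <= edot b b * (edot a a * edot b b - edot a b ^+ 2).
    by apply: le_trans h _; rewrite le_eqVlt; apply/orP; left; apply/eqP; ring.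
  by rewrite pmulr_rge0// subr_ge0.
rewrite -(ger0_norm (mulr_ge0 (enorm_ge0 a) (enorm_ge0 b))) -ler_sqr ?nnegrE//.
by rewrite !real_normK ?num_real// exprMn !sqr_enorm.
Qed.

Lemma enormZ (s : R) a : enorm (s *: a) = `|s| * enorm a.
Proof.
by rewrite /enorm edotZl edotZr mulrA -expr2 sqrtrM ?sqr_ge0// sqrtr_sqr.
Qed.

End enorm_theory.

Section enorm_energy.
Context {d : measure_display} {T : measurableType d} {R : realType} {N : nat}.
Variables (mu : {measure set T -> \bar R}) (D : set T) (p : R).
Hypothesis mD : measurable D.
Hypothesis p1 : 1 < p.
Local Notation V := 'rV[R]_N.+1.
Implicit Types (u v : T -> R) (G K : T -> V).

Let p0 : 0 < p. Proof. exact: lt_trans p1. Qed.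

Lemma powR_sum_le (n : nat) (a : 'I_n -> R) : (forall i, 0 <= a i) ->
  (\sum_i a i) `^ p <= n%:R `^ p * \sum_i (a i) `^ p.
Proof.
case: n a => [|n] a a0; first by rewrite !big_ord0 powR0 ?gt_eqF// mul0r.
have [j _ hj] := @arg_maxP _ _ _ (ord0 : 'I_n.+1) xpredT a isT.
apply: (@le_trans _ _ ((n.+1%:R * a j) `^ p)).
  apply: powR_mono => //; first by rewrite sumr_ge0.
  apply: (@le_trans _ _ (\sum_(i < n.+1) a j)); first by apply: ler_sum => i _; exact: hj.
  by rewrite sumr_const card_ord mulr_natl.
rewrite powRM// ler_wpM2l ?powR_ge0// (bigD1 j)//= lerDl sumr_ge0// => i _; exact: powR_ge0.
Qed.

Definition enp (G : T -> V) x := enorm (G x) `^ p.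

Lemma enp_le G x : enp G x <= N.+1%:R `^ p * \sum_i `|G x ord0 i| `^ p.
Proof.
apply: (@le_trans _ _ ((\sum_i `|G x ord0 i|) `^ p)); last exact: powR_sum_le.
by apply: powR_mono => //; [exact: enorm_ge0|exact: enorm_le_sum].
Qed.

Lemma enp_ge G x i : `|G x ord0 i| `^ p <= enp G x.
Proof. by apply: powR_mono => //; exact: coord_le_enorm. Qed.

Lemma measurable_enorm G : (forall i, measurable_fun D (fun x => G x ord0 i)) ->
  measurable_fun D (fun x => enorm (G x)).
Proof.
move=> mG; apply: measurableT_comp; first exact: (continuous_measurable_fun (@sqrt_continuous R)).
by apply: measurable_sum => i; exact: measurable_funM.
Qed.

Lemma measurable_edot G K : (forall i, measurable_fun D (fun x => G x ord0 i)) ->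
  (forall i, measurable_fun D (fun x => K x ord0 i)) ->
  measurable_fun D (fun x => edot (G x) (K x)).
Proof. by move=> mG mK; apply: measurable_sum => i; exact: measurable_funM. Qed.

Lemma Ig_enp G : (forall i, Lp mu D p (fun x => G x ord0 i)) ->
  mu.-integrable D (EFin \o enp G).
Proof.
move=> LG; have IG : mu.-integrable D (EFin \o (fun x => \sum_i `|G x ord0 i| `^ p)).
  by apply: Ig_sum => // i; case: (LG i).
apply: (Ig_le mD _ _ (Ig_scale mD (N.+1%:R `^ p) IG)).
  apply: (measurableT_comp (measurable_powR p)).
  by apply: measurable_enorm => i; case: (LG i).
by move=> x _; rewrite ger0_norm ?powR_ge0//; exact: enp_le.
Qed.

Definition enormp u G : R := \int[mu]_(x in D) (`|u x| `^ p) + \int[mu]_(x in D) enp G x.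

Lemma enormp_ge0 u G : 0 <= enormp u G.
Proof. by rewrite addr_ge0// Rintegral_ge0// => x _; exact: powR_ge0. Qed.

Lemma enormp_le u G : LpJ mu D p u G -> enormp u G <= (1 + N.+1%:R `^ p) * energy mu D p u G.
Proof.
move=> L; have [[mu_ Iu] LG] := L; have Ie := Ig_en mD L; have IG := Ig_enp LG.
rewrite /enormp -RintegralD// /energy -RintegralZl//; apply: le_Rintegral => //.
- exact: Ig_add.
- exact: Ig_scale.
move=> x _; have := enp_le G x; set c := _ `^ p => h.
have c0 : 0 <= c by exact: powR_ge0.
have a0 := powR_ge0 `|u x| p.
have s0 : 0 <= \sum_i `|G x ord0 i| `^ p by apply: sumr_ge0 => i _; exact: powR_ge0.
rewrite /en; nra.
Qed.

Lemma energy_le u G : LpJ mu D p u G -> energy mu D p u G <= N.+1%:R * enormp u G.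
Proof.
move=> L; have [[mu_ Iu] LG] := L; have Ie := Ig_en mD L; have IG := Ig_enp LG.
rewrite /enormp -RintegralD// /energy -RintegralZl//; last exact: Ig_add.
apply: le_Rintegral => //.
  by apply: Ig_scale => //; exact: Ig_add.
move=> x _; rewrite /en mulrDr; apply: lerD.
  by rewrite ler_peMl ?powR_ge0// ler1n.
apply: (@le_trans _ _ (\sum_(i < N.+1) enp G x)); first by apply: ler_sum => i _; exact: enp_ge.
by rewrite sumr_const card_ord mulr_natl.
Qed.

Lemma enormp_scale (c : R) u G : LpJ mu D p u G ->
  enormp (fun x => c * u x) (fun x => c *: G x) = `|c| `^ p * enormp u G.
Proof.
move=> [[mu_ Iu] LG]; have IG := Ig_enp LG.
rewrite /enormp mulrDr -!RintegralZl//; congr (_ + _); apply: eq_Rintegral => x _.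
  by rewrite normrM powRM.
by rewrite /enp enormZ powRM// enorm_ge0.
Qed.

End enorm_energy.

(** * Weak gradients *)

(** Since |w| <= 1 + |w|^p, the majorant is a multiple of 1 + S, integrable because D has finite
    measure. *)
Lemma fast_mul_bounded d (T : measurableType d) (R : realType) (n : nat)
    (mu : {measure set T -> \bar R}) (D : set T) (p : R) (u_ : nat -> T -> R)
    (G_ : nat -> T -> 'rV[R]_n) (m : T -> R) (C : R) :
  measurable D -> 1 < p -> (mu D < +oo)%E ->
  (forall k, LpJ mu D p (u_ k) (G_ k)) ->
  (forall k, energy mu D p (u_ k) (G_ k) <= 2^-1 ^+ k) ->
  measurable_fun D m -> (forall x, D x -> `|m x| <= C) ->
  \int[mu]_(x in D) (u_ k x * m x) @[k --> \oo] --> 0 /\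
  forall i, \int[mu]_(x in D) (G_ k x ord0 i * m x) @[k --> \oo] --> 0.
Proof.
move=> mD p1 Dfin L_ E_ mm mC.
have [S [IS Sd cu cG]] := fast_cvg mD p1 L_ E_.
have key (w_ : nat -> T -> R) : (forall k, measurable_fun D (w_ k)) ->
    (forall k x, `|w_ k x| `^ p <= en p (u_ k) (G_ k) x) ->
    {ae mu, forall x, D x -> w_ k x @[k --> \oo] --> 0} ->
    \int[mu]_(x in D) (w_ k x * m x) @[k --> \oo] --> 0.
  move=> mw wen cw.
  apply: (@Rintegral_cvg0_dominated _ T R mu D _ (fun x => `|C|%:E * (1 + S x))%E mD).
  - by move=> k; exact: measurable_funM.
  - by apply: filterS cw => x + Dx => /(_ Dx) h; rewrite -[X in _ --> X](mul0r (m x)); exact: cvgMl.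
  - by apply: integrableZl => //; apply: integrableD => //; exact: (Ig_cst mD 1 Dfin).
  - apply: aeW => x Dx k; apply: (@le_trans _ _ (`|C| * (1 + en p (u_ k) (G_ k) x))%:E).
      rewrite lee_fin normrM mulrC; apply: ler_pM => //.
        by apply: (le_trans (mC x Dx)); exact: ler_norm.
      by apply: (le_trans (ler_1DpowR p1 (normr_ge0 _))); rewrite lerD2l.
    by rewrite EFinM EFinD lee_wpmul2l ?lee_fin// leeD2l.
split => [|i].
  apply: key => //; last by move=> k x; exact: en_le_u.
  by move=> k; have [[]] := L_ k.
apply: key.
- by move=> k; have [_ /(_ i)[]] := L_ k.
- by move=> k x; exact: en_le_G.
- by apply: filterS cG => x h Dx; exact: h.
Qed.

(** * The space W^{1,p}_0 through approximating pairs *)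

Section sobolev_zero.
Context {R : realType} {N : nat}.
Local Notation V := 'rV[R]_N.+1.
Local Notation T := (leb_type R N).
Local Notation mu := (@leb R N).
Variables (Omega : set V) (p : R).
Hypothesis oO : open Omega.
Hypothesis bO : bounded_set Omega.
Hypothesis p1 : 1 < p.
Implicit Types (u v phi psi : V -> R) (G K : V -> V).

Local Notation LpO u := (@Lp _ T R mu Omega p u).
Local Notation LJ u G := (@LpJ _ T R N.+1 mu Omega p u G).
Local Notation EO u G := (@energy _ T R N.+1 mu Omega p u G).
Local Notation IO f := (mu.-integrable (Omega : set T) (EFin \o (f : T -> R))).

Lemma mO : measurable (Omega : set T).
Proof. exact: measurable_leb_open. Qed.

Lemma O_fin : (mu Omega < +oo)%E.
Proof. exact: leb_bounded. Qed.

Lemma in_LpP u : in_Lp Omega p u <-> LpO u.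
Proof.
split => -[mu_ Iu]; split; [exact: mu_| |exact: mu_|].
- exact: (@Ig_ge0_lty _ T R mu Omega _ (@measurable_norm_powR _ T R Omega p u mu_)
    (fun x _ => powR_ge0 _ _) Iu).
- exact: (@Ig_lty _ T R mu Omega mO _ (fun x _ => powR_ge0 _ _) Iu).
Qed.

Definition tgrad phi : V -> V := fun x => \row_i partial i phi x.

Lemma test_Ig phi : test_function Omega phi -> IO phi.
Proof.
move=> /test_integrable; apply: (@integrableS _ T R mu setT Omega) => //; exact: mO.
Qed.

Lemma test_meas phi : test_function Omega phi -> measurable_fun (Omega : set T) (phi : T -> R).
Proof. by move=> /test_Ig /(@Ig_measurable _ T R mu Omega). Qed.

Lemma test_Lp phi : test_function Omega phi -> LpO phi.
Proof.
move=> tp; have [C hC] := test_bounded tp; split; first exact: test_meas.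
apply: (@Ig_le _ T R mu Omega mO _ (fun=> C `^ p)).
- by apply: (@measurable_norm_powR _ T); exact: test_meas.
- by move=> x _; rewrite ger0_norm ?powR_ge0// powR_mono.
- exact: (@Ig_cst _ T R mu Omega mO (C `^ p) O_fin).
Qed.

Lemma test_LpJ phi : test_function Omega phi -> LJ phi (tgrad phi).
Proof.
move=> tp; split; first exact: test_Lp.
by move=> i; under eq_fun do rewrite mxE; apply: test_Lp; exact: test_partial.
Qed.

Lemma Lp_mul_test_Ig u phi : LpO u -> test_function Omega phi -> IO (fun x => u x * phi x).
Proof.
move=> Lu tp; have [C hC] := test_bounded tp.
apply: (@Ig_mul_bounded _ T R mu Omega _ _ C mO) => //.
- exact: (@Lp_Ig _ T R mu Omega p mO p1 u O_fin Lu).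
- exact: test_meas.
Qed.

Lemma Rintegral_test_setT phi : test_function Omega phi ->
  \int[mu]_(x in Omega) phi x = \int[mu]_x phi x.
Proof.
move=> tp; rewrite -[LHS](@Rintegral_restrict _ T R mu Omega); apply: eq_Rintegral => x _.
have [xO|xO] := pselect (Omega x); first by rewrite indicE mem_set// mulr1.
by rewrite (test_support_Omega tp xO) mul0r.
Qed.

Lemma test_by_parts i phi psi : test_function Omega phi -> test_function Omega psi ->
  \int[mu]_(x in Omega) (phi x * partial i psi x) =
  - \int[mu]_(x in Omega) (partial i phi x * psi x).
Proof.
move=> tp tq; have sp := test_smooth tp; have sq := test_smooth tq.
apply/eqP; rewrite -addr_eq0; apply/eqP.
have I1 := Lp_mul_test_Ig (test_Lp tp) (test_partial i tq).
have I2 := Lp_mul_test_Ig (test_Lp (test_partial i tp)) tq.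
rewrite -(@RintegralD _ T R mu Omega _ _ mO I1 I2).
have tpq := test_mul sp tq.
rewrite -(Rintegral_partial_eq0 i tpq) -(Rintegral_test_setT (test_partial i tpq)).
apply: eq_Rintegral => x _; rewrite partial_mul; last 2 first.
- exact: smooth_diff.
- exact: smooth_diff.
by rewrite [psi x * _]mulrC.
Qed.

Lemma test_weak_gradient phi : test_function Omega phi ->
  is_weak_gradient Omega p phi (tgrad phi).
Proof.
move=> tp; split => [i|psi i tq].
  by apply/in_LpP; have [_] := test_LpJ tp; exact.
by rewrite test_by_parts//; congr (- _); apply: eq_Rintegral => x _; rewrite mxE.
Qed.

Lemma weak_gradient_LpJ u G : in_Lp Omega p u -> is_weak_gradient Omega p u G -> LJ u G.
Proof. by move=> /in_LpP Lu [LG _]; exact: (conj Lu (fun i => (in_LpP _).1 (LG i))). Qed.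

Lemma weak_gradient_lin (a : R) u G v K : in_Lp Omega p u -> in_Lp Omega p v ->
  is_weak_gradient Omega p u G -> is_weak_gradient Omega p v K ->
  is_weak_gradient Omega p (fun x => a * u x + v x) (fun x => a *: G x + K x).
Proof.
move=> Lu Lv wu wv; have L1 := weak_gradient_LpJ Lu wu; have L2 := weak_gradient_LpJ Lv wv.
have [L _] := LpJ_add mO p1 (LpJ_scale mO p1 a L1) L2.
split => [i|phi i tp].
  by apply/in_LpP; have [_] := LpJ_add mO p1 (LpJ_scale mO p1 a L1) L2; exact.
have [_ /(_ phi i tp) e1] := wu; have [_ /(_ phi i tp) e2] := wv.
have tpi := test_partial i tp.
have Iu := Lp_mul_test_Ig L1.1 tpi; have Iv := Lp_mul_test_Ig L2.1 tpi.
have IG := Lp_mul_test_Ig (L1.2 i) tp; have IK := Lp_mul_test_Ig (L2.2 i) tp.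
transitivity (a * \int[mu]_(x in Omega) (u x * partial i phi x) +
  \int[mu]_(x in Omega) (v x * partial i phi x)).
  rewrite -(@RintegralZl _ T R mu Omega _ _ mO Iu).
  rewrite -(@RintegralD _ T R mu Omega _ _ mO (Ig_scale mO a Iu) Iv).
  by apply: eq_Rintegral => x _; ring.
rewrite e1 e2 mulrN -opprD; congr (- _).
rewrite -(@RintegralZl _ T R mu Omega _ _ mO IG).
rewrite -(@RintegralD _ T R mu Omega _ _ mO (Ig_scale mO a IG) IK).
by apply: eq_Rintegral => x _; rewrite !mxE; ring.
Qed.

(** The difference of the gradients is orthogonal to every test function, coordinate by coordinate.
    Functions that agree only a.e. are allowed, because the truncated direction taken at u agrees
    with v only a.e. *)
Lemma weak_gradient_unique u v G K : in_Lp Omega p u -> in_Lp Omega p v ->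
  {ae mu, forall x : T, Omega x -> u x = v x} ->
  is_weak_gradient Omega p u G -> is_weak_gradient Omega p v K ->
  {ae mu, forall x : T, Omega x -> G x = K x}.
Proof.
move=> Lu Lv uv wu wv; have L1 := weak_gradient_LpJ Lu wu; have L2 := weak_gradient_LpJ Lv wv.
have h i : {ae mu, forall x : T, Omega x -> G x ord0 i - K x ord0 i = 0}.
  have Id := Ig_sub mO (@Lp_Ig _ T R mu Omega p mO p1 _ O_fin (L1.2 i))
    (@Lp_Ig _ T R mu Omega p mO p1 _ O_fin (L2.2 i)).
  apply: (weak_zero oO bO Id) => phi tp.
  have [_ /(_ phi i tp) e1] := wu; have [_ /(_ phi i tp) e2] := wv.
  have IG := Lp_mul_test_Ig (L1.2 i) tp; have IK := Lp_mul_test_Ig (L2.2 i) tp.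
  transitivity (\int[mu]_(x in Omega) (G x ord0 i * phi x) -
    \int[mu]_(x in Omega) (K x ord0 i * phi x)).
    rewrite -(@RintegralB _ T R mu Omega _ _ mO IG IK).
    by apply: eq_Rintegral => x _; ring.
  apply/eqP; rewrite subr_eq0 -eqr_opp -e1 -e2; apply/eqP.
  have tpi := test_partial i tp.
  apply: (@ae_eq_Rintegral _ T R mu Omega mO).
  - exact: Ig_measurable (Lp_mul_test_Ig L1.1 tpi).
  - exact: Ig_measurable (Lp_mul_test_Ig L2.1 tpi).
  - by apply: filterS uv => x uv Ox; rewrite uv.
(* The finitely many coordinates are indexed by natural numbers, so that the countable union of null
   sets applies. *)
have : {ae mu, forall (x : T) (k : nat), Omega x -> forall i : 'I_N.+1, i = k :> nat -> G x ord0 i - K x ord0 i = 0}.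
  apply: ae_foralln => k.
  have [kN|kN] := ltnP k N.+1.
    apply: filterS (h (Ordinal kN)) => x hx Ox i ik.
    have -> : i = Ordinal kN by exact: val_inj.
    exact: hx.
  by apply: aeW => x Ox i ik; move: kN; rewrite -ik leqNgt ltn_ord.
apply: filterS => x hx Ox; apply/rowP => i; apply/eqP; rewrite -subr_eq0; apply/eqP.
exact: (hx i Ox i).
Qed.

Lemma W1p_grad u : W1p Omega p u -> is_weak_gradient Omega p u (grad Omega p u).
Proof. by move=> [_ ex]; exact: xgetPex. Qed.

Definition W0 u G := LJ u G /\ forall e : R, 0 < e -> exists2 phi, test_function Omega phi &
  EO (fun x => u x - phi x) (fun x => G x - tgrad phi x) < e.

Lemma W0_fast u G : W0 u G -> exists2 phi_ : nat -> V -> R,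
  forall k, test_function Omega (phi_ k) &
  forall k, EO (fun x => phi_ k x - u x) (fun x => tgrad (phi_ k) x - G x) <= 2^-1 ^+ k.
Proof.
move=> [L h].
have e0 k : 0 < 2^-1 ^+ k :> R by rewrite exprn_gt0// invr_gt0.
have /choice[phi_ hphi] : forall k : nat, exists phi, test_function Omega phi /\
    EO (fun x => u x - phi x) (fun x => G x - tgrad phi x) < 2^-1 ^+ k.
  by move=> k; have [phi tp E] := h _ (e0 k); exists phi.
exists phi_ => k; first by case: (hphi k).
by rewrite energy_subC; apply: ltW; case: (hphi k).
Qed.

Lemma W0_weak u G : W0 u G -> is_weak_gradient Omega p u G.
Proof.
move=> W; have [phi_ tphi Ephi] := W0_fast W; have [L _] := W.
split => [i|psi i tq]; first exact: (in_LpP _).2 (L.2 i).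
have tqi := test_partial i tq.
have Lk k := LpJ_sub mO p1 (test_LpJ (tphi k)) L.
have [C1 hC1] := test_bounded tq; have [C2 hC2] := test_bounded tqi.
have [c1 _] := fast_mul_bounded mO p1 O_fin Lk Ephi (test_meas tqi) (fun x _ => hC2 x).
have [_ c2] := fast_mul_bounded mO p1 O_fin Lk Ephi (test_meas tq) (fun x _ => hC1 x).
have I1 := Lp_mul_test_Ig L.1 tqi; have I2 := Lp_mul_test_Ig (L.2 i) tq.
apply/eqP; rewrite -addr_eq0 -oppr_eq0; apply/eqP.
set A := (X in - X = 0).
(* Integration by parts is exact for phi_k, so the defect of phi_k - u is the constant - A, while
   both of its integrals tend to 0. *)
suff E k : \int[mu]_(x in Omega) ((phi_ k x - u x) * partial i psi x) +
    \int[mu]_(x in Omega) ((tgrad (phi_ k) x - G x) ord0 i * psi x) = - A.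
  have c12 : (\int[mu]_(x in Omega) ((phi_ k x - u x) * partial i psi x) +
    \int[mu]_(x in Omega) ((tgrad (phi_ k) x - G x) ord0 i * psi x)) @[k --> \oo] --> (0 : R) + 0.
    by apply: cvgD; [exact: c1|exact: c2].
  rewrite -[RHS](addr0 0) -(cvg_lim _ c12)//.
  by under eq_fun do rewrite E; rewrite lim_cst.
rewrite {}/A.
have I3 := Lp_mul_test_Ig (test_LpJ (tphi k)).1 tqi.
have I4 := Lp_mul_test_Ig ((test_LpJ (tphi k)).2 i) tq.
have [_ /(_ psi i tq) bp] := test_weak_gradient (tphi k).
transitivity ((\int[mu]_(x in Omega) (phi_ k x * partial i psi x) -
   \int[mu]_(x in Omega) (u x * partial i psi x)) +
  (\int[mu]_(x in Omega) (tgrad (phi_ k) x ord0 i * psi x) -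
   \int[mu]_(x in Omega) (G x ord0 i * psi x))).
  rewrite -(@RintegralB _ T R mu Omega _ _ mO I3 I1).
  rewrite -(@RintegralB _ T R mu Omega _ _ mO I4 I2).
  congr (_ + _); apply: eq_Rintegral => x _; rewrite ?mxE; ring.
by rewrite bp; ring.
Qed.

(** [grad] agrees a.e. with any weak gradient G, so the norm may be computed from G. *)
Lemma sobolev_normE u G : in_Lp Omega p u -> is_weak_gradient Omega p u G ->
  sobolev_norm Omega p u = (@enormp _ T R N mu Omega p u G) `^ p^-1.
Proof.
move=> Lu wu.
have wg := W1p_grad (conj Lu (ex_intro _ G wu)).
have L1 := weak_gradient_LpJ Lu wu; have L2 := weak_gradient_LpJ Lu wg.
have E : \int[mu]_(x in Omega) (enorm (grad Omega p u x) `^ p) =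
    \int[mu]_(x in Omega) (@enp _ T R N p G x).
  apply: (@ae_eq_Rintegral _ T R mu Omega mO).
  - exact: Ig_measurable (Ig_enp mO p1 L2.2).
  - exact: Ig_measurable (Ig_enp mO p1 L1.2).
  have := weak_gradient_unique Lu Lu (aeW _ (fun x _ => erefl)) wg wu.
  by apply: filterS => x + Ox => /(_ Ox); rewrite /enp => ->.
by rewrite /sobolev_norm E.
Qed.

Lemma sobolev_norm_ge0 u : 0 <= sobolev_norm Omega p u.
Proof. exact: powR_ge0. Qed.

Lemma sobolev_norm_powR u G : in_Lp Omega p u -> is_weak_gradient Omega p u G ->
  sobolev_norm Omega p u `^ p = @enormp _ T R N mu Omega p u G.
Proof. by move=> Lu wu; rewrite (sobolev_normE Lu wu) powRVK// enormp_ge0. Qed.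

Lemma W0_Lp u G : W0 u G -> in_Lp Omega p u.
Proof. by move=> [L _]; apply/in_LpP; exact: L.1. Qed.

Lemma W0_W1p0 u G : W0 u G -> W1p0 Omega p u.
Proof.
move=> W; have wu := W0_weak W; have Lu := W0_Lp W; have [L h] := W.
split; first by split => //; exists G.
move=> e e0.
pose c : R := 1 + N.+1%:R `^ p.
have c0 : 0 < c by rewrite ltr_pwDl// powR_ge0.
have [phi tp hphi] := h (e `^ p / c) (divr_gt0 (powR_gt0 _ e0) c0).
exists phi => //.
have Lphi := (in_LpP _).2 (test_LpJ tp).1.
have wd : is_weak_gradient Omega p (u \- phi) (fun x => G x - tgrad phi x).
  have := weak_gradient_lin (-1) Lphi Lu (test_weak_gradient tp) wu.
  rewrite (_ : (fun x => -1 * phi x + u x) = u \- phi); last by apply/funext => x /=; ring.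
  by rewrite (_ : (fun x => -1 *: tgrad phi x + G x) = fun x => G x - tgrad phi x)//;
    apply/funext => x; rewrite scaleN1r addrC.
have LJd := LpJ_sub mO p1 L (test_LpJ tp).
have Ld : in_Lp Omega p (u \- phi) by exact: (in_LpP _).2 LJd.1.
rewrite -(powR_ltP p1) ?sobolev_norm_ge0 ?(ltW e0)// (sobolev_norm_powR Ld wd).
apply: (le_lt_trans (enormp_le mO p1 LJd)); rewrite mulrC -ltr_pdivlMr//.
Qed.

Lemma W1p0_W0 u : W1p0 Omega p u -> W0 u (grad Omega p u).
Proof.
move=> [Wu h]; have wu := W1p_grad Wu; have [Lu _] := Wu; have L := weak_gradient_LpJ Lu wu.
split => // e e0.
have c0 : 0 < N.+1%:R :> R by [].
have ec : 0 < e / N.+1%:R by rewrite divr_gt0.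
have [phi tp hphi] := h ((e / N.+1%:R) `^ p^-1) (powR_gt0 _ ec).
exists phi => //.
have Lphi := (in_LpP _).2 (test_LpJ tp).1.
have wd : is_weak_gradient Omega p (u \- phi) (fun x => grad Omega p u x - tgrad phi x).
  have := weak_gradient_lin (-1) Lphi Lu (test_weak_gradient tp) wu.
  rewrite (_ : (fun x => -1 * phi x + u x) = u \- phi); last by apply/funext => x /=; ring.
  by rewrite (_ : (fun x => -1 *: tgrad phi x + _ x) = fun x => grad Omega p u x - tgrad phi x)//;
    apply/funext => x; rewrite scaleN1r addrC.
have LJd := LpJ_sub mO p1 L (test_LpJ tp).
have Ld : in_Lp Omega p (u \- phi) by exact: (in_LpP _).2 LJd.1.
apply: (le_lt_trans (energy_le mO p1 LJd)).
rewrite -(sobolev_norm_powR Ld wd) mulrC -ltr_pdivlMr//.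
by rewrite -[X in _ < X](powRVK p1 (ltW ec)) powR_ltP// ?sobolev_norm_ge0// powR_ge0.
Qed.

Lemma W0_grad u G : W0 u G -> {ae mu, forall x : T, Omega x -> grad Omega p u x = G x}.
Proof.
move=> W; have Lu := W0_Lp W; have [W1 _] := W0_W1p0 W.
exact: (weak_gradient_unique Lu Lu (aeW _ (fun x _ => erefl)) (W1p_grad W1) (W0_weak W)).
Qed.

Lemma tgrad_lin (a : R) phi psi x : smooth phi -> smooth psi ->
  tgrad (fun x => a * phi x + psi x) x = a *: tgrad phi x + tgrad psi x.
Proof.
move=> sp sq; have dp := smooth_diff sp; have dq := smooth_diff sq.
have sc := @smooth_cst R N a.
apply/rowP => i; rewrite !mxE partial_add//; last exact: (smooth_diff (smooth_mul sc sp)).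
rewrite (@partial_mul _ _ (fun=> a) phi i x (smooth_diff sc x) (dp x)).
by rewrite partial_cst mulr0 addr0.
Qed.

Lemma W0_lin (a : R) u G v K : W0 u G -> W0 v K ->
  W0 (fun x => a * u x + v x) (fun x => a *: G x + K x).
Proof.
move=> Wu Wv; have [Lu hu] := Wu; have [Lv hv] := Wv.
have L := LpJ_add mO p1 (LpJ_scale mO p1 a Lu) Lv.
split; first exact: L.
move=> e e0.
pose c : R := 4 `^ p * (`|a| `^ p + 1).
have a0 := powR_ge0 `|a| p.
have c0 : 0 < c by rewrite mulr_gt0 ?powR_gt0// ltr_wpDl.
have aux (E1 E2 : R) : E1 < e / c -> E2 < e / c -> 4 `^ p * (`|a| `^ p * E1 + E2) < e.
  move=> h1 h2; apply: (@lt_le_trans _ _ (4 `^ p * (`|a| `^ p * (e / c) + e / c))).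
    by rewrite ltr_pM2l ?powR_gt0// ler_ltD// ler_wpM2l// ltW.
  by rewrite -[X in _ + X]mul1r -mulrDl mulrA -/c mulrCA divff ?mulr1// gt_eqF.
have [phi tp hphi] := hu (e / c) (divr_gt0 e0 c0).
have [psi tq hpsi] := hv (e / c) (divr_gt0 e0 c0).
exists (fun x => a * phi x + psi x).
  by apply: test_add => //; exact: test_scale.
have L1 := LpJ_sub mO p1 Lu (test_LpJ tp); have L2 := LpJ_sub mO p1 Lv (test_LpJ tq).
have := energy_add mO p1 (LpJ_scale mO p1 a L1) L2; rewrite (energy_scale mO a L1) => h.
have -> : EO (fun x => a * u x + v x - (a * phi x + psi x))
    (fun x => a *: G x + K x - tgrad (fun x => a * phi x + psi x) x) =
    EO (fun x => a * (u x - phi x) + (v x - psi x))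
       (fun x => a *: (G x - tgrad phi x) + (K x - tgrad psi x)).
  apply: eq_Rintegral => x _; congr (en p _ _ x); apply/funext => y; first by ring.
  rewrite tgrad_lin; [|exact: (test_smooth tp)|exact: (test_smooth tq)].
  by rewrite scalerBr opprD addrACA.
apply: (le_lt_trans h).
exact: (aux _ _ hphi hpsi).
Qed.

Lemma test_W0 phi : test_function Omega phi -> W0 phi (tgrad phi).
Proof.
move=> tp; split; first exact: test_LpJ.
move=> e e0; exists phi => //.
rewrite (_ : EO _ _ = 0)// /energy (_ : (fun x => _) = cst 0).
  by rewrite /Rintegral integral0.
apply/funext => x; rewrite /en subrr normr0 powR0 ?gt_eqF// ?(lt_trans _ p1)// add0r.
by rewrite big1// => i _; rewrite !mxE subrr normr0 powR0// gt_eqF// (lt_trans _ p1).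
Qed.

Definition test_chain (H Ha Hb : R -> R -> R) := forall phi psi,
  test_function Omega phi -> test_function Omega psi ->
  test_function Omega (fun x => H (phi x) (psi x)) /\
  forall x, tgrad (fun x => H (phi x) (psi x)) x = @cgrad _ T R N.+1 Ha Hb phi (tgrad phi) psi (tgrad psi) x.

(** The chain rule is the classical one on test functions, and H(phi_k, psi_k) is again a test
    function. Along sequences with geometric energies it converges to H(u, v) together with its
    gradient. *)
Lemma W0_chain (C : R) (H Ha Hb : R -> R -> R) u G v K :
  @chain_map _ T R Omega C H Ha Hb -> test_chain H Ha Hb -> W0 u G -> W0 v K ->
  W0 (fun x => H (u x) (v x)) (@cgrad _ T R N.+1 Ha Hb u G v K).
Proof.
move=> cH tH Wu Wv; have [Lu _] := Wu; have [Lv _] := Wv.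
split; first exact: (LpJ_chain mO p1 cH Lu Lv).
move=> e e0; have [phi_ tp Ep] := W0_fast Wu; have [psi_ tq Eq] := W0_fast Wv.
have := chain_cvg mO p1 cH (fun k => test_LpJ (tp k)) (fun k => test_LpJ (tq k)) Lu Lv Ep Eq.
move=> /cvgr0_norm_lt => /(_ e e0) [k _ /(_ k (leqnn k)) hk].
have [tk gk] := tH _ _ (tp k) (tq k).
exists (fun x => H (phi_ k x) (psi_ k x)) => //.
rewrite energy_subC; apply: le_lt_trans hk; apply: le_trans (ler_norm _).
rewrite le_eqVlt; apply/orP; left; apply/eqP; apply: eq_Rintegral => x _.
by congr (en p _ _ x); apply/funext => y; rewrite gk.
Qed.

Lemma W0_sub u G v K : W0 u G -> W0 v K -> W0 (u \- v) (fun x => G x - K x).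
Proof.
move=> Wu Wv; have := W0_lin (-1) Wv Wu.
rewrite (_ : (fun x => -1 * v x + u x) = u \- v); last by apply/funext => x /=; ring.
by rewrite (_ : (fun x => -1 *: K x + G x) = fun x => G x - K x)//;
    apply/funext => x; rewrite scaleN1r addrC.
Qed.

Lemma W0_0 : W0 (fun=> 0) (fun=> 0).
Proof.
have t0 : test_function Omega (fun=> 0).
  have h : [set x : V | (0 : R) != 0] = set0 by apply/seteqP; split => x //=; rewrite eqxx.
  split; first exact: smooth_cst.
    by rewrite h closure0; exact: compact0.
  by rewrite h closure0; exact: sub0set.
have := test_W0 t0; congr W0; apply/funext => x; apply/rowP => i.
by rewrite !mxE partial_cst.
Qed.

Lemma W0_scale (a : R) u G : W0 u G -> W0 (fun x => a * u x) (fun x => a *: G x).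
Proof.
move=> Wu; have := W0_lin a Wu W0_0; congr W0.
  by apply/funext => x; rewrite addr0.
by apply/funext => x; rewrite addr0.
Qed.

Lemma sobolev_norm_scale (a : R) u : W1p0 Omega p u ->
  sobolev_norm Omega p (fun x => a * u x) = `|a| * sobolev_norm Omega p u.
Proof.
move=> /W1p0_W0 Wu; have Wa := W0_scale a Wu.
rewrite (sobolev_normE (W0_Lp Wa) (W0_weak Wa)) (sobolev_normE (W0_Lp Wu) (W0_weak Wu)).
rewrite (enormp_scale mO p1 a Wu.1) powRM ?powR_ge0 ?enormp_ge0//.
by rewrite (powRK p1).
Qed.

Lemma sobolev_norm_le_energy u G : W0 u G ->
  sobolev_norm Omega p u `^ p <= (1 + N.+1%:R `^ p) * EO u G.
Proof.
by move=> W; rewrite (sobolev_norm_powR (W0_Lp W) (W0_weak W)); exact: (enormp_le mO p1 W.1).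
Qed.

Lemma energy_le_sobolev_norm u G : W0 u G -> EO u G <= N.+1%:R * sobolev_norm Omega p u `^ p.
Proof.
by move=> W; rewrite (sobolev_norm_powR (W0_Lp W) (W0_weak W)); exact: (energy_le mO p1 W.1).
Qed.

Lemma energy_grad u G : W0 u G -> EO u (grad Omega p u) = EO u G.
Proof.
move=> W; apply: (ae_eq_energy mO).
- exact: (W1p0_W0 (W0_W1p0 W)).1.
- exact: W.1.
- exact: aeW.
- exact: W0_grad.
Qed.

End sobolev_zero.

(** * Truncations, the p-Laplacian and primitives *)

Section chain_maps.
Context {R : realType}.
Implicit Types g : R -> R.

(** The first factor vanishes where |b s| >= A + 1, the second clips t. It is used with b = 1 to
    build the deformation, and with A = 1 and small b to make u bounded where the approximants are
    nonzero. *)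
Definition cutoff (A b M s t : R) := plateau A (b * s) * clip M t.
Definition cutoff_l (b M : R) (dA : R -> R) (s t : R) := dA (b * s) * b * clip M t.
Definition cutoff_r (A b : R) (dM : R -> R) (s t : R) := plateau A (b * s) * dM t.

(* A smooth substitute for a signed minimum: bounded by both |s| and |t|, with
   partial derivatives bounded uniformly in e, and close to s / 2 when t is close
   to s and e is small. *)
Definition ratio_map (e s t : R) := s * (t * t) * (s * s + t * t + e)^-1.
Definition ratio_l (e s t : R) :=
  t * t * (t * t + e - s * s) * ((s * s + t * t + e)^-1 * (s * s + t * t + e)^-1).
Definition ratio_r (e s t : R) :=
  2 * s * t * (s * s + e) * ((s * s + t * t + e)^-1 * (s * s + t * t + e)^-1).

Lemma cvg_cont_comp g (a_ : nat -> R) (a : R) : continuous g -> a_ k @[k --> \oo] --> a ->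
  g (a_ k) @[k --> \oo] --> g a.
Proof. by move=> cg ca; apply: (cvg_comp _ _ ca); exact: cg. Qed.

Lemma ratio_denom_gt0 (e s t : R) : 0 < e -> 0 < s * s + t * t + e.
Proof. by move=> e0; rewrite ltr_wpDl// addr_ge0// -expr2 sqr_ge0. Qed.

(** Clipping t is what keeps the derivative in s bounded, by C1 |b| (M + 1). *)
Lemma cutoff_chain_map d (T : measurableType d) (D : set T) (N : nat) (A b M : R) dA dM (C1 C2 : R) :
  0 <= M -> @smooth1 R N (plateau A) dA -> @smooth1 R N (clip M) dM ->
  (forall x, `|dA x| <= C1) -> (forall x, `|dM x| <= C2) ->
  exists C, @chain_map _ T R D C (cutoff A b M) (cutoff_l b M dA) (cutoff_r A b dM).
Proof.
move=> M0 sA sM hA hM.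
have cA := smooth1_continuous sA; have cM := smooth1_continuous sM.
have [_ cdA _] := sA; have [_ cdM _] := sM.
have cb (s_ : nat -> R) (s : R) : s_ k @[k --> \oo] --> s -> b * s_ k @[k --> \oo] --> b * s.
  by move=> cs; apply: cvgM => //; exact: cvg_cst.
have mb (u : T -> R) : measurable_fun D u -> measurable_fun D (fun x => b * u x).
  by move=> mu_; apply: measurable_funM => //; exact: measurable_cst.
have mcomp g (u : T -> R) : continuous g -> measurable_fun D u -> measurable_fun D (fun x => g (u x)).
  by move=> cg mu_; apply: (measurableT_comp (continuous_measurable_fun cg)).
have C10 : 0 <= C1 by exact: le_trans (hA 0).
have C20 : 0 <= C2 by exact: le_trans (hM 0).
exists (1 + C1 * `|b| * (M + 1) + C2); split.
- by rewrite !addr_ge0// mulr_ge0// ?mulr_ge0// addr_ge0.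
- split => s_ t_ s t cs ct; rewrite /cutoff /cutoff_l /cutoff_r.
  + apply: cvgM; last exact: cvg_cont_comp ct.
    exact: (cvg_cont_comp cA (cb _ _ cs)).
  + apply: cvgM; last exact: cvg_cont_comp ct.
    apply: cvgM; last exact: cvg_cst.
    exact: (cvg_cont_comp cdA (cb _ _ cs)).
  + apply: cvgM; last exact: cvg_cont_comp ct.
    exact: (cvg_cont_comp cA (cb _ _ cs)).
- split => u v mu_ mv; rewrite /cutoff /cutoff_l /cutoff_r.
  + apply: measurable_funM; last exact: mcomp.
    exact: (mcomp _ _ cA (mb _ mu_)).
  + apply: measurable_funM; last exact: mcomp.
    apply: measurable_funM; last exact: measurable_cst.
    exact: (mcomp _ _ cdA (mb _ mu_)).
  + apply: measurable_funM; last exact: mcomp.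
    exact: (mcomp _ _ cA (mb _ mu_)).
- move=> s t; rewrite /cutoff normrM.
  apply: (@le_trans _ _ (1 * `|t|)).
    by apply: ler_pM => //; [rewrite ger0_norm ?plateau_ge0// plateau_le1|exact: clip_le].
  apply: ler_pM => //; last by rewrite lerDr.
  by rewrite -addrA lerDl addr_ge0// !mulr_ge0// addr_ge0.
- move=> s t; rewrite /cutoff_l normrM [X in X * _]normrM.
  apply: (@le_trans _ _ (C1 * `|b| * (M + 1))).
    apply: ler_pM; [exact: mulr_ge0|exact: normr_ge0| |exact: clip_bounded].
    by rewrite ler_wpM2r.
  lra.
- move=> s t; rewrite /cutoff_r normrM.
  apply: (@le_trans _ _ (1 * C2)).
    by apply: ler_pM => //; rewrite ger0_norm ?plateau_ge0// plateau_le1.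
  have : 0 <= C1 * `|b| * (M + 1) by rewrite !mulr_ge0// addr_ge0.
  lra.
Qed.

Lemma cutoff_test_chain (N : nat) (Omega : set 'rV[R]_N.+1) (A b M : R) dA dM :
  @smooth1 R N (plateau A) dA -> @smooth1 R N (clip M) dM ->
  test_chain Omega (cutoff A b M) (cutoff_l b M dA) (cutoff_r A b dM).
Proof.
move=> sA sM phi psi tp tq.
have sp := test_smooth tp; have sq := test_smooth tq.
have sbp : smooth (fun x => b * phi x) by apply: smooth_mul => //; exact: smooth_cst.
have [dA1 _ sA1] := sA; have [dM1 _ sM1] := sM.
have s1 := sA1 _ sbp; have s2 := sM1 _ sq.
split.
  apply: (test_function_support tp tq); first exact: smooth_mul s1 s2.
  by move=> x _ q0; rewrite /cutoff q0 /clip mul0r mulr0.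
move=> x; apply/rowP => i; rewrite !mxE.
rewrite /cutoff (partial_mul i (smooth_diff s1 x) (smooth_diff s2 x)).
have [da ea] := dA1 (b * phi x); have [dm em] := dM1 (psi x).
rewrite (@partial_comp _ _ (plateau A) (fun x => b * phi x) i x (smooth_diff sbp x) da) ea.
rewrite (@partial_comp _ _ (clip M) psi i x (smooth_diff sq x) dm) em.
rewrite (@partial_mul _ _ (fun=> b) phi i x (smooth_diff (@smooth_cst R N b) x) (smooth_diff sp x)).
rewrite partial_cst /cutoff_l /cutoff_r; ring.
Qed.

Lemma ratio_le_l (e s t : R) : 0 < e -> `|ratio_map e s t| <= `|s|.
Proof.
move=> e0; have q0 := ratio_denom_gt0 s t e0; have t0 : 0 <= t * t by rewrite -expr2 sqr_ge0.
have s0 : 0 <= s * s by rewrite -expr2 sqr_ge0.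
rewrite /ratio_map -mulrA normrM ler_piMr//.
rewrite ger0_norm; last by rewrite mulr_ge0// invr_ge0 ltW.
by rewrite ler_pdivrMr// mul1r; lra.
Qed.

Lemma ratio_le_r (e s t : R) : 0 < e -> `|ratio_map e s t| <= `|t|.
Proof.
move=> e0; have q0 := ratio_denom_gt0 s t e0.
have -> : ratio_map e s t = t * ((s * t) / (s * s + t * t + e)) by rewrite /ratio_map; ring.
rewrite normrM ler_piMr// normrM normfV (gtr0_norm q0) ler_pdivrMr// mul1r.
have h1 : 0 <= (s - t) * (s - t) by rewrite -expr2 sqr_ge0.
have h2 : 0 <= (s + t) * (s + t) by rewrite -expr2 sqr_ge0.
have h3 : 0 <= s * s by rewrite -expr2 sqr_ge0.
have h4 : 0 <= t * t by rewrite -expr2 sqr_ge0.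
rewrite ler_norml; apply/andP; split; nra.
Qed.

(** The squared denominator is shared between two quotients, each of modulus at most 1; the bound
    does not depend on e. *)
Lemma ratio_l_bound (e s t : R) : 0 < e -> `|ratio_l e s t| <= 1.
Proof.
move=> e0; have q0 := ratio_denom_gt0 s t e0.
have h3 : 0 <= s * s by rewrite -expr2 sqr_ge0.
have h4 : 0 <= t * t by rewrite -expr2 sqr_ge0.
rewrite /ratio_l; set Q := s * s + t * t + e.
have -> : t * t * (t * t + e - s * s) * (Q^-1 * Q^-1) =
  (t * t / Q) * ((t * t + e - s * s) / Q) by ring.
rewrite normrM mulr_ile1// normrM normfV (gtr0_norm q0) ler_pdivrMr// mul1r ler_norml;
  rewrite /Q; apply/andP; split; lra.
Qed.

Lemma ratio_r_bound (e s t : R) : 0 < e -> `|ratio_r e s t| <= 1.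
Proof.
move=> e0; have q0 := ratio_denom_gt0 s t e0.
have h1 : 0 <= (s - t) * (s - t) by rewrite -expr2 sqr_ge0.
have h2 : 0 <= (s + t) * (s + t) by rewrite -expr2 sqr_ge0.
have h3 : 0 <= s * s by rewrite -expr2 sqr_ge0.
have h4 : 0 <= t * t by rewrite -expr2 sqr_ge0.
rewrite /ratio_r; set Q := s * s + t * t + e.
have -> : 2 * s * t * (s * s + e) * (Q^-1 * Q^-1) =
  ((2 * s * t) / Q) * ((s * s + e) / Q) by ring.
rewrite normrM mulr_ile1// normrM normfV (gtr0_norm q0) ler_pdivrMr// mul1r ler_norml;
  rewrite /Q; apply/andP; split; lra.
Qed.

Lemma ratio_chain_map d (T : measurableType d) (D : set T) (e : R) : 0 < e ->
  @chain_map _ T R D 1 (ratio_map e) (ratio_l e) (ratio_r e).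
Proof.
move=> e0.
have cq (s_ t_ : nat -> R) (s t : R) : s_ k @[k --> \oo] --> s -> t_ k @[k --> \oo] --> t ->
    (s_ k * s_ k + t_ k * t_ k + e)^-1 @[k --> \oo] --> (s * s + t * t + e)^-1.
  move=> cs ct; apply: cvgV; first by rewrite gt_eqF// ratio_denom_gt0.
  by apply: cvgD; [apply: cvgD; exact: cvgM|exact: cvg_cst].
have mq (u v : T -> R) : measurable_fun D u -> measurable_fun D v ->
    measurable_fun D (fun x => (u x * u x + v x * v x + e)^-1).
  move=> mu_ mv.
  rewrite (_ : (fun x => _) = fun x => (u x * u x + v x * v x + e) `^ (-1)); last first.
    by apply/funext => x; rewrite powR_inv1// ltW// ratio_denom_gt0.
  apply: (measurableT_comp (measurable_powR (-1))).
  by apply: measurable_funD; [apply: measurable_funD; exact: measurable_funM|exact: measurable_cst].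
split => //.
- split => s_ t_ s t cs ct; rewrite /ratio_map /ratio_l /ratio_r.
  + by apply: cvgM; [apply: cvgM => //; exact: cvgM|exact: cq].
  + apply: cvgM; last by apply: cvgM; exact: cq.
    apply: cvgM; first exact: cvgM.
    by apply: cvgB; [apply: cvgD; [exact: cvgM|exact: cvg_cst]|exact: cvgM].
  + apply: cvgM; last by apply: cvgM; exact: cq.
    apply: cvgM.
      by apply: cvgM => //; apply: cvgM => //; exact: cvg_cst.
    by apply: cvgD; [exact: cvgM|exact: cvg_cst].
- split => u v mu_ mv; rewrite /ratio_map /ratio_l /ratio_r.
  + by apply: measurable_funM; [apply: measurable_funM => //; exact: measurable_funM|exact: mq].
  + apply: measurable_funM; last by apply: measurable_funM; exact: mq.
    apply: measurable_funM; first exact: measurable_funM.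
    by apply: measurable_funB; [apply: measurable_funD; [exact: measurable_funM|exact: measurable_cst]|exact: measurable_funM].
  + apply: measurable_funM; last by apply: measurable_funM; exact: mq.
    apply: measurable_funM.
      by apply: measurable_funM => //; apply: measurable_funM => //; exact: measurable_cst.
    by apply: measurable_funD; [exact: measurable_funM|exact: measurable_cst].
- by move=> s t; rewrite mul1r (le_trans (ratio_le_l s t e0))// lerDl.
- by move=> s t; exact: ratio_l_bound.
- by move=> s t; exact: ratio_r_bound.
Qed.

Lemma ratio_test_chain (N : nat) (Omega : set 'rV[R]_N.+1) (e : R) : 0 < e ->
  test_chain Omega (ratio_map e) (ratio_l e) (ratio_r e).
Proof.
move=> e0 phi psi tp tq.
have sp := test_smooth tp; have sq := test_smooth tq.
have sn : smooth (fun x => phi x * (psi x * psi x)) by apply: smooth_mul => //; exact: smooth_mul.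
have spp := smooth_mul sp sp; have sqq := smooth_mul sq sq.
have ss := smooth_add spp sqq.
have sQ := smooth_add ss (@smooth_cst R N e).
have Q0 x : phi x * phi x + psi x * psi x + e != 0 by rewrite gt_eqF// ratio_denom_gt0.
have sV := smooth_inv Q0 sQ.
split.
  apply: (test_function_support tp tq); first exact: smooth_mul sn sV.
  by move=> x p0 _; rewrite /ratio_map p0 !mul0r.
move=> x; apply/rowP => i; rewrite !mxE.
rewrite /ratio_map (partial_mul i (smooth_diff sn x) (smooth_diff sV x)).
rewrite (partial_inv i (smooth_diff sQ x) (Q0 x)).
rewrite (partial_add i (smooth_diff ss x) (smooth_diff (@smooth_cst R N e) x)).
rewrite (partial_add i (smooth_diff spp x) (smooth_diff sqq x)).
rewrite (partial_mul i (smooth_diff sp x) (smooth_diff sqq x)).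
rewrite (partial_mul i (smooth_diff sp x) (smooth_diff sp x)).
rewrite (partial_mul i (smooth_diff sq x) (smooth_diff sq x)).
rewrite partial_cst /ratio_l /ratio_r.
by field; exact: Q0.
Qed.

End chain_maps.

(** * The integrand of the p-Laplacian *)

Section p_laplace.
Context {R : realType} {N : nat}.
Variable p : R.
Hypothesis p1 : 1 < p.
Local Notation V := 'rV[R]_N.+1.
Implicit Types a b c : V.

Let p0 : 0 < p. Proof. exact: lt_trans p1. Qed.
Let q0 : 0 < p - 1. Proof. by rewrite subr_gt0. Qed.

Definition plap a b : R := enorm a `^ (p - 2) * edot a b.

Lemma plap_lin (s : R) a b c : plap a (s *: b + c) = s * plap a b + plap a c.
Proof. by rewrite /plap edotDr edotZr; ring. Qed.

Lemma powR_B2 (x : R) : 0 <= x -> x `^ (p - 2) * x = x `^ (p - 1).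
Proof.
move=> x0; have [->|xn0] := eqVneq x 0.
  by rewrite mulr0 powR0// gt_eqF.
have -> : p - 1 = (p - 2) + 1 by ring.
by rewrite [RHS]powRD ?powRr1//; apply/implyP.
Qed.

Lemma plap_le1 a b : `|plap a b| <= enorm a `^ (p - 1) * enorm b.
Proof.
rewrite normrM ger0_norm ?powR_ge0// -powR_B2 ?enorm_ge0// -mulrA.
by rewrite ler_wpM2l ?powR_ge0// cauchy_schwarz.
Qed.

Lemma plap_le a b : `|plap a b| <= enorm a `^ p + enorm b `^ p.
Proof. by apply: (le_trans (plap_le1 a b)); apply: powR_mulB1; rewrite ?enorm_ge0. Qed.

Lemma plap_diag a : plap a a = enorm a `^ p.
Proof.
rewrite /plap -sqr_enorm expr2 mulrA powR_B2 ?enorm_ge0// mulrC mulr_powRB1 ?enorm_ge0//.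
Qed.

(** The subgradient inequality at c for the convex function |.|^p / p. By [plap_diag] it reduces to
    Young's inequality for |c|^(p-1) |a| with exponents p / (p - 1) and p. *)
Lemma plap_convex a c : p^-1 * enorm c `^ p - p^-1 * enorm a `^ p <= plap c (c - a).
Proof.
have -> : plap c (c - a) = enorm c `^ p - plap c a.
  by rewrite -plap_diag -[c - a]addrC -scaleN1r plap_lin mulN1r addrC.
have pn0 : p != 0 by rewrite gt_eqF.
have qn0 : p - 1 != 0 by rewrite gt_eqF.
have young : plap c a <= enorm a `^ p / p + (enorm c `^ (p - 1)) `^ (p / (p - 1)) / (p / (p - 1)).
  apply: (le_trans (ler_norm _)); apply: (le_trans (plap_le1 c a)); rewrite mulrC.
  apply: conjugate_powR => //; rewrite ?enorm_ge0 ?powR_ge0//.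
  - by rewrite divr_gt0.
  - by field; rewrite pn0 qn0.
move: young; rewrite -powRrM.
have -> : (p - 1) * (p / (p - 1)) = p by field.
set A := enorm a `^ p; set B := enorm c `^ p => young.
have e : B / (p / (p - 1)) = B - p^-1 * B by field; rewrite pn0 qn0.
rewrite e in young; rewrite -[A / p]mulrC in young.
lra.
Qed.

Lemma cvg_powR_gt0 (r : R) (a_ : nat -> R) : 0 < r -> (forall k, 0 <= a_ k) ->
  a_ k @[k --> \oo] --> 0 -> a_ k `^ r @[k --> \oo] --> 0.
Proof.
move=> r0 a0 /cvgrPdist_lt ca; apply/cvgrPdist_lt => e e0.
have e1 : 0 < e `^ r^-1 by exact: powR_gt0.
apply: filterS (ca _ e1) => n; rewrite !sub0r !normrN => h.
rewrite ger0_norm ?powR_ge0//.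
have -> : e = (e `^ r^-1) `^ r by rewrite -powRrM mulVf ?gt_eqF// powRr1// ltW.
rewrite ger0_norm// in h.
by apply: gt0_ltr_powR; rewrite ?nnegrE// ltW.
Qed.

Lemma cvg_enorm (a_ : nat -> V) a : (forall i, a_ k ord0 i @[k --> \oo] --> a ord0 i) ->
  enorm (a_ k) @[k --> \oo] --> enorm a.
Proof.
move=> ca; apply: (@cvg_cont_comp R Num.sqrt); first exact: sqrt_continuous.
by apply: cvg_sum_fin => i; apply: cvgM.
Qed.

(** The power p - 2 may be discontinuous at 0 only; there the bound |a|^(p-1) |b|, whose exponent p
    - 1 is positive, takes over. *)
Lemma cvg_plap (a_ b_ : nat -> V) a b : (forall i, a_ k ord0 i @[k --> \oo] --> a ord0 i) ->
  (forall i, b_ k ord0 i @[k --> \oo] --> b ord0 i) ->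
  plap (a_ k) (b_ k) @[k --> \oo] --> plap a b.
Proof.
move=> ca cb; have cna := cvg_enorm ca; have cnb := cvg_enorm cb.
have ce : edot (a_ k) (b_ k) @[k --> \oo] --> edot a b.
  by apply: cvg_sum_fin => i; apply: cvgM.
have [a0|a0] := eqVneq (enorm a) 0.
  have -> : plap a b = 0.
    by apply/eqP; rewrite -normr_le0 (le_trans (plap_le1 a b))// a0 powR0 ?gt_eqF// mul0r.
  apply: norm_cvg0; apply: (squeeze_cvgr _ (cvg_cst 0)).
    by apply: nearW => k; rewrite normr_ge0 /=; exact: plap_le1.
  rewrite -[X in _ --> X](mul0r (enorm b)); apply: cvgM => //.
  apply: cvg_powR_gt0 => //; first by move=> k; exact: enorm_ge0.
  by rewrite -a0.
apply: cvgM => //.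
have ap : 0 < enorm a by rewrite lt0r a0 enorm_ge0.
have dp : derivable (fun x : R => x `^ (p - 2)) (enorm a) 1.
  by apply: derivable_powR; rewrite in_itv /= ap.
have cp : {for enorm a, continuous (fun x : R => x `^ (p - 2))}.
  exact/differentiable_continuous/derivable1_diffP.
exact: (cvg_comp _ _ cna cp).
Qed.

Section plap_integral.
Context {d : measure_display} {T : measurableType d}.
Variables (mu : {measure set T -> \bar R}) (D : set T).
Hypothesis mD : measurable D.
Implicit Types (u v : T -> R) (G K : T -> V).

Lemma measurable_plap G K : (forall i, measurable_fun D (fun x => G x ord0 i)) ->
  (forall i, measurable_fun D (fun x => K x ord0 i)) ->
  measurable_fun D (fun x => plap (G x) (K x)).
Proof.
move=> mG mK; apply: measurable_funM; last exact: measurable_edot.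
by apply: (measurableT_comp (measurable_powR (p - 2))); exact: measurable_enorm.
Qed.

Lemma Ig_plap G K : (forall i, Lp mu D p (fun x => G x ord0 i)) ->
  (forall i, Lp mu D p (fun x => K x ord0 i)) ->
  mu.-integrable D (EFin \o (fun x => plap (G x) (K x))).
Proof.
move=> LG LK; apply: (Ig_le mD _ _ (Ig_add mD (Ig_enp mD p1 LG) (Ig_enp mD p1 LK))).
  by apply: measurable_plap => i; [case: (LG i)|case: (LK i)].
by move=> x _; exact: plap_le.
Qed.

Lemma plap_cvg (u_ : nat -> T -> R) (G_ : nat -> T -> V) (v_ : nat -> T -> R)
    (K_ : nat -> T -> V) u G v K :
  (forall k, LpJ mu D p (u_ k) (G_ k)) -> (forall k, LpJ mu D p (v_ k) (K_ k)) ->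
  LpJ mu D p u G -> LpJ mu D p v K ->
  (forall k, energy mu D p (fun x => u_ k x - u x) (fun x => G_ k x - G x) <= 2^-1 ^+ k) ->
  (forall k, energy mu D p (fun x => v_ k x - v x) (fun x => K_ k x - K x) <= 2^-1 ^+ k) ->
  \int[mu]_(x in D) plap (G_ k x) (K_ k x) @[k --> \oo] --> \int[mu]_(x in D) plap (G x) (K x).
Proof.
move=> Lu_ Lv_ Lu Lv Eu Ev.
have [S [IS Sd _ cG]] := fast_cvg mD p1 (fun k => LpJ_sub mD p1 (Lu_ k) Lu) Eu.
have [S' [IS' Sd' _ cK]] := fast_cvg mD p1 (fun k => LpJ_sub mD p1 (Lv_ k) Lv) Ev.
pose c : R := N.+1%:R `^ p * 4 `^ p.
have c0 : 0 <= c by rewrite mulr_ge0// powR_ge0.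
pose M x : \bar R := (c%:E * (S x + (en p u G x)%:E + S' x + (en p v K x)%:E))%E.
have IM : mu.-integrable D M.
  apply: integrableZl => //; have Iu := Ig_en mD Lu; have Iv := Ig_en mD Lv.
  exact: (integrableD mD (integrableD mD (integrableD mD IS Iu) IS') Iv).
have bnd (w : T -> R) (A : T -> V) (w' : T -> R) (A' : T -> V) x : enorm (A x) `^ p <=
    c * (en p (fun y => w y - w' y) (fun y => A y - A' y) x + en p w' A' x).
  apply: (le_trans (enp_le p1 A x)); rewrite /c -mulrA ler_wpM2l ?powR_ge0//.
  apply: (@le_trans _ _ (en p (fun y => (w y - w' y) + w' y) (fun y => (A y - A' y) + A' y) x)).
    rewrite /en; apply: ler_wpDl; first exact: powR_ge0.
    by apply: ler_sum => i _; rewrite subrK.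
  exact: en_add_le.
have [] // := @Rintegral_cvg_dominated _ T R mu D mD (fun k x => plap (G_ k x) (K_ k x))
  (fun x => plap (G x) (K x)) M.
- move=> k; exact: Ig_measurable (Ig_plap (Lu_ k).2 (Lv_ k).2).
- exact: Ig_measurable (Ig_plap Lu.2 Lv.2).
- apply: filterS2 cG cK => x hG hK Dx; apply: cvg_plap => i; apply/subr_cvg0.
    by have := hG Dx i; under eq_fun do rewrite !mxE.
  by have := hK Dx i; under eq_fun do rewrite !mxE.
- apply: aeW => x Dx k; have Sx := Sd k x; have Sx' := Sd' k x.
  apply: (@le_trans _ _ ((c * (en p (fun x => u_ k x - u x) (fun x => G_ k x - G x) x + en p u G x
    + en p (fun x => v_ k x - v x) (fun x => K_ k x - K x) x + en p v K x))%:E)); last first.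
    by rewrite EFinM !EFinD lee_wpmul2l ?lee_fin// !leeD.
  rewrite lee_fin; apply: (le_trans (plap_le _ _)).
  have := bnd (u_ k) (G_ k) u G x; have := bnd (v_ k) (K_ k) v K x; lra.
Qed.

End plap_integral.
End p_laplace.

(** The condition k <= n_k preserves geometric bounds already satisfied by the original sequence. *)
Lemma fast_subsequence (R : realType) (E_ : nat -> R) : E_ k @[k --> \oo] --> 0 ->
  exists n_ : nat -> nat, forall k, (k <= n_ k)%N /\ E_ (n_ k) <= 2^-1 ^+ k.
Proof.
move=> /cvgrPdist_le cE; suff /choice[n_ h] : forall k, exists n, (k <= n)%N /\ E_ n <= 2^-1 ^+ k by exists n_.
move=> k.
have e0 : 0 < 2^-1 ^+ k :> R by rewrite exprn_gt0// invr_gt0.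
have [m _ hm] := cE _ e0; exists (maxn k m); split; first exact: leq_maxl.
have := hm (maxn k m) (leq_maxr k m); rewrite /= sub0r normrN; apply: le_trans.
exact: ler_norm.
Qed.

(** * Primitives of continuous functions *)

Section real_primitive.
Context {R : realType}.
Local Notation lam := (@lebesgue_measure R).
Implicit Type g : R -> R.

(** [prim (f x)] unfolds to the same expression as [primitive f x], with no measurable space of
    points x involved. *)
Definition prim g (s : R) : R :=
  if 0 <= s then \int[lam]_(t in `[0, s]) g t else - \int[lam]_(t in `[s, 0]) g t.

Lemma continuous_itv_integrable g (a b : R) : continuous g ->
  lam.-integrable `[a, b] (EFin \o g).
Proof.
move=> cg; apply: continuous_compact_integrable; first exact: segment_compact.
exact: continuous_subspaceT.
Qed.

Lemma Rintegral_itv_split g (a b c : R) : continuous g -> a <= b -> b <= c ->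
  \int[lam]_(t in `[a, c]) g t = \int[lam]_(t in `[a, b]) g t + \int[lam]_(t in `[b, c]) g t.
Proof.
move=> cg ab bc.
have h : \int[lam]_(t in `[a, c]) g t - \int[lam]_(t in `[a, b]) g t =
    \int[lam]_(x in `]b, c]) g x.
  by apply: Rintegral_itvB; rewrite ?bnd_simp//; exact: continuous_itv_integrable.
rewrite -[X in _ = _ + X](Rintegral_itv_obnd_cbnd (b := BRight c)); last first.
  apply: integrableS (continuous_itv_integrable b c cg) => //.
  by apply: subset_itvr; rewrite bnd_simp.
by rewrite -h addrC subrK.
Qed.

(** A base point a to the left of both 0 and s removes the case distinction on the sign of s, and
    lets the fundamental theorem of calculus be applied at an interior point. *)
Lemma prim_shift g (a s : R) : continuous g -> a <= 0 -> a <= s ->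
  prim g s = \int[lam]_(t in `[a, s]) g t - \int[lam]_(t in `[a, 0]) g t.
Proof.
move=> cg a0 as_; rewrite /prim; case: ifPn => [s0|]; last rewrite -ltNge => s0.
  by rewrite (Rintegral_itv_split cg a0 s0) addrC addKr.
by rewrite (@Rintegral_itv_split g a s 0 cg as_ (ltW s0)) opprD addNKr.
Qed.

Lemma is_derive_prim g (s : R) : continuous g -> is_derive s (1 : R) (prim g) (g s).
Proof.
move=> cg; pose a := Num.min 0 s - 1.
have a0 : a < 0 by rewrite /a; case: (leP 0 s) => ?; lra.
have as_ : a < s by rewrite /a; case: (leP 0 s) => ?; lra.
have s1 : s < s + 1 by rewrite ltrDl.
pose F (x : R) : R := \int[lam]_(t in `[a, x]) g t.
pose c : R := \int[lam]_(t in `[a, 0]) g t.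
have dF : is_derive s (1 : R) F (g s).
  have [d1 d2] := @continuous_FTC1_closed R g a s (s + 1) s1
    (continuous_itv_integrable a (s + 1) cg) as_ (cg s).
  by rewrite derive1E in d2; exact: (DeriveDef d1 d2).
have dFc : is_derive s (1 : R) (F - cst c) (g s - 0) by exact: is_deriveB.
rewrite subr0 in dFc; apply: near_eq_is_derive dFc.
near=> x; rewrite (prim_shift cg (ltW a0) (_ : a <= x))//.
by apply: ltW; near: x; exact: lt_nbhsr.
Unshelve. all: by end_near. Qed.

(** The position of c is recorded as a distance to a, the form in which f is dominated along the
    segment. *)
Lemma prim_mvt g (a b : R) : continuous g ->
  exists c : R, `|c - a| <= `|b - a| /\ prim g b - prim g a = g c * (b - a).
Proof.
move=> cg; have cp : continuous (prim g).
  by move=> x; exact: is_derive_continuous (is_derive_prim x cg).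
have dp x : is_derive x (1 : R) (prim g) (g x) by exact: is_derive_prim.
case: (leP a b) => [ab|/ltW ba].
  have [c] := MVT_segment ab (fun x _ => dp x) (continuous_subspaceT cp).
  rewrite in_itv /= => /andP[h1 h2] e; exists c; split => //.
  by rewrite !ger0_norm ?subr_ge0// lerD2r.
have [c] := MVT_segment ba (fun x _ => dp x) (continuous_subspaceT cp).
rewrite in_itv /= => /andP[h1 h2] e; exists c; split.
  by rewrite !ler0_norm ?subr_le0// !opprB lerD2l lerN2.
by rewrite -opprB e -mulrN opprB.
Qed.

End real_primitive.

(** * Measurability of superpositions and of their primitives *)

Section caratheodory_functions.
Context {d : measure_display} {T : measurableType d} {R : realType}.
Variables (mu : {measure set T -> \bar R}) (D : set T) (f : T -> R -> R).
Hypothesis mD : measurable D.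
Hypothesis mu_complete : measure_is_complete mu.
Hypothesis mf : forall s, measurable_fun D (f ^~ s).
Hypothesis cf : {ae mu, forall x, D x -> continuous (f x)}.
Local Notation lam := (@lebesgue_measure R).

(** Preimages under h and g differ inside a null set, all of whose subsets are measurable by
    completeness. *)
Lemma ae_measurable_fun (g h : T -> R) : measurable_fun D g ->
  {ae mu, forall x, D x -> h x = g x} -> measurable_fun D h.
Proof.
move=> mg [A [mA A0 hA]] _ B mB.
have -> : D `&` h @^-1` B = ((D `&` g @^-1` B) `\` A) `|` ((D `&` h @^-1` B) `&` A).
  apply/seteqP; split => [x [Dx Bx]|x].
    have [Ax|Ax] := pselect (A x); first by right.
    left; split => //; split => //=.
    have <- // : h x = g x.
    by apply: contra_notP Ax => n; apply: hA => /= /(_ Dx).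
  move=> [[[Dx Bx] Ax]|[]//]; split => //=.
  have -> // : h x = g x.
  by apply: contra_notP Ax => n; apply: hA => /= /(_ Dx).
apply: measurableU; first by apply: measurableD => //; exact: mg.
by apply: mu_complete; exists A; split => // x [].
Qed.

Lemma measurable_restrictT (u : T -> R) : measurable_fun D u ->
  measurable_fun setT (fun x => u x * \1_D x).
Proof.
move=> mu_; rewrite (_ : (fun x => _) = u \_ D); last first.
  by apply/funext => x; rewrite patchE indicE; case: (x \in D); rewrite ?mulr1 ?mulr0.
by apply/measurable_restrict => //; rewrite setTI.
Qed.

Definition floor_approx (n : nat) (t : R) : R := (Num.floor (n.+1%:R * t))%:~R / n.+1%:R.

Lemma floor_approx_cvg (t : R) : floor_approx n t @[n --> \oo] --> t.
Proof.
have h n : t - n.+1%:R^-1 <= floor_approx n t <= t.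
  have n0 : 0 < n.+1%:R :> R by [].
  rewrite /floor_approx ler_pdivlMr// ler_pdivrMr// mulrBl mulVf ?gt_eqF// mulrC.
  have := floor_le_tmp (n.+1%:R * t); have := ltW (floorD1_gt (n.+1%:R * t)).
  by rewrite intrD => h1 h2; rewrite h2 andbT lerBlDr.
have c1 : t - n.+1%:R^-1 @[n --> \oo] --> t.
  by rewrite -[X in _ --> X]subr0; apply: cvgB; [exact: cvg_cst|exact: cvg_harmonic].
by apply: (squeeze_cvgr _ c1 (cvg_cst t)); apply: nearW => n; exact: h.
Qed.

(** Continuity in s holds for almost every x only. Removing a measurable null set gives it at every
    remaining point; f is then multiplied by the indicator of [Good]. *)
Lemma good_set : exists2 Good : set T, measurable Good /\ Good `<=` D &
  (forall x, Good x -> continuous (f x)) /\ {ae mu, forall x, D x -> Good x}.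
Proof.
case: cf => A [mA A0 hA]; exists (D `\` A); first by split; [exact: measurableD|move=> x []].
split => [x [Dx Ax]|].
  by apply: contra_notP Ax => n; apply: hA => /= /(_ Dx).
exists A; split => // x /=; apply: contra_notP => Ax; by split.
Qed.

(** Freezing s at the multiples of 1 / (n + 1) gives countably many measurable pieces; continuity in
    s makes these functions converge to f. *)
Lemma joint_measurable (Good : set T) : measurable Good -> Good `<=` D ->
  (forall x, Good x -> continuous (f x)) ->
  measurable_fun setT (fun z : T * R => f z.1 z.2 * \1_Good z.1).
Proof.
move=> mG GD cG.
have mfG s : measurable_fun setT (fun x => f x s * \1_Good x).
  rewrite (_ : (fun x => _) = (f ^~ s) \_ Good); last first.
    apply/funext => x; rewrite patchE indicE; case: (x \in Good); by rewrite ?mulr1 ?mulr0.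
  by apply/measurable_restrict => //; rewrite setTI; exact: measurable_funS (mf s).
pose h n (z : T * R) : R := f z.1 (floor_approx n z.2) * \1_Good z.1.
apply: (@measurable_fun_cvg _ _ R setT h).
  move=> n _ B mB; rewrite setTI.
  have -> : h n @^-1` B = \bigcup_(k : int)
     ([set x | B (f x (k%:~R / n.+1%:R) * \1_Good x)] `*`
      [set t | Num.floor (n.+1%:R * t) = k]).
    apply/seteqP; split => [[x t] /= Bx|[x t] [k _ [/= Bx tk]]].
      by exists (Num.floor (n.+1%:R * t)).
    by rewrite /h /floor_approx /= tk.
  apply: countable_bigcupT_measurable; first exact: countableP.
  move=> k; apply: measurableX.
    by rewrite -[X in measurable X]setTI; exact: mfG.
  have n0 : 0 < n.+1%:R :> R by [].
  rewrite (_ : [set _ | _] = `[k%:~R / n.+1%:R, (k + 1)%:~R / n.+1%:R[%classic)//.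
  apply/seteqP; split => t /=; rewrite in_itv /= ler_pdivrMr// ltr_pdivlMr// mulrC.
    by move=> <-; rewrite floor_le_tmp floorD1_gt.
  by move=> /andP[h1 h2]; apply: floor_def; rewrite h1.
move=> [x t] _ /=; rewrite /h /= indicE; have [Gx|Gx] := boolP (x \in Good).
  rewrite mulr1; under eq_fun do rewrite mulr1.
  apply: (@cvg_cont_comp R (f x)); last exact: floor_approx_cvg.
  by apply: cG; rewrite inE in Gx.
by rewrite mulr0; under eq_fun do rewrite mulr0; exact: cvg_cst.
Qed.

Lemma measurable_caratheodory (u : T -> R) : measurable_fun D u ->
  measurable_fun D (fun x => f x (u x)).
Proof.
move=> mu_; have [G [mG GD] [cG aeG]] := good_set.
have mj := joint_measurable mG GD cG.
have mp : measurable_fun setT (fun x : T => (x, u x * \1_D x)).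
  by apply: measurable_fun_pair; [exact: measurable_id|exact: measurable_restrictT].
have /measurable_funTS mc := measurableT_comp mj mp.
apply: (ae_measurable_fun (mc D)).
apply: filterS aeG => x + Dx => /(_ Dx) Gx /=.
by rewrite !indicE !mem_set// !mulr1.
Qed.

(** The region between the graphs of a and b is measurable in the product; the positive and negative
    parts of F are restricted to it and integrated by Tonelli's theorem. *)
Lemma measurable_integral_between (F : T * R -> R) (a b : T -> R) :
  measurable_fun setT F -> measurable_fun setT a -> measurable_fun setT b ->
  measurable_fun setT (fun x => \int[lam]_(t in `[a x, b x]) F (x, t)).
Proof.
move=> mF ma mb.
pose E : set (T * R) := [set z | a z.1 <= z.2 <= b z.1].
have mE : measurable E.
  have -> : E = ((fun z : T * R => z.2 - a z.1) @^-1` `[0, +oo[%classic) `&`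
                ((fun z : T * R => b z.1 - z.2) @^-1` `[0, +oo[%classic).
    by apply/seteqP; split => z /=; rewrite !in_itv /= !andbT !subr_ge0 => /andP.
  apply: measurableI; rewrite -[X in measurable X]setTI.
    by apply: measurable_funB => //; exact: (measurableT_comp ma).
  by apply: measurable_funB => //; exact: (measurableT_comp mb).
have mFE : measurable_fun setT (EFin \o F) by exact/measurable_EFinP.
have mres (h : T * R -> \bar R) : measurable_fun setT h -> (forall z, (0 <= h z)%E) ->
    measurable_fun setT (fun x => \int[lam]_(t in `[a x, b x]) h (x, t))%E.
  move=> mh h0.
  have mhE : measurable_fun setT (h \_ E).
    by apply/measurable_restrict => //; rewrite setTI; exact: measurable_funTS.
  have hE0 z : (0 <= (h \_ E) z)%E by rewrite patchE; case: ifP.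
  have := @measurable_fun_fubini_tonelli_F _ _ T _ R lam (h \_ E) mhE hE0.
  congr measurable_fun; apply/funext => x; rewrite /fubini_F [RHS]integral_mkcond.
  apply: eq_integral => t _; rewrite !patchE; congr (if _ then _ else _).
rewrite /Rintegral; apply: measurableT_comp => //.
rewrite (_ : (fun x => _) = fun x => (\int[lam]_(t in `[a x, b x]) ((EFin \o F)^\+ (x, t))
   - \int[lam]_(t in `[a x, b x]) ((EFin \o F)^\- (x, t)))%E).
  apply: emeasurable_funB; apply: mres => //.
  - exact: measurable_funepos.
  - exact: measurable_funeneg.
apply/funext => x; rewrite [LHS]integralE.
by congr (_ - _)%E; apply: eq_integral => t _; rewrite ?funeposE ?funenegE.
Qed.

Lemma measurable_prim (u : T -> R) : measurable_fun D u ->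
  measurable_fun D (fun x => prim (f x) (u x)).
Proof.
move=> mu_; have [G [mG GD] [cG aeG]] := good_set.
have mj := joint_measurable mG GD cG.
pose w x := u x * \1_D x.
have mw : measurable_fun setT w by exact: measurable_restrictT.
have m0 : measurable_fun setT (fun _ : T => 0 : R) by exact: measurable_cst.
pose P x := if 0 <= w x then \int[lam]_(t in `[0, w x]) (f x t * \1_G x)
  else - \int[lam]_(t in `[w x, 0]) (f x t * \1_G x).
have mP : measurable_fun setT P.
  apply: measurable_fun_ifT.
  - exact: measurable_fun_ler.
  - exact: (measurable_integral_between mj m0 mw).
  - apply: measurableT_comp => //.
    exact: (measurable_integral_between mj mw m0).
apply: (@ae_measurable_fun P); first exact: measurable_funTS.
apply: filterS aeG => x + Dx => /(_ Dx) Gx.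
rewrite /P /w /prim indicE mem_set// mulr1.
by case: ifP => _; [|congr (- _)]; apply: eq_Rintegral => t _; rewrite indicE mem_set// mulr1.
Qed.

End caratheodory_functions.

(** * Critical points are weak solutions *)

(** The case of interest is a not integrable. As its integral is not -oo, the negative part is
    integrable and the positive part has integral +oo; both facts persist after adding b, so the two
    sides are +oo. *)
Lemma integral_add_Ig d (T : measurableType d) (R : realType) (mu : {measure set T -> \bar R})
    (D : set T) (a b : T -> R) : measurable D -> measurable_fun D a ->
  mu.-integrable D (EFin \o b) -> (\int[mu]_(x in D) (a x)%:E)%E != -oo%E ->
  (\int[mu]_(x in D) (a x + b x)%:E =
   \int[mu]_(x in D) (a x)%:E + (\int[mu]_(x in D) b x)%:E)%E.
Proof.
move=> mD ma Ib aNy.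
have [Ia|nIa] := pselect (mu.-integrable D (EFin \o a)).
  rewrite (RintegralE_Ig mD Ib) -integralD//.
have mab : measurable_fun D (fun x => a x + b x).
  by apply: measurable_funD => //; exact: Ig_measurable Ib.
have mpa : measurable_fun D (fun x => Num.max (a x) 0).
  by apply: measurable_maxr => //; exact: measurable_cst.
have mna : measurable_fun D (fun x => Num.max (- a x) 0).
  by apply: measurable_maxr; [exact: measurableT_comp|exact: measurable_cst].
have pE (c : T -> R) : (\int[mu]_(x in D) (EFin \o c)^\+ x =
    \int[mu]_(x in D) (Num.max (c x) 0)%:E)%E.
  by apply: eq_integral => x _; rewrite funeposE /= EFin_max.
have nE (c : T -> R) : (\int[mu]_(x in D) (EFin \o c)^\- x =
    \int[mu]_(x in D) (Num.max (- c x) 0)%:E)%E.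
  by apply: eq_integral => x _; rewrite funenegE /= EFin_max.
have Ina : mu.-integrable D (EFin \o (fun x => Num.max (- a x) 0)).
  apply: Ig_ge0_lty => //; first by move=> x _; rewrite le_max lexx orbT.
  rewrite ltNge leye_eq; apply/negP => /eqP h; move/eqP: aNy; apply.
  by rewrite integralE [X in (_ - X)%E]nE h addeNy.
have pa : (\int[mu]_(x in D) (Num.max (a x) 0)%:E = +oo)%E.
  apply/eqP; rewrite -leye_eq leNgt; apply/negP => h; apply: nIa.
  have Ipa : mu.-integrable D (EFin \o (fun x => Num.max (a x) 0)).
    by apply: Ig_ge0_lty => // x _; rewrite le_max lexx orbT.
  apply: (Ig_ext mD _ (Ig_sub mD Ipa Ina)) => x _.
  by case: (leP (a x) 0) => ?; case: (leP (- a x) 0) => ?; lra.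
have Inab : mu.-integrable D (EFin \o (fun x => Num.max (- (a x + b x)) 0)).
  apply: (Ig_le mD _ _ (Ig_add mD Ina (Ig_abs Ib))).
    by apply: measurable_maxr; [exact: measurableT_comp|exact: measurable_cst].
  move=> x _; rewrite ger0_norm ?le_max ?lexx ?orbT//.
  have := ler_norm (- b x); rewrite normrN => h; have := normr_ge0 (b x) => h0.
  by rewrite ge_max; case: (leP (- a x) 0) => ?; apply/andP; split; lra.
have pab : (\int[mu]_(x in D) (Num.max (a x + b x) 0)%:E = +oo)%E.
  apply/eqP; rewrite -leye_eq leNgt; apply/negP => h.
  have Ipab : mu.-integrable D (EFin \o (fun x => Num.max (a x + b x) 0)).
    apply: Ig_ge0_lty => //; last by move=> x _; rewrite le_max lexx orbT.
    by apply: measurable_maxr => //; exact: measurable_cst.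
  have : mu.-integrable D (EFin \o (fun x => Num.max (a x) 0)).
    apply: (Ig_le mD mpa _ (Ig_add mD Ipab (Ig_abs Ib))) => x _.
    rewrite ger0_norm ?le_max ?lexx ?orbT//.
    have := ler_norm (- b x); rewrite normrN => h'; have := normr_ge0 (b x) => h0.
    by rewrite ge_max; case: (leP (a x + b x) 0) => ?; apply/andP; split; lra.
  have p0 x : D x -> 0 <= Num.max (a x) 0 by rewrite le_max lexx orbT.
  by move=> /(Ig_lty mD p0); rewrite pa ltxx.
have fin_n c : mu.-integrable D (EFin \o (fun x => Num.max (- c x) 0)) ->
    (\int[mu]_(x in D) (Num.max (c x) 0)%:E = +oo)%E -> (\int[mu]_(x in D) (c x)%:E = +oo)%E.
  move=> Ic pc; rewrite integralE [X in (X - _)%E]pE [X in (_ - X)%E]nE pc.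
  by rewrite -(RintegralE_Ig mD Ic).
by rewrite (fin_n _ Inab pab) (fin_n _ Ina pa).
Qed.

(** By the mean value theorem the quotient is f(x, c_k) y_k(x) for some c_k within t_k |y_k(x)| of
    w_k(x), hence c_k tends to u(x). The majorant is required for every such c, so that no
    measurable choice of c_k is made. *)
Lemma difference_quotient_cvg d (T : measurableType d) (R : realType)
    (mu : {measure set T -> \bar R}) (D : set T) (f : T -> R -> R)
    (w_ y_ : nat -> T -> R) (t_ : nat -> R) (u y : T -> R) (g : T -> \bar R) :
  measurable D -> measure_is_complete mu ->
  (forall s, measurable_fun D (f ^~ s)) -> {ae mu, forall x, D x -> continuous (f x)} ->
  (forall k, measurable_fun D (w_ k)) -> (forall k, measurable_fun D (y_ k)) ->
  measurable_fun D u -> measurable_fun D y ->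
  (forall k, 0 < t_ k) -> t_ k @[k --> \oo] --> 0 ->
  {ae mu, forall x, D x -> w_ k x @[k --> \oo] --> u x} ->
  {ae mu, forall x, D x -> y_ k x @[k --> \oo] --> y x} ->
  mu.-integrable D g ->
  {ae mu, forall x, D x -> forall k c, `|c - w_ k x| <= t_ k * `|y_ k x| ->
     ((`|f x c| * `|y_ k x|)%:E <= g x)%E} ->
  [/\ mu.-integrable D (EFin \o (fun x => f x (u x) * y x)),
      forall k, mu.-integrable D (EFin \o
        (fun x => prim (f x) (w_ k x + t_ k * y_ k x) - prim (f x) (w_ k x))) &
      (t_ k)^-1 * \int[mu]_(x in D) (prim (f x) (w_ k x + t_ k * y_ k x) - prim (f x) (w_ k x))
        @[k --> \oo] --> \int[mu]_(x in D) (f x (u x) * y x)].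
Proof.
move=> mD muc mf cf mw my mu_ my_ t0 ct cw cy Ig bnd.
pose q k x := (t_ k)^-1 * (prim (f x) (w_ k x + t_ k * y_ k x) - prim (f x) (w_ k x)).
have mq k : measurable_fun D (q k).
  apply: measurable_funM; first exact: measurable_cst.
  apply: measurable_funB; apply: (measurable_prim mD muc mf cf) => //.
  by apply: measurable_funD => //; apply: measurable_funM => //; exact: measurable_cst.
have mvt : {ae mu, forall x, D x -> forall k, exists2 c,
    `|c - w_ k x| <= t_ k * `|y_ k x| & q k x = f x c * y_ k x}.
  apply: filterS cf => x + Dx k => /(_ Dx) cfx.
  have [c [h1 h2]] := prim_mvt (w_ k x) (w_ k x + t_ k * y_ k x) cfx.
  rewrite (addrC (w_ k x)) addrK in h1 h2; exists c.
    by rewrite (le_trans h1)// normrM gtr0_norm.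
  by rewrite /q (addrC (w_ k x)) h2; field; rewrite gt_eqF.
have cq : {ae mu, forall x, D x -> q k x @[k --> \oo] --> f x (u x) * y x}.
  apply: filterS2 (filterI cf mvt) (filterI cw cy) => x [cfx hc] [cwx cyx] Dx.
  have /choice[c_ hc_] : forall k, exists c, `|c - w_ k x| <= t_ k * `|y_ k x| /\ q k x = f x c * y_ k x.
    by move=> k; have [c] := hc Dx k; exists c.
  rewrite (_ : (fun k => q k x) = fun k => f x (c_ k) * y_ k x); last first.
    by apply/funext => k; case: (hc_ k).
  apply: cvgM; last exact: cyx.
  apply: (cvg_cont_comp (cfx Dx)).
  have d0 : c_ k - w_ k x @[k --> \oo] --> 0.
    have cb : t_ k * `|y_ k x| @[k --> \oo] --> 0.
      rewrite -[X in _ --> X](mul0r `|y x|); apply: cvgM; first exact: ct.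
      by apply: cvg_norm; exact: cyx.
    apply: norm_cvg0; apply: (squeeze_cvgr _ (cvg_cst 0) cb).
    by apply: nearW => k; rewrite normr_ge0 /=; case: (hc_ k).
  rewrite -[X in _ --> X]add0r (_ : c_ = fun k => (c_ k - w_ k x) + w_ k x); last first.
    by apply/funext => k; rewrite subrK.
  by apply: cvgD; [exact: d0|exact: cwx].
have bq : {ae mu, forall x, D x -> forall k, (`|q k x|%:E <= g x)%E}.
  apply: filterS2 mvt bnd => x hc hb Dx k; have [c h1 ->] := hc Dx k.
  by rewrite normrM; exact: hb.
have mlim : measurable_fun D (fun x => f x (u x) * y x).
  by apply: measurable_funM => //; exact: (measurable_caratheodory mD muc mf cf).
have [I1 I2 c3] := Rintegral_cvg_dominated mD mq mlim cq Ig bq.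
have ID k : mu.-integrable D (EFin \o
    (fun x => prim (f x) (w_ k x + t_ k * y_ k x) - prim (f x) (w_ k x))).
  apply: (Ig_ext mD _ (Ig_scale mD (t_ k) (I2 k))) => x _.
  by rewrite /q mulrA divff ?mul1r// gt_eqF.
split => //.
rewrite (_ : (fun k => _) = fun k => \int[mu]_(x in D) q k x)//.
by apply/funext => k; rewrite -RintegralZl.
Qed.
Lemma Rintegral_lin_le d (T : measurableType d) (R : realType)
    (mu : {measure set T -> \bar R}) (D : set T) (a b c : T -> R) (s t : R) :
  measurable D -> mu.-integrable D (EFin \o a) -> mu.-integrable D (EFin \o b) ->
  mu.-integrable D (EFin \o c) -> (forall x, D x -> s * a x - s * b x <= t * c x) ->
  s * \int[mu]_(x in D) a x - s * \int[mu]_(x in D) b x <= t * \int[mu]_(x in D) c x.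
Proof.
move=> mD Ia Ib Ic abc.
have J1 := Ig_scale mD s Ia; have J2 := Ig_scale mD s Ib; have J3 := Ig_scale mD t Ic.
rewrite -(RintegralZl s mD Ia) -(RintegralZl s mD Ib) -(RintegralZl t mD Ic) -(RintegralB mD J1 J2).
exact: (le_Rintegral mD (Ig_sub mD J1 J2) J3).
Qed.

Lemma enp_diff_le {R : realType} {N : nat} (p : R) (p1 : 1 < p) d (T : measurableType d)
    (mu : {measure set T -> \bar R}) (D : set T) (mD : measurable D) (t : R)
    (G K : T -> 'rV[R]_N.+1) :
  (forall i, Lp mu D p (fun x => G x ord0 i)) -> (forall i, Lp mu D p (fun x => K x ord0 i)) ->
  p^-1 * \int[mu]_(x in D) enp p (fun x => t *: K x + G x) x - p^-1 * \int[mu]_(x in D) enp p G x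
  <= t * \int[mu]_(x in D) plap p (t *: K x + G x) (K x).
Proof.
move=> LG LK; have Lt i : Lp mu D p (fun x => (t *: K x + G x) ord0 i).
  by under eq_fun do rewrite !mxE; apply: (Lp_add mD p1) (LG i); exact: (Lp_scale mD).
have I1 := Ig_enp mD p1 Lt; have I2 := Ig_enp mD p1 LG; have I3 := Ig_plap p1 mD Lt LK.
apply: (Rintegral_lin_le mD I1 I2 I3).
move=> x _; apply: le_trans (plap_convex p1 _ _) _.
by rewrite addrK /plap edotZr mulrCA.
Qed.

(** From t_k y_k - t y = t_k (y_k - y) + (t_k - t) y. Each nested factor 4^p comes from one sum of
    two terms, including t_k = (t_k - t) + t. *)
Lemma energy_cvg_lin {R : realType} {n : nat} (p : R) (p1 : 1 < p) d (T : measurableType d)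
    (mu : {measure set T -> \bar R}) (D : set T) (mD : measurable D)
    (y_ w_ : nat -> T -> R) (K_ G_ : nat -> T -> 'rV[R]_n) (t_ : nat -> R)
    (y w : T -> R) (K G : T -> 'rV[R]_n) (t : R) :
  (forall k, LpJ mu D p (y_ k) (K_ k)) -> (forall k, LpJ mu D p (w_ k) (G_ k)) ->
  LpJ mu D p y K -> LpJ mu D p w G ->
  energy mu D p (fun x => y_ k x - y x) (fun x => K_ k x - K x) @[k --> \oo] --> 0 ->
  energy mu D p (fun x => w_ k x - w x) (fun x => G_ k x - G x) @[k --> \oo] --> 0 ->
  t_ k @[k --> \oo] --> t ->
  energy mu D p (fun x => t_ k * y_ k x + w_ k x - (t * y x + w x))
    (fun x => t_ k *: K_ k x + G_ k x - (t *: K x + G x)) @[k --> \oo] --> 0.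
Proof.
move=> Ly_ Lw_ Ly Lw cy cw ct.
pose Ey k := energy mu D p (fun x => y_ k x - y x) (fun x => K_ k x - K x).
pose Ew k := energy mu D p (fun x => w_ k x - w x) (fun x => G_ k x - G x).
pose s k := `|t_ k - t| `^ p; pose E := energy mu D p y K.
pose B k := 4 `^ p * (4 `^ p * (4 `^ p * (s k + `|t| `^ p) * Ey k + s k * E) + Ew k).
have cs : s k @[k --> \oo] --> 0.
  apply: (cvg_powR0 p1); rewrite -(subrr t).
  by apply: cvgB; [exact: ct|exact: cvg_cst].
have cB : B k @[k --> \oo] --> 0.
  have -> : 0 = 4 `^ p * (4 `^ p * (4 `^ p * (0 + `|t| `^ p) * 0 + 0 * E) + 0) :> R.
    by rewrite mulr0 mul0r !addr0 !mulr0.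
  apply: cvgMr; apply: cvgD; last exact: cw.
  apply: cvgMr; apply: cvgD; last exact: cvgMl.
  apply: cvgM; last exact: cy.
  by apply: cvgMr; apply: cvgD; [exact: cs|exact: cvg_cst].
apply: (squeeze_cvgr _ (cvg_cst 0) cB); apply: nearW => k; rewrite energy_ge0 /=.
have L1 := LpJ_sub mD p1 (Ly_ k) Ly; have L2 := LpJ_sub mD p1 (Lw_ k) Lw.
have L3 := LpJ_scale mD p1 (t_ k) L1; have L4 := LpJ_scale mD p1 (t_ k - t) Ly.
have L5 := LpJ_add mD p1 L3 L4.
have h2 := energy_add mD p1 L5 L2; have := energy_add mD p1 L3 L4.
rewrite (energy_scale mD (t_ k) L1) (energy_scale mD (t_ k - t) Ly) => h1.
apply: le_trans (le_trans h2 _).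
  rewrite le_eqVlt; apply/orP; left; apply/eqP.
  have aux (s1 a1 b1 a2 b2 : R) :
      s1 * a1 + b1 - (t * a2 + b2) = s1 * (a1 - a2) + (s1 - t) * a2 + (b1 - b2) by ring.
  apply: f_equal2; apply/funext => x; first exact: aux.
  by apply/rowP => i; rewrite !mxE; exact: aux.
rewrite /B ler_wpM2l ?powR_ge0// lerD2r.
apply: (le_trans h1); apply: ler_wpM2l; first exact: powR_ge0.
rewrite lerD2r; apply: ler_wpM2r; first exact: energy_ge0.
by rewrite -{1}(subrK t (t_ k)); exact: powR_normD.
Qed.

Lemma energy_ae0 {R : realType} {n : nat} (p : R) (p1 : 1 < p) d (T : measurableType d)
    (mu : {measure set T -> \bar R}) (D : set T) (mD : measurable D)
    (y : T -> R) (K : T -> 'rV[R]_n) : LpJ mu D p y K ->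
  {ae mu, forall x, D x -> y x = 0} -> {ae mu, forall x, D x -> K x = 0} ->
  energy mu D p y K = 0.
Proof.
move=> L y0 K0; have e0 : energy mu D p y K = \int[mu]_(x in D) 0.
  apply: ae_eq_Rintegral => //; first exact: (Ig_measurable (Ig_en mD L)).
  apply: filterS2 y0 K0 => x h1 h2 Dx; rewrite /en (h1 Dx) (h2 Dx).
  rewrite normr0 powR0 ?gt_eqF ?(lt_trans ltr01)// add0r big1// => i _.
  by rewrite mxE normr0 powR0// gt_eqF// (lt_trans ltr01).
by rewrite e0 /Rintegral integral0.
Qed.

Lemma clip_derive1 {R : realType} (N : nat) (M : R) (dM : R -> R) (t : R) :
  @smooth1 R N (clip M) dM -> `|t| < M -> dM t = 1.
Proof.
move=> [dc _ _] tM; have := dc t => -[_ <-].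
have -> : 'D_1 (clip M) t = 'D_1 id t.
  apply: near_eq_derive; near=> s; apply: clip_id; apply: ltW; near: s.
  have := @norm_continuous R R^o t => /cvgrPdist_lt /(_ (M - `|t|)).
  rewrite subr_gt0 => /(_ tM); apply: filterS => s.
  by rewrite ltr_norml => /andP[]; lra.
by rewrite derive_id.
Unshelve. all: by end_near. Qed.

Lemma ratio_cvg {R : realType} (e_ t_ : nat -> R) (s : R) :
  e_ k @[k --> \oo] --> 0 -> t_ k @[k --> \oo] --> s ->
  ratio_map (e_ k) s (t_ k) @[k --> \oo] --> 2^-1 * s.
Proof.
move=> ce ct; have [->|sn0] := eqVneq s 0.
  rewrite mulr0; under eq_fun do rewrite /ratio_map !mul0r; exact: cvg_cst.
have q0 : s * s + s * s + 0 != 0.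
  by rewrite addr0 -mulr2n mulrn_eq0 negb_or /= mulf_neq0.
have -> : 2^-1 * s = s * (s * s) * (s * s + s * s + 0)^-1.
  by rewrite (_ : s * (s * s) = 2^-1 * s * (s * s + s * s + 0)) ?mulfK//; field.
rewrite /ratio_map; apply: cvgM.
  by apply: cvgM; [exact: cvg_cst|exact: cvgM].
apply: cvgV; first exact: q0.
by apply: cvgD => //; apply: cvgD; [exact: cvg_cst|exact: cvgM].
Qed.

Lemma plateau_cvg1 {R : realType} (b_ : nat -> R) (s : R) : b_ k @[k --> \oo] --> 0 ->
  plateau 1 (b_ k * s) @[k --> \oo] --> (1 : R).
Proof.
move=> cb; apply: cvg_near_cst.
have : b_ k * s @[k --> \oo] --> 0 by rewrite -(mul0r s); apply: cvgMl.
move=> /cvgrPdist_le /(_ 1 ltr01); apply: filterS => k.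
by rewrite sub0r normrN => /plateau_eq1.
Qed.

Lemma energy_dominated {R : realType} {n : nat} (p : R) (p1 : 1 < p) d (T : measurableType d)
    (mu : {measure set T -> \bar R}) (D : set T) (mD : measurable D) (C : R)
    (z u v w : T -> R) (Z G K J : T -> 'rV[R]_n) : 0 <= C ->
  LpJ mu D p z Z -> LpJ mu D p u G -> LpJ mu D p v K -> LpJ mu D p w J ->
  (forall x, D x -> `|z x| <= C * (`|u x| + `|v x| + `|w x|)) ->
  (forall x i, D x -> `|Z x ord0 i| <= C * (`|G x ord0 i| + `|K x ord0 i| + `|J x ord0 i|)) ->
  energy mu D p z Z <= (C * 4) `^ p * (energy mu D p u G + energy mu D p v K + energy mu D p w J).
Proof.
move=> C0 Lz Lu Lv Lw hz hZ.
have Iz := Ig_en mD Lz; have Iu := Ig_en mD Lu; have Iv := Ig_en mD Lv; have Iw := Ig_en mD Lw.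
have Iuv := Ig_add mD Iu Iv; have Iuvw := Ig_add mD Iuv Iw.
have I2 := Ig_scale mD ((C * 4) `^ p) Iuvw.
have bound (a b c e : R) : 0 <= a -> 0 <= b -> 0 <= c -> 0 <= e -> a <= C * (b + c + e) ->
    a `^ p <= (C * 4) `^ p * (b `^ p + c `^ p + e `^ p).
  move=> a0 b0 c0 e0 h; have := @powR_max4 _ _ p1 C b c e 0 a C0 a0 b0 c0 e0 (lexx _).
  by rewrite addr0 powR0 ?addr0 ?gt_eqF ?(lt_trans ltr01)//; apply.
have eE : (C * 4) `^ p * (energy mu D p u G + energy mu D p v K + energy mu D p w J) =
    \int[mu]_(x in D) ((C * 4) `^ p * (en p u G x + en p v K x + en p w J x)).
  rewrite (RintegralZl _ mD Iuvw) (RintegralD mD Iuv Iw) (RintegralD mD Iu Iv) //.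
rewrite eE; apply: (le_Rintegral mD Iz I2) => x Dx; rewrite /en.
apply: (@le_trans _ _ ((C * 4) `^ p * (`|u x| `^ p + `|v x| `^ p + `|w x| `^ p) +
  \sum_i (C * 4) `^ p * (`|G x ord0 i| `^ p + `|K x ord0 i| `^ p + `|J x ord0 i| `^ p))).
  apply: lerD; first by apply: bound => //; exact: hz.
  by apply: ler_sum => i _; apply: bound => //; exact: hZ.
rewrite -mulr_sumr !big_split /= -mulrDr.
have aux (a b c a' b' c' : R) : a + b + c + (a' + b' + c') = a + a' + (b + b') + (c + c') by ring.
by rewrite aux.
Qed.

(** * The derivative of the functional at u *)

Section main.
Context {R : realType} {N : nat}.
Local Notation V := 'rV[R]_N.+1.
Local Notation T := (leb_type R N).
Local Notation mu := (@leb R N).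
Variables (Omega : set V) (p : R) (h : (V -> R) -> R) (f : V -> R -> R).
Hypothesis oO : open Omega.
Hypothesis bO : bounded_set Omega.
Hypothesis p1 : 1 < p.
Hypothesis hh : dual_W1p0 Omega p h.
Hypothesis hf : caratheodory Omega f.
Hypothesis hfloc : forall r : R, 0 < r -> L1loc Omega (sup_abs f r).
Variable u : V -> R.
Hypothesis hu : W1p0 Omega p u.
Implicit Types (v w y : V -> R) (G K : V -> V).

Local Notation gr := (grad Omega p).
Local Notation nrm := (sobolev_norm Omega p).
Local Notation LJ v G := (@LpJ _ T R N.+1 mu Omega p v G).
Local Notation EO v G := (@energy _ T R N.+1 mu Omega p v G).
Local Notation IO g := (mu.-integrable (Omega : set T) (EFin \o (g : T -> R))).
Local Notation WO v G := (W0 Omega p v G).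

Let mOm : measurable (Omega : set T). Proof. exact: mO. Qed.

Lemma leb_complete : measure_is_complete mu.
Proof. exact: measure_is_complete_caratheodory. Qed.

Let p0 : 0 < p. Proof. exact: lt_trans p1. Qed.

Lemma W0gr v : W1p0 Omega p v -> WO v (gr v).
Proof. exact: W1p0_W0. Qed.

Lemma neg_plaplacianE v K : WO v K ->
  neg_plaplacian Omega p u v = \int[mu]_(x in Omega) plap p (gr u x) (K x).
Proof.
move=> W; have Wu := W0gr hu; have Wv := W0gr (W0_W1p0 oO bO p1 W).
apply: (@ae_eq_Rintegral _ T R mu Omega mOm).
- exact: (Ig_measurable (Ig_plap p1 mOm Wu.1.2 Wv.1.2)).
- exact: (Ig_measurable (Ig_plap p1 mOm Wu.1.2 W.1.2)).
have := W0_grad oO bO p1 W; apply: filterS => x + Ox => /(_ Ox) ->.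
by rewrite /plap.
Qed.

Lemma neg_plaplacian_lin (a : R) v w : W1p0 Omega p v -> W1p0 Omega p w ->
  neg_plaplacian Omega p u (fun x => a * v x + w x) =
  a * neg_plaplacian Omega p u v + neg_plaplacian Omega p u w.
Proof.
move=> hv hw; have Wu := W0gr hu; have Wv := W0gr hv; have Ww := W0gr hw.
rewrite (neg_plaplacianE (W0_lin oO bO p1 a Wv Ww)) (neg_plaplacianE Wv) (neg_plaplacianE Ww).
have I1 := Ig_plap p1 mOm Wu.1.2 Wv.1.2; have I2 := Ig_plap p1 mOm Wu.1.2 Ww.1.2.
rewrite -(@RintegralZl _ T R mu Omega _ _ mOm I1).
rewrite -(@RintegralD _ T R mu Omega _ _ mOm (Ig_scale mOm a I1) I2).
by apply: eq_Rintegral => x _; rewrite plap_lin.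
Qed.

Definition Ip v : R := \int[mu]_(x in Omega) (@enp _ T R N p (gr v) x).

Lemma Ip_le v : W1p0 Omega p v -> Ip v <= nrm v `^ p.
Proof.
move=> hv; have Wv := W0gr hv.
rewrite (sobolev_norm_powR oO bO p1 (W0_Lp oO Wv) (W0_weak oO bO p1 Wv)) /enormp lerDr.
by apply: Rintegral_ge0 => x _; exact: powR_ge0.
Qed.

Lemma neg_plaplacian_le v : W1p0 Omega p v -> `|neg_plaplacian Omega p u v| <= Ip u + Ip v.
Proof.
move=> hv; have Wu := W0gr hu; have Wv := W0gr hv.
rewrite (neg_plaplacianE Wv); have I1 := Ig_plap p1 mOm Wu.1.2 Wv.1.2.
have Iu := Ig_enp mOm p1 Wu.1.2; have Iv := Ig_enp mOm p1 Wv.1.2.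
apply: (le_trans (@le_normr_Rintegral _ T R mu Omega _ mOm I1)).
rewrite /Ip -(@RintegralD _ T R mu Omega _ _ mOm Iu Iv).
apply: (@le_Rintegral _ T R mu Omega _ _ mOm (Ig_abs I1) (Ig_add mOm Iu Iv)).
by move=> x _; exact: plap_le.
Qed.

Lemma linear_scale (L : (V -> R) -> R) :
  (forall (a : R) v w, W1p0 Omega p v -> W1p0 Omega p w ->
     L (fun x => a * v x + w x) = a * L v + L w) ->
  forall (a : R) v, W1p0 Omega p v -> L (fun x => a * v x) = a * L v.
Proof.
move=> lin a v hv; have h0 : W1p0 Omega p (fun=> 0) by exact: (W0_W1p0 oO bO p1 (W0_0 oO bO p1)).
have z0 : L (fun=> 0) = 0.
  have := lin 1 _ _ h0 h0; under [fun x => _ + _]eq_fun do rewrite mul1r addr0.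
  by rewrite mul1r => /eqP; rewrite -subr_eq0 opprD addNKr oppr_eq0 => /eqP.
have := lin a _ _ hv h0; rewrite z0 addr0 => <-.
by congr L; apply/funext => x; rewrite addr0.
Qed.

(** Dividing v by any l > nrm v, rather than by nrm v, also covers the case nrm v = 0. *)
Lemma homogeneous_bound (L : (V -> R) -> R) (C : R) :
  (forall (a : R) v, W1p0 Omega p v -> L (fun x => a * v x) = a * L v) ->
  (forall v, W1p0 Omega p v -> nrm v <= 1 -> `|L v| <= C) ->
  forall v, W1p0 Omega p v -> `|L v| <= C * nrm v.
Proof.
move=> hom bnd v hv.
have C0 : 0 <= C.
  have h0 : W1p0 Omega p (fun=> 0) by exact: (W0_W1p0 oO bO p1 (W0_0 oO bO p1)).
  have n0 : nrm (fun=> 0) <= 1.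
    have := sobolev_norm_scale oO bO p1 0 h0; rewrite (_ : (fun x => _) = (fun=> 0)).
      by move=> ->; rewrite normr0 mul0r.
    by apply/funext => x; rewrite mulr0.
  exact: le_trans (bnd _ h0 n0).
have key (l : R) : nrm v < l -> `|L v| <= C * l.
  move=> vl; have l0 : 0 < l by exact: le_lt_trans (sobolev_norm_ge0 _ _ _) vl.
  have hlv := W0_W1p0 oO bO p1 (W0_scale oO bO p1 l^-1 (W0gr hv)).
  have nlv : nrm (fun x => l^-1 * v x) <= 1.
    rewrite (sobolev_norm_scale oO bO p1 _ hv) gtr0_norm ?invr_gt0//.
    by rewrite ler_pdivrMl// mulr1 ltW.
  have := bnd _ hlv nlv; rewrite hom// normrM gtr0_norm ?invr_gt0//.
  by rewrite ler_pdivrMl// mulrC.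
apply/ler_addgt0Pr => e e0.
have [C00|Cn0] := eqVneq C 0.
  have := key (nrm v + 1); rewrite ltrDl ltr01 => /(_ isT); rewrite C00 !mul0r => h'.
  by rewrite add0r (le_trans h')// ltW.
have Cp : 0 < C by rewrite lt0r Cn0.
have := key (nrm v + e / C); rewrite ltrDl divr_gt0// => /(_ isT).
by rewrite mulrDr mulrCA divff// mulr1.
Qed.

Lemma neg_plaplacian_bound : exists C : R, forall v, W1p0 Omega p v ->
  `|neg_plaplacian Omega p u v| <= C * nrm v.
Proof.
exists (Ip u + 1); apply: (homogeneous_bound (linear_scale neg_plaplacian_lin)) => v hv nv.
apply: (le_trans (neg_plaplacian_le hv)); rewrite lerD2l (le_trans (Ip_le hv))//.
by have := powR_mono p1 (sobolev_norm_ge0 _ _ _) nv; rewrite powR1.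
Qed.
Lemma PhiE w : W1p0 Omega p w ->
  Phi Omega p f h w = ((p^-1 * Ip w)%:E - Psi Omega f w - (h w)%:E)%E.
Proof.
move=> hw; rewrite /Phi EFinM /Ip (RintegralE_Ig mOm (Ig_enp mOm p1 (W0gr hw).1.2)).
by [].
Qed.

Lemma Ip_diff_le w y K t : W1p0 Omega p w -> WO y K ->
  p^-1 * Ip (fun x => t * y x + w x) - p^-1 * Ip w <=
  t * \int[mu]_(x in Omega) plap p (t *: K x + gr w x) (K x).
Proof.
move=> hw Wy; have Ww := W0gr hw; have Wt := W0_lin oO bO p1 t Wy Ww.
have Wgt := W0gr (W0_W1p0 oO bO p1 Wt).
have I1 := Ig_enp mOm p1 Wt.1.2.
have -> : Ip (fun x => t * y x + w x) =
    \int[mu]_(x in Omega) (@enp _ T R N p (fun x => t *: K x + gr w x) x).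
  apply: (@ae_eq_Rintegral _ T R mu Omega mOm).
  - exact: (Ig_measurable (Ig_enp mOm p1 Wgt.1.2)).
  - exact: (Ig_measurable I1).
  have := W0_grad oO bO p1 Wt; apply: filterS => x + Ox => /(_ Ox).
  by rewrite /enp => ->.
exact: (@enp_diff_le R N p p1 _ T mu Omega mOm t (gr w) K Ww.1.2 Wy.1.2).
Qed.

Lemma measurable_primO w : measurable_fun (Omega : set T) (w : T -> R) ->
  measurable_fun (Omega : set T) (fun x : T => prim (f x) (w x)).
Proof. by case: hf => mf cf; exact: (measurable_prim mOm leb_complete mf cf). Qed.

(** Psi(w) = -oo is excluded by [Phi] w <= m. If Psi(w) = +oo, it remains so at the new point, where
    [Phi] is then -oo. If Psi(w) is finite, the convexity bound for the gradient term reduces the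
    claim to real arithmetic. *)
Lemma Phi_step w y K t m delta : W1p0 Omega p w -> WO y K ->
  IO (fun x => prim (f x) (w x + t * y x) - prim (f x) (w x)) ->
  (Phi Omega p f h w <= m%:E)%E ->
  t * \int[mu]_(x in Omega) plap p (t *: K x + gr w x) (K x) -
    \int[mu]_(x in Omega) (prim (f x) (w x + t * y x) - prim (f x) (w x)) -
    t * h y <= - (delta * t) ->
  (Phi Omega p f h (fun x => (t * y x + w x)%R) <= (m - delta * t)%:E)%E.
Proof.
have aux (a b tJ D th r l m0 dt : R) : b - a <= tJ -> tJ - D - th <= - dt ->
  a - r - l <= m0 -> b - (r + D) - (th + l) <= m0 - dt by lra.
move=> hw Wy ID Pw ht; have Ww := W0gr hw; have hy := W0_W1p0 oO bO p1 Wy.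
have hwt := W0_W1p0 oO bO p1 (W0_lin oO bO p1 t Wy Ww).
have dI := Ip_diff_le t hw Wy; move: dI ht Pw.
set J := \int[mu]_(x in Omega) plap _ _ _.
rewrite (PhiE hw) (PhiE hwt) (hh.1 t _ _ hy hw) => dI ht.
set D := \int[mu]_(x in Omega) _ in ht.
have PsiD : Psi Omega f w != -oo%E ->
    Psi Omega f (fun x => t * y x + w x) = (Psi Omega f w + D%:E)%E.
  move=> nP; rewrite -(@integral_add_Ig _ T R mu Omega _ _ mOm (measurable_primO Ww.1.1.1) ID nP).
  by apply: eq_integral => x _; rewrite [X in _ = X%:E]addrC subrK [X in prim _ X]addrC.
case E : (Psi Omega f w) => [r| |] //; last first.
  by move=> _; rewrite PsiD ?E //= leNye.
rewrite PsiD ?E// -EFinD -!EFinN -!EFinD !lee_fin.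
exact: (aux _ _ _ _ _ _ _ _ _ dI ht).
Qed.

Lemma sobolev_norm_subC v w : W1p0 Omega p v -> W1p0 Omega p w ->
  nrm (v \- w) = nrm (w \- v).
Proof.
move=> hv hw; have hwv := W0_W1p0 oO bO p1 (W0_sub oO bO p1 (W0gr hw) (W0gr hv)).
have := sobolev_norm_scale oO bO p1 (-1) hwv; rewrite normrN1 mul1r => <-.
by congr (sobolev_norm Omega p _); apply/funext => x /=; rewrite mulN1r opprB.
Qed.

(* Local statements around a point are proved by contradiction along sequences
   with summable energies, to which fast_cvg applies. *)
Lemma near_seq z (t0 : R) (P : (V -> R) -> R -> Prop) : W1p0 Omega p z ->
  (forall (w_ : nat -> V -> R) (t_ : nat -> R), (forall k, W1p0 Omega p (w_ k)) ->
    (forall k, EO (fun x => w_ k x - z x) (fun x => gr (w_ k) x - gr z x) <= 2^-1 ^+ k) ->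
    (forall k, `|t_ k - t0| <= 2^-1 ^+ k) -> exists k : nat, P (w_ k) (t_ k)) ->
  exists2 s : R, 0 < s & forall w t, W1p0 Omega p w -> nrm (w \- z) < s -> `|t - t0| < s -> P w t.
Proof.
move=> hz hP; apply: contrapT => nex.
(* N + 1 is the constant that bounds the energy by the p-th power of the Sobolev norm, so norms
   below s give energies of at most 2^-k. *)
have small (k : nat) : exists2 s : R, 0 < s & s <= 2^-1 ^+ k /\ N.+1%:R * s `^ p <= 2^-1 ^+ k.
  have e0 : 0 < (2^-1 : R) ^+ k by rewrite exprn_gt0// invr_gt0.
  pose s : R := Num.min (2^-1 ^+ k) ((2^-1 ^+ k / N.+1%:R) `^ p^-1).
  have s0 : 0 < s by rewrite lt_min e0 powR_gt0// divr_gt0.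
  exists s => //; split; first by rewrite ge_min lexx.
  rewrite mulrC -ler_pdivlMr//.
  apply: (@le_trans _ _ (((2^-1 ^+ k / N.+1%:R) `^ p^-1) `^ p)).
    have s2 : s <= (2^-1 ^+ k / N.+1%:R) `^ p^-1 by rewrite ge_min lexx orbT.
    exact: (powR_mono p1 (ltW s0) s2).
  by rewrite -powRrM mulVf ?gt_eqF// powRr1// divr_ge0// ltW.
have /choice[w_ /choice[t_ hw]] : forall k : nat, exists w, exists t,
    [/\ W1p0 Omega p w, EO (fun x => w x - z x) (fun x => gr w x - gr z x) <= 2^-1 ^+ k,
        `|t - t0| <= 2^-1 ^+ k & ~ P w t].
  move=> k; have [s s0 [s1 s2]] := small k; apply: contrapT => nk; apply: nex.
  exists s => // w t hw ws ts; apply: contrapT => nP; apply: nk; exists w, t; split => //.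
    apply: (le_trans (energy_le_sobolev_norm oO bO p1 (W0_sub oO bO p1 (W0gr hw) (W0gr hz)))).
    apply: le_trans s2; apply: ler_wpM2l => //.
    exact: (powR_mono p1 (sobolev_norm_ge0 _ _ _) (ltW ws)).
  exact: le_trans (ltW ts) s1.
have [k] := hP w_ t_ (fun k => let: And4 a _ _ _ := hw k in a)
  (fun k => let: And4 _ a _ _ := hw k in a) (fun k => let: And4 _ _ a _ := hw k in a).
by have [_ _ _] := hw k.
Qed.

Lemma sobolev_norm_cvg0 (w_ : nat -> V -> R) (G_ : nat -> V -> V) :
  (forall k, WO (w_ k) (G_ k)) -> EO (w_ k) (G_ k) @[k --> \oo] --> 0 ->
  nrm (w_ k) @[k --> \oo] --> 0.
Proof.
move=> Ww cE; apply: (cvg_powR0_inv p1).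
have cB : (1 + N.+1%:R `^ p) * EO (w_ k) (G_ k) @[k --> \oo] --> 0.
  rewrite -[X in _ --> X](mulr0 (1 + N.+1%:R `^ p)); exact: cvgMr.
apply: (squeeze_cvgr _ (cvg_cst 0) cB); apply: nearW => k.
rewrite powR_ge0 ger0_norm ?sobolev_norm_ge0//=.
exact: (sobolev_norm_le_energy oO bO p1 (Ww k)).
Qed.

Lemma dual_cvg (w_ : nat -> V -> R) (w : V -> R) (G_ : nat -> V -> V) (G : V -> V) :
  (forall k, WO (w_ k) (G_ k)) -> WO w G ->
  EO (fun x => w_ k x - w x) (fun x => G_ k x - G x) @[k --> \oo] --> 0 ->
  h (w_ k) @[k --> \oo] --> h w.
Proof.
move=> Ww_ Ww cE; have [hl [C hC]] := hh.
have Wd k := W0_sub oO bO p1 (Ww_ k) Ww.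
have cn := sobolev_norm_cvg0 Wd cE.
have hd k : h (w_ k) - h w = h (w_ k \- w).
  have := hl (-1) w (w_ k) (W0_W1p0 oO bO p1 Ww) (W0_W1p0 oO bO p1 (Ww_ k)).
  rewrite mulN1r addrC => <-; congr h; apply/funext => x /=; by rewrite mulN1r addrC.
apply/cvgrPdist_lt => e e0.
have cC : C * nrm (w_ k \- w) @[k --> \oo] --> 0.
  rewrite -[X in _ --> X](mulr0 C); exact: cvgMr.
move/cvgrPdist_lt : cC => /(_ e e0); apply: filterS => k; rewrite sub0r normrN distrC hd.
apply: le_lt_trans; apply: le_trans (ler_norm _).
exact: (hC _ (W0_W1p0 oO bO p1 (Wd k))).
Qed.

(** The predicates live on the normed space, the a.e. filter on its measurable copy; this form
    reconciles the two. *)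
Lemma ae_mp (P Q : V -> Prop) : (forall x, P x -> Q x) ->
  {ae mu, forall x, P x} -> {ae mu, forall x, Q x}.
Proof. exact: (@filterS _ _ (ae_filter_ringOfSetsType mu)). Qed.

Lemma ae_mp2 (P1 P2 Q : V -> Prop) : (forall x, P1 x -> P2 x -> Q x) ->
  {ae mu, forall x, P1 x} -> {ae mu, forall x, P2 x} -> {ae mu, forall x, Q x}.
Proof. exact: (@filterS2 _ _ (ae_filter_ringOfSetsType mu)). Qed.

(** * The deformation along a truncated direction *)

Section deformation.
Variables (v : V -> R) (M A C : R) (Kc : set V) (dA dM : R -> R).
Hypothesis hv : W1p0 Omega p v.
Hypothesis M0 : 0 <= M.
Hypothesis vM : {ae mu, forall x, Omega x -> `|v x| <= M}.
Hypothesis A0 : 0 <= A.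
Hypothesis uA : {ae mu, forall x, Omega x -> v x != 0 -> `|u x| <= A}.
Hypothesis cK : compact Kc.
Hypothesis KO : Kc `<=` Omega.
Hypothesis vK : {ae mu, forall x, Omega x -> ~ Kc x -> v x = 0}.
Hypothesis cmap : @chain_map _ T R Omega C (cutoff A 1 M) (cutoff_l 1 M dA) (cutoff_r A 1 dM).
Hypothesis tmap : test_chain Omega (cutoff A 1 M) (cutoff_l 1 M dA) (cutoff_r A 1 dM).

(** This is the direction y(w): v clipped at level M and switched off where |w| >= A + 1. The bound
    A on u where v is nonzero makes y(u) = v a.e. *)
Definition vtrunc w : V -> R := fun x => cutoff A 1 M (w x) (v x).
Definition vtrunc_grad w : V -> V :=
  @cgrad _ T R N.+1 (cutoff_l 1 M dA) (cutoff_r A 1 dM) w (gr w) v (gr v).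

Lemma W0_vtrunc w : W1p0 Omega p w -> WO (vtrunc w) (vtrunc_grad w).
Proof. move=> hw; exact: (W0_chain oO bO p1 cmap tmap (W0gr hw) (W0gr hv)). Qed.

Lemma vtrunc_u : {ae mu, forall x, Omega x -> vtrunc u x = v x}.
Proof.
apply: ae_mp2 vM uA => x h1 h2 Ox; rewrite /vtrunc /cutoff clip_id ?h1// mul1r.
have [->|vn0] := eqVneq (v x) 0; first by rewrite mulr0.
by rewrite plateau_eq1 ?mul1r// h2.
Qed.

(** The gradient given by the chain rule is not evaluated: since y(u) = v a.e., uniqueness of weak
    gradients suffices. *)
Lemma vtrunc_grad_u : {ae mu, forall x, Omega x -> vtrunc_grad u x = gr v x}.
Proof.
have Wv := W0gr hv; have WY := W0_vtrunc hu.
exact: (weak_gradient_unique oO bO p1 (W0_Lp oO WY) (W0_Lp oO Wv) vtrunc_u (W0_weak oO bO p1 WY) (W0_weak oO bO p1 Wv)).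
Qed.

Lemma energy_vtrunc_u : EO (vtrunc u) (vtrunc_grad u) = EO v (gr v).
Proof. exact: (ae_eq_energy mOm (W0_vtrunc hu).1 (W0gr hv).1 vtrunc_u vtrunc_grad_u). Qed.

Lemma neg_plaplacian_vtrunc_u :
  \int[mu]_(x in Omega) plap p (gr u x) (vtrunc_grad u x) = neg_plaplacian Omega p u v.
Proof.
have Wv := W0gr hv; have WY := W0_vtrunc hu; rewrite (neg_plaplacianE Wv).
apply: (@ae_eq_Rintegral _ T R mu Omega mOm).
- exact: (Ig_measurable (Ig_plap p1 mOm (W0gr hu).1.2 WY.1.2)).
- exact: (Ig_measurable (Ig_plap p1 mOm (W0gr hu).1.2 Wv.1.2)).
by apply: ae_mp vtrunc_grad_u => x + Ox => /(_ Ox) ->.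
Qed.

(** h acts on representatives and respects a.e. equality only through its norm bound, whence
    continuity of h along a constant sequence at distance 0 from v. *)
Lemma dual_vtrunc_u : h (vtrunc u) = h v.
Proof.
have Wv := W0gr hv; have WY := W0_vtrunc hu; have Wd := W0_sub oO bO p1 WY Wv.
have e0 : EO (fun x => vtrunc u x - v x) (fun x => vtrunc_grad u x - gr v x) = 0.
  apply: (energy_ae0 p1 mOm Wd.1).
    by apply: ae_mp vtrunc_u => x + Ox => /(_ Ox) /= ->; rewrite subrr.
  by apply: ae_mp vtrunc_grad_u => x + Ox => /(_ Ox) /= ->; rewrite subrr.
have := @dual_cvg (fun=> vtrunc u) v (fun=> vtrunc_grad u) (gr v) (fun=> WY) Wv.
rewrite e0 => /(_ (cvg_cst 0)) /cvg_lim; rewrite lim_cst//; exact.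
Qed.

(* Where vtrunc w x <> 0 one has |w x| <= A + 1, and |vtrunc w x| <= M + 1; so for
   0 <= t <= 1 the segment from w x to w x + t vtrunc w x stays in the ball of
   radius A + M + 2. *)
Definition majorant (x : T) : \bar R :=
  ((M + 1)%:E * ((sup_abs f (A + M + 2) : T -> \bar R) \_ Kc) x)%E.

Lemma majorant_integrable : mu.-integrable (Omega : set T) majorant.
Proof.
apply: (@integrableZl _ T R mu Omega mOm).
apply: (@integrableS _ T R mu setT) => //.
apply/(integrable_mkcond _ (measurable_leb_compact cK)).
by apply: hfloc => //; rewrite ltr_wpDl ?addr_ge0.
Qed.

(** The statement ranges over all s, t and c after the null set is fixed, so a single null set
    serves every w and every step. *)
Lemma majorantP : {ae mu, forall x, Omega x -> forall s t c : R, 0 <= t -> t <= 1 ->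
  `|c - s| <= t * `|cutoff A 1 M s (v x)| ->
  ((`|f x c| * `|cutoff A 1 M s (v x)|)%:E <= majorant x)%E}.
Proof.
apply: ae_mp vK => x h1 Ox s t c t0 t1.
have M10 : 0 <= M + 1 by rewrite addr_ge0.
rewrite /majorant patchE; case: ifPn => [_|/negP nK]; last first.
  rewrite h1//; last by move=> Kx; apply: nK; rewrite inE.
  by rewrite /cutoff clip_id ?normr0// !mulr0 normr0 mulr0 mule0.
have yM : `|cutoff A 1 M s (v x)| <= M + 1.
  rewrite normrM -[M + 1]mul1r ler_pM// ?clip_bounded//.
  by rewrite ger0_norm ?plateau_ge0// plateau_le1.
move=> cs; have sup_ge r : `|r| <= A + M + 2 -> (`|f x r|%:E <= sup_abs f (A + M + 2) x)%E.
  by move=> rA; apply: ereal_sup_ubound; exists r.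
have sup0 : (0 <= sup_abs f (A + M + 2) x)%E.
  apply: le_trans (sup_ge 0 _); first by rewrite lee_fin.
  by rewrite normr0 !addr_ge0.
have [y0|yn0] := eqVneq (cutoff A 1 M s (v x)) 0.
  by rewrite y0 normr0 mulr0 mule_ge0.
rewrite mulrC EFinM lee_pmul ?lee_fin//; apply: sup_ge.
have sA : `|s| <= A + 1.
  rewrite leNgt; apply/negP => /ltW As; move/eqP: yn0; apply.
  by rewrite /cutoff mul1r plateau_eq0// mul0r.
have cle : `|c| <= `|c - s| + `|s| by rewrite -{1}(subrK s c) ler_normD.
apply: (le_trans cle); have ty : t * `|cutoff A 1 M s (v x)| <= M + 1.
  by rewrite -[M + 1]mul1r ler_pM.
have aux (a b e : R) : a <= e -> e <= M + 1 -> b <= A + 1 -> a + b <= A + M + 2 by lra.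
exact: (aux _ _ _ cs ty sA).
Qed.

Lemma cvg_half_pow : (2^-1 : R) ^+ k @[k --> \oo] --> 0.
Proof. by apply: cvg_expr; rewrite ger0_norm ?invf_lt1 ?ltr1n. Qed.

Lemma vtrunc_cvg z (w_ : nat -> V -> R) : W1p0 Omega p z -> (forall k, W1p0 Omega p (w_ k)) ->
  (forall k, EO (fun x => w_ k x - z x) (fun x => gr (w_ k) x - gr z x) <= 2^-1 ^+ k) ->
  EO (fun x => vtrunc (w_ k) x - vtrunc z x) (fun x => vtrunc_grad (w_ k) x - vtrunc_grad z x) @[k --> \oo] --> 0.
Proof.
move=> hz hw Ew; have Wv := W0gr hv.
apply: (chain_cvg mOm p1 cmap (fun k => (W0gr (hw k)).1) (fun k => Wv.1) (W0gr hz).1 Wv.1 Ew).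
move=> k; have Wd := W0_sub oO bO p1 Wv Wv.
rewrite (energy_ae0 p1 mOm Wd.1); first by rewrite exprn_ge0// invr_ge0.
- by apply: aeW => x _; exact: subrr.
- by apply: aeW => x _; exact: subrr.
Qed.

Lemma deform_cvg z (w_ : nat -> V -> R) (t_ : nat -> R) (t0 : R) :
  W1p0 Omega p z -> (forall k, W1p0 Omega p (w_ k)) ->
  (forall k, EO (fun x => w_ k x - z x) (fun x => gr (w_ k) x - gr z x) <= 2^-1 ^+ k) ->
  (forall k, `|t_ k - t0| <= 2^-1 ^+ k) ->
  EO (fun x => t_ k * vtrunc (w_ k) x + w_ k x - (t0 * vtrunc z x + z x))
     (fun x => t_ k *: vtrunc_grad (w_ k) x + gr (w_ k) x - (t0 *: vtrunc_grad z x + gr z x)) @[k --> \oo] --> 0.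
Proof.
move=> hz hw Ew Et; have cY := vtrunc_cvg hz hw Ew.
have ct : t_ k @[k --> \oo] --> t0.
  apply/cvgrPdist_le => e e0; have /cvgrPdist_le/(_ e e0) := cvg_half_pow.
  apply: filterS => k; rewrite sub0r normrN ger0_norm ?exprn_ge0 ?invr_ge0// distrC.
  exact: le_trans (Et k).
have cE : EO (fun x => w_ k x - z x) (fun x => gr (w_ k) x - gr z x) @[k --> \oo] --> 0.
  apply: (squeeze_cvgr _ (cvg_cst 0) cvg_half_pow); apply: nearW => k.
  by rewrite Ew andbT; exact: energy_ge0.
exact: (energy_cvg_lin p1 mOm (fun k => (W0_vtrunc (hw k)).1) (fun k => (W0gr (hw k)).1)
  (W0_vtrunc hz).1 (W0gr hz).1 cY cE ct).
Qed.

Lemma deform_continuous z (t0 e : R) : W1p0 Omega p z -> 0 < e ->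
  exists2 s : R, 0 < s & forall w t, W1p0 Omega p w -> nrm (w \- z) < s -> `|t - t0| < s ->
    nrm ((fun x => t * vtrunc w x + w x) \- (fun x => t0 * vtrunc z x + z x)) < e.
Proof.
move=> hz e0; apply: (near_seq hz) => w_ t_ hw Ew Et.
have cE := deform_cvg hz hw Ew Et.
have Wl k := W0_lin oO bO p1 (t_ k) (W0_vtrunc (hw k)) (W0gr (hw k)).
have W0l := W0_lin oO bO p1 t0 (W0_vtrunc hz) (W0gr hz).
have := sobolev_norm_cvg0 (fun k => W0_sub oO bO p1 (Wl k) W0l) cE.
move/cvgrPdist_lt/(_ e e0)/filter_ex => [k]; rewrite sub0r normrN ger0_norm ?sobolev_norm_ge0//.
by exists k.
Qed.

(** The increment of [Phi] divided by t_k is bounded by a quantity converging to the derivative of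
    [Phi] at u along v, which is strictly below - delta. The last hypothesis forces the direction to
    have norm at most 1 in the limit: 4^p is the cost of y(w_k) = (y(w_k) - v) + v, and 1 + (N +
    1)^p that of passing from the energy to the Sobolev norm. *)
Lemma descent_seq (delta : R) (w_ : nat -> V -> R) (t_ : nat -> R) :
  (forall k, W1p0 Omega p (w_ k)) ->
  (forall k, EO (fun x => w_ k x - u x) (fun x => gr (w_ k) x - gr u x) <= 2^-1 ^+ k) ->
  (forall k, 0 < t_ k) -> (forall k, `|t_ k - 0| <= 2^-1 ^+ k) ->
  neg_plaplacian Omega p u v - pairing_f Omega f u v - h v < - delta ->
  (1 + N.+1%:R `^ p) * (4 `^ p * EO v (gr v)) < 1 ->
  exists k : nat, [/\ nrm (vtrunc (w_ k)) <= 1,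
    IO (fun x => prim (f x) (w_ k x + t_ k * vtrunc (w_ k) x) - prim (f x) (w_ k x)) &
    t_ k * \int[mu]_(x in Omega) plap p (t_ k *: vtrunc_grad (w_ k) x + gr (w_ k) x) (vtrunc_grad (w_ k) x) -
    \int[mu]_(x in Omega) (prim (f x) (w_ k x + t_ k * vtrunc (w_ k) x) - prim (f x) (w_ k x)) -
    t_ k * h (vtrunc (w_ k)) <= - (delta * t_ k)].
Proof.
have auxQ (t J D H : R) : 0 < t -> J - t^-1 * D - H < - delta -> t * J - D - t * H <= - (delta * t).
  move=> t0 /ltW hQ; have -> : t * J - D - t * H = t * (J - t^-1 * D - H).
    by rewrite !mulrBr mulrA divff ?gt_eqF// mul1r.
  by have := ler_wpM2l (ltW t0) hQ; rewrite [t * - delta]mulrN [t * delta]mulrC.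
move=> hw Ew tp Et hD hsmall.
have cY := vtrunc_cvg hu hw Ew; have cD := deform_cvg hu hw Ew Et.
have cS : EO (fun x => vtrunc (w_ k) x - vtrunc u x) (fun x => vtrunc_grad (w_ k) x - vtrunc_grad u x) +
    EO (fun x => t_ k * vtrunc (w_ k) x + w_ k x - (0 * vtrunc u x + u x))
     (fun x => t_ k *: vtrunc_grad (w_ k) x + gr (w_ k) x - (0 *: vtrunc_grad u x + gr u x)) @[k --> \oo] --> 0.
  by rewrite -[X in _ --> X](addr0 0); apply: cvgD; [exact: cY|exact: cD].
(* The energies of y(w_k) - y(u) and of the moved points tend to 0 without a rate; a subsequence
   makes them geometric, as [fast_cvg] and [plap_cvg] require. *)
have [n_ hn] := fast_subsequence cS.
pose w' k := w_ (n_ k); pose t' k := t_ (n_ k).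
have hw' k : W1p0 Omega p (w' k) by exact: hw.
have WY' k := W0_vtrunc (hw' k); have WYu := W0_vtrunc hu; have Wu := W0gr hu.
have pow_le k : (2^-1 : R) ^+ (n_ k) <= 2^-1 ^+ k.
  by apply: ler_wiXn2l; rewrite ?invr_ge0// ?invf_le1 ?ler1n//; exact: (hn k).1.
have Ew' k : EO (fun x => w' k x - u x) (fun x => gr (w' k) x - gr u x) <= 2^-1 ^+ k.
  exact: le_trans (Ew (n_ k)) (pow_le k).
have leS (a b c : R) : 0 <= a -> 0 <= b -> a + b <= c -> a <= c /\ b <= c by move=> *; split; lra.
have ES k := leS _ _ _ (@energy_ge0 _ T R N.+1 mu Omega p _ _) (@energy_ge0 _ T R N.+1 mu Omega p _ _) (hn k).2.
have EY' k : EO (fun x => vtrunc (w' k) x - vtrunc u x) (fun x => vtrunc_grad (w' k) x - vtrunc_grad u x) <= 2^-1 ^+ k.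
  exact: (ES k).1.
have cEY' : EO (fun x => vtrunc (w' k) x - vtrunc u x) (fun x => vtrunc_grad (w' k) x - vtrunc_grad u x) @[k --> \oo] --> 0.
  apply: (squeeze_cvgr _ (cvg_cst 0) cvg_half_pow); apply: nearW => k.
  by rewrite EY' andbT; exact: energy_ge0.
have tp' k : 0 < t' k by exact: tp.
have t'_le k : t' k <= 2^-1 ^+ k.
  by apply: le_trans (ler_norm _) _; have := Et (n_ k); rewrite subr0 => /le_trans; apply.
have ct' : t' k @[k --> \oo] --> 0.
  apply: (squeeze_cvgr _ (cvg_cst 0) cvg_half_pow); apply: nearW => k.
  by rewrite t'_le ltW.
have cJ : \int[mu]_(x in Omega) plap p (t' k *: vtrunc_grad (w' k) x + gr (w' k) x) (vtrunc_grad (w' k) x)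
    @[k --> \oo] --> neg_plaplacian Omega p u v.
  rewrite -neg_plaplacian_vtrunc_u.
  have -> : \int[mu]_(x in Omega) plap p (gr u x) (vtrunc_grad u x) =
      \int[mu]_(x in Omega) plap p (0 *: vtrunc_grad u x + gr u x) (vtrunc_grad u x).
    by apply: eq_Rintegral => x _; rewrite scale0r add0r.
  exact: (plap_cvg p1 mOm (fun k => (W0_lin oO bO p1 (t' k) (WY' k) (W0gr (hw' k))).1)
    (fun k => (WY' k).1) (W0_lin oO bO p1 0 WYu Wu).1 WYu.1 (fun k => (ES k).2) EY').
have ch := dual_cvg WY' WYu cEY'; rewrite dual_vtrunc_u in ch.
have [? [_ _ cw' _]] := fast_cvg mOm p1 (fun k => LpJ_sub mOm p1 (W0gr (hw' k)).1 Wu.1) Ew'.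
have [? [_ _ cy' _]] := fast_cvg mOm p1 (fun k => LpJ_sub mOm p1 (WY' k).1 WYu.1) EY'.
have dom : {ae mu, forall x, Omega x -> forall (k : nat) (c : R),
    `|c - w' k x| <= t' k * `|vtrunc (w' k) x| -> ((`|f x c| * `|vtrunc (w' k) x|)%:E <= majorant x)%E}.
  apply: ae_mp majorantP => x hx Ox k c; apply: (hx Ox); first exact: ltW.
  by apply: (le_trans (t'_le k)); rewrite exprn_ile1// ?invr_ge0// invf_le1 ?ler1n.
have cw : {ae mu, forall x, Omega x -> w' k x @[k --> \oo] --> u x}.
  by apply: ae_mp cw' => x hx Ox; apply/subr_cvg0; exact: hx.
have cy : {ae mu, forall x, Omega x -> vtrunc (w' k) x @[k --> \oo] --> vtrunc u x}.
  by apply: ae_mp cy' => x hx Ox; apply/subr_cvg0; exact: hx.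
have [If ID cDQ] := @difference_quotient_cvg _ T R mu Omega f w' (fun k => vtrunc (w' k)) t' u (vtrunc u)
  majorant mOm leb_complete hf.1 hf.2 (fun k => (W0gr (hw' k)).1.1.1) (fun k => (WY' k).1.1.1)
  Wu.1.1.1 WYu.1.1.1 tp' ct' cw cy majorant_integrable dom.
have pE : \int[mu]_(x in Omega) (f x (u x) * vtrunc u x) = pairing_f Omega f u v.
  apply: (@ae_eq_Rintegral _ T R mu Omega mOm).
  - exact: (Ig_measurable If).
  - apply: measurable_funM; last exact: (W0gr hv).1.1.1.
    exact: (measurable_caratheodory mOm leb_complete hf.1 hf.2 Wu.1.1.1).
  by apply: ae_mp vtrunc_u => x + Ox => /(_ Ox) ->.
rewrite pE in cDQ.
pose Q k : R := \int[mu]_(x in Omega) plap p (t' k *: vtrunc_grad (w' k) x + gr (w' k) x) (vtrunc_grad (w' k) x) -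
  (t' k)^-1 * \int[mu]_(x in Omega) (prim (f x) (w' k x + t' k * vtrunc (w' k) x) - prim (f x) (w' k x)) -
  h (vtrunc (w' k)).
have cQ : Q k @[k --> \oo] --> neg_plaplacian Omega p u v - pairing_f Omega f u v - h v.
  by apply: cvgB; [apply: cvgB; [exact: cJ|exact: cDQ]|exact: ch].
have cB : (1 + N.+1%:R `^ p) * (4 `^ p *
    (EO (fun x => vtrunc (w' k) x - vtrunc u x) (fun x => vtrunc_grad (w' k) x - vtrunc_grad u x) + EO (vtrunc u) (vtrunc_grad u)))
    @[k --> \oo] --> (1 + N.+1%:R `^ p) * (4 `^ p * (0 + EO (vtrunc u) (vtrunc_grad u))).
  by apply: cvgMr; apply: cvgMr; apply: cvgD; [exact: cEY'|exact: cvg_cst].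
rewrite add0r energy_vtrunc_u in cB.
have F1 : \forall k \near \oo, Q k < - delta by exact: (cvgr_lt _ cQ _ hD).
pose B k := (1 + N.+1%:R `^ p) * (4 `^ p *
    (EO (fun x => vtrunc (w' k) x - vtrunc u x) (fun x => vtrunc_grad (w' k) x - vtrunc_grad u x) + EO v (gr v))).
have F2 : \forall k \near \oo, B k < 1 by exact: (cvgr_lt _ cB _ hsmall).
have [k [Qk Bk]] := filter_ex (filterI F1 F2).
exists (n_ k); split; last 2 first.
- exact: ID.
- exact: (auxQ _ _ _ _ (tp' k) Qk).
have h1 := sobolev_norm_le_energy oO bO p1 (WY' k).
have h2 := energy_add mOm p1 (LpJ_sub mOm p1 (WY' k).1 WYu.1) WYu.1.
have : nrm (vtrunc (w' k)) `^ p < 1.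
  apply: (le_lt_trans h1); apply: le_lt_trans Bk; apply: ler_wpM2l.
    by rewrite addr_ge0// powR_ge0.
  rewrite -energy_vtrunc_u; apply: le_trans h2.
  rewrite le_eqVlt; apply/orP; left; apply/eqP.
  by apply: f_equal2; apply/funext => x; rewrite subrK.
move=> lt1; rewrite leNgt; apply/negP => gt1.
have := powR_mono p1 ler01 (ltW gt1); rewrite powR1 => /le_lt_trans/(_ lt1).
by rewrite ltxx.
Qed.

(** The majorant applies with t = 0 and c = s = u(x). *)
Lemma pairing_integrable : IO (fun x => f x (u x) * v x).
Proof.
have Wu := W0gr hu.
have mf : measurable_fun (Omega : set T) (fun x : T => f x (u x) * v x).
  apply: measurable_funM; last exact: (W0gr hv).1.1.1.
  exact: (measurable_caratheodory mOm leb_complete hf.1 hf.2 Wu.1.1.1).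
apply: (Ig_le_ae mOm mf majorant_integrable).
apply: ae_mp2 vtrunc_u majorantP => x h1 h2 Ox; rewrite -(h1 Ox) normrM.
by apply: (h2 Ox (u x) 0); rewrite ?mul0r ?subrr ?normr0.
Qed.

Lemma descent_near (delta : R) :
  neg_plaplacian Omega p u v - pairing_f Omega f u v - h v < - delta ->
  (1 + N.+1%:R `^ p) * (4 `^ p * EO v (gr v)) < 1 ->
  exists2 s : R, 0 < s & forall w t, W1p0 Omega p w -> nrm (w \- u) < s -> `|t - 0| < s ->
    0 < t -> nrm (vtrunc w) <= 1 /\ forall m : R, (Phi Omega p f h w <= m%:E)%E ->
      (Phi Omega p f h (fun x => (t * vtrunc w x + w x)%R) <= (m - delta * t)%:E)%E.
Proof.
move=> hD hs; apply: (near_seq hu) => w_ t_ hw Ew Et.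
have [tp|ntp] := pselect (forall k, 0 < t_ k); last first.
  by move/existsNP : ntp => [k tk]; exists k => /tk.
have [k [n1 ID hk]] := descent_seq hw Ew tp Et hD hs.
exists k => _; split; first exact: n1.
move=> m Pm; exact: (Phi_step (hw k) (W0_vtrunc (hw k)) ID Pm hk).
Qed.

(** The deformation uses only the point of the epigraph, not its level. Its displacement is t times
    the norm of the direction, hence at most t. *)
Lemma deform_regular (delta : R) :
  neg_plaplacian Omega p u v - pairing_f Omega f u v - h v < - delta ->
  (1 + N.+1%:R `^ p) * (4 `^ p * EO v (gr v)) < 1 ->
  delta_regular (W1p0 Omega p) (fun v w => nrm (v \- w)) (Phi Omega p f h) delta u.
Proof.
move=> hD hs; have [s s0 hd] := descent_near hD hs.
have dist_le (a b : R) : 0 <= a -> a <= Num.sqrt (a ^+ 2 + b ^+ 2).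
  by move=> a0; rewrite -{1}(ger0_norm a0) -sqrtr_sqr ler_wsqrtr// lerDl sqr_ge0.
have hW w t : W1p0 Omega p w -> WO (fun x => t * vtrunc w x + w x) (fun x => t *: vtrunc_grad w x + gr w x).
  by move=> hw; exact: (W0_lin oO bO p1 t (W0_vtrunc hw) (W0gr hw)).
(* Half of s, because t ranges over a closed interval whereas [descent_near] asks for a strict
   bound. *)
exists (s / 2); split; first by rewrite divr_gt0.
exists (fun z t => fun x => t * vtrunc z.1 x + z.1 x); split.
- move=> z t [_ [hz _]] _; exact: (W0_W1p0 oO bO p1 (hW z.1 t hz)).
- move=> z t [_ [hz _]] _ e e0; have [eta eta0 he] := deform_continuous t hz e0.
  exists eta => // z' t' [_ [hz' _]] _ dz dt.
  rewrite (sobolev_norm_subC (W0_W1p0 oO bO p1 (hW _ _ hz)) (W0_W1p0 oO bO p1 (hW _ _ hz'))).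
  apply: (he z'.1 t' hz'); last by rewrite distrC.
  rewrite (sobolev_norm_subC hz' hz); apply: le_lt_trans dz.
  exact: (dist_le _ _ (sobolev_norm_ge0 _ _ _)).
move=> z t [dz [hz Pz]]; rewrite /= in_itv /= => /andP[t0 ts].
have dE : nrm ((fun x => t * vtrunc z.1 x + z.1 x) \- z.1) = t * nrm (vtrunc z.1).
  have := sobolev_norm_scale oO bO p1 t (W0_W1p0 oO bO p1 (W0_vtrunc hz)); rewrite (ger0_norm t0) => <-.
  by congr (sobolev_norm Omega p _); apply/funext => x /=; rewrite addrK.
(* The quotient argument needs t > 0; at t = 0 the map is the identity and the claim is membership
   in the epigraph. *)
rewrite dE; move: t0; rewrite le_eqVlt => /orP[/eqP t0|t0].
  rewrite -t0 mul0r mulr0 subr0; split; first exact: lexx.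
  rewrite (_ : (fun x => _) = z.1); first exact: Pz.
  by apply/funext => x; rewrite mul0r add0r.
have zs : nrm (z.1 \- u) < s.
  apply: (@le_lt_trans _ _ _ _ _ (dist_le _ _ (sobolev_norm_ge0 _ _ _))).
  apply: lt_trans dz _; by rewrite ltr_pdivrMr// ltr_pMr// ltr1n.
have ts' : `|t - 0| < s.
  rewrite subr0 (gtr0_norm t0); apply: (le_lt_trans ts); by rewrite ltr_pdivrMr// ltr_pMr// ltr1n.
have [n1 hP] := hd _ _ hz zs ts' t0.
split; first by have := ler_wpM2l (ltW t0) n1; rewrite mulr1.
exact: (hP _ Pz).
Qed.

End deformation.

Lemma V_space_scale (c : R) v : V_space Omega p u v -> V_space Omega p u (fun x => c * v x).
Proof.
move=> [hv [mv [M vM] [Kc [cK KO vK]]] [A uA]].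
split; first exact: (W0_W1p0 oO bO p1 (W0_scale oO bO p1 c (W0gr hv))).
- split.
  + by apply: measurable_funM => //; exact: measurable_cst.
  + exists (`|c| * M); apply: ae_mp vM => x hx Ox; rewrite normrM.
    by apply: ler_wpM2l => //; exact: hx.
  + exists Kc; split => //; apply: ae_mp vK => x hx Ox nK.
    by rewrite hx// mulr0.
- exists A; apply: ae_mp uA => x hx [Ox cv]; apply: hx; split => //.
  by apply: contra cv => /eqP ->; rewrite mulr0.
Qed.

Lemma V_space_deformation v : V_space Omega p u v ->
  IO (fun x => f x (u x) * v x) /\ forall delta : R,
  neg_plaplacian Omega p u v - pairing_f Omega f u v - h v < - delta ->
  (1 + N.+1%:R `^ p) * (4 `^ p * EO v (gr v)) < 1 ->
  delta_regular (W1p0 Omega p) (fun v w => nrm (v \- w)) (Phi Omega p f h) delta u.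
Proof.
move=> [hv [mv [M vM] [Kc [cK KO vK]]] [A uA]].
have vM' : {ae mu, forall x, Omega x -> `|v x| <= `|M|}.
  by apply: ae_mp vM => x hx Ox; apply: (le_trans (hx Ox)); exact: ler_norm.
have uA' : {ae mu, forall x, Omega x -> v x != 0 -> `|u x| <= `|A|}.
  by apply: ae_mp uA => x hx Ox vx; apply: (le_trans (hx (conj Ox vx))); exact: ler_norm.
have [dA [sA [C1 hC1]]] := plateau_smooth N `|A|.
have [dM [sM [C2 hC2]]] := clip_smooth N `|M|.
have [C cm] := @cutoff_chain_map R _ T Omega N `|A| 1 `|M| dA dM C1 C2 (normr_ge0 M) sA sM hC1 hC2.
have tm := @cutoff_test_chain R N Omega `|A| 1 `|M| dA dM sA sM.
split; first exact: (pairing_integrable hv (normr_ge0 M) vM' (normr_ge0 A) uA' cK KO vK).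
move=> delta hD hs.
exact: (deform_regular hv (normr_ge0 M) vM' (normr_ge0 A) uA' cK KO vK cm tm hD hs).
Qed.

(** * Consequences of criticality *)

Hypothesis hcrit : critical_point (W1p0 Omega p) (fun v w => nrm (v \- w)) (Phi Omega p f h) u.

Local Notation Df v := (neg_plaplacian Omega p u v - pairing_f Omega f u v - h v).

Lemma residual_scale (c : R) v : V_space Omega p u v -> Df (fun x => c * v x) = c * Df v.
Proof.
move=> Vv; have [hv _ _] := Vv; have [If _] := V_space_deformation Vv.
rewrite (linear_scale neg_plaplacian_lin c hv) (linear_scale hh.1 c hv) !mulrBr.
congr (_ - _ - _); rewrite /pairing_f -(@RintegralZl _ T R mu Omega _ _ mOm If).
by apply: eq_Rintegral => x _; rewrite mulrCA.
Qed.

(** A negative derivative along v stays negative along c v for c > 0, while small c meets the size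
    condition; u would then be regular. *)
Lemma residual_ge0 v : V_space Omega p u v -> 0 <= Df v.
Proof.
move=> Vv; rewrite leNgt; apply/negP => Dv; have [hv _ _] := Vv.
pose B := (1 + N.+1%:R `^ p) * (4 `^ p * EO v (gr v)).
have B0 : 0 <= B.
  apply: mulr_ge0; first by rewrite addr_ge0// powR_ge0.
  by apply: mulr_ge0; [exact: powR_ge0|exact: energy_ge0].
have B1 : 0 < B + 1 by rewrite ltr_wpDl.
(* With c^p = 1 / (B + 1) the size condition becomes B / (B + 1) < 1. *)
pose c : R := (B + 1)^-1 `^ p^-1.
have c0 : 0 < c by rewrite powR_gt0// invr_gt0.
have cp : `|c| `^ p = (B + 1)^-1.
  by rewrite gtr0_norm// -powRrM mulVf ?gt_eqF// powRr1// invr_ge0 ltW.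
have Vc := V_space_scale c Vv; have [_ reg] := V_space_deformation Vc.
have small : (1 + N.+1%:R `^ p) * (4 `^ p * EO (fun x => c * v x) (gr (fun x => c * v x))) < 1.
  rewrite (energy_grad oO bO p1 (W0_scale oO bO p1 c (W0gr hv))).
  rewrite (energy_scale mOm c (W0gr hv).1) cp.
  have -> (a b e : R) : a * (b * ((B + 1)^-1 * e)) = a * (b * e) / (B + 1) by ring.
  by rewrite ltr_pdivrMr// mul1r ltrDl.
(* Half of the modulus of the scaled derivative leaves the strict inequality required. *)
have [_ _ nreg] := hcrit; pose delta : R := - (c * Df v) / 2.
have cD : c * Df v < 0 by rewrite pmulr_rlt0.
apply: (nreg delta); first by rewrite divr_gt0// oppr_gt0.
apply: reg small; rewrite (residual_scale c Vv) /delta.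
have aux (a : R) : a < 0 -> a < - (- a / 2) by lra.
exact: aux.
Qed.

Lemma V_space_equation v : V_space Omega p u v ->
  neg_plaplacian Omega p u v - h v = pairing_f Omega f u v.
Proof.
move=> Vv; have D0 := residual_ge0 Vv.
have := residual_ge0 (V_space_scale (-1) Vv); rewrite (residual_scale (-1) Vv); move: D0.
have aux (a b c : R) : 0 <= a - b - c -> 0 <= -1 * (a - b - c) -> a - c = b by lra.
exact: aux.
Qed.

Lemma dual_neg_plaplacian : dual_W1p0 Omega p (fun v => neg_plaplacian Omega p u v - h v).
Proof.
have aux (a b c b' c' : R) : a * b + b' - (a * c + c') = a * (b - c) + (b' - c') by ring.
have [hl [C hC]] := hh; have [C' hC'] := neg_plaplacian_bound; split.
  move=> a v w hv hw; rewrite (neg_plaplacian_lin a hv hw) (hl a v w hv hw).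
  exact: aux.
exists (C' + C) => v hv; rewrite mulrDl; apply: (le_trans (ler_normB _ _)).
by apply: lerD; [exact: hC'|exact: hC].
Qed.

(** The ratio is bounded by both |v| and |phi|, so z is dominated by v, bounded, and supported in
    the compact support of phi. The plateau vanishes where b |u| >= 2, so |u| <= 2 / b where z is
    nonzero. The condition b M <= 1 is the balance: differentiating the plateau costs a factor b,
    the ratio contributes at most M, so the energy of z is bounded independently of b, e and M. *)
Lemma V_approx_step (dA : R -> R) (C1 e b M : R) v phi :
  @smooth1 R N (plateau 1) dA -> (forall x, `|dA x| <= C1) -> 0 < e -> 0 < b -> 0 <= M ->
  b * M <= 1 -> W1p0 Omega p v -> test_function Omega phi -> (forall x, `|phi x| <= M) ->
  let z := fun x => plateau 1 (b * u x) * ratio_map e (v x) (phi x) in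
  [/\ V_space Omega p u z, forall x, `|z x| <= `|v x| &
  nrm z `^ p <= (1 + N.+1%:R `^ p) * (((1 + C1) * 4) `^ p *
    (EO u (gr u) + EO v (gr v) + EO phi (tgrad phi)))].
Proof.
move=> sA hC1 e0 b0 M0 bM hv tphi phiM z.
have C10 : 0 <= C1 by exact: le_trans (hC1 0).
have Wu := W0gr hu; have Wv := W0gr hv; have Wphi := test_W0 oO bO p1 tphi.
have Wy := W0_chain oO bO p1 (@ratio_chain_map R _ T Omega e e0) (ratio_test_chain e0) Wv Wphi.
(* The ratio has modulus at most M, strictly below the level M + 1, so the clip is inactive and its
   derivative is 1. It serves only to put z in the form of [cutoff]. *)
have [dM [sM [C2 hC2]]] := clip_smooth N (M + 1).
have M10 : 0 <= M + 1 by rewrite addr_ge0.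
have [C cm] := @cutoff_chain_map R _ T Omega N 1 b (M + 1) dA dM C1 C2 M10 sA sM hC1 hC2.
have tm := @cutoff_test_chain R N Omega 1 b (M + 1) dA dM sA sM.
have Wz := W0_chain oO bO p1 cm tm Wu Wy.
have yM x : `|ratio_map e (v x) (phi x)| <= M.
  by apply: (le_trans (ratio_le_r _ _ e0)); exact: phiM.
have yM1 x : `|ratio_map e (v x) (phi x)| < M + 1 by apply: (le_lt_trans (yM x)); rewrite ltrDl.
have zE : (fun x => cutoff 1 b (M + 1) (u x) (ratio_map e (v x) (phi x))) = z.
  by apply/funext => x; rewrite /cutoff clip_id// ltW.
rewrite zE in Wz; have hz := W0_W1p0 oO bO p1 Wz.
have zy x : `|z x| <= `|ratio_map e (v x) (phi x)|.
  rewrite normrM -[leRHS]mul1r; apply: ler_wpM2r; first exact: normr_ge0.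
  by rewrite (ger0_norm (plateau_ge0 _ _)); exact: plateau_le1.
have zv x : `|z x| <= `|v x| by apply: (le_trans (zy x)); exact: ratio_le_l.
split; [split|exact: zv|].
- exact: hz.
- split; first exact: Wz.1.1.1.
    by exists M; apply: aeW => x _; exact: le_trans (zy x) (yM x).
  have [_ cphi phiO] := tphi.
  exists (closure [set x | phi x != 0]); split; [exact: cphi|exact: phiO|].
  apply: aeW => x _ nx; have phi0 : phi x = 0.
    by apply/eqP/negPn/negP => px; apply: nx; exact: subset_closure.
  apply/eqP; rewrite -normr_le0; apply: (le_trans (zy x)).
  by apply: (le_trans (ratio_le_r _ _ e0)); rewrite phi0 normr0.
- exists (2 / b); apply: aeW => x [_ zx]; rewrite leNgt; apply/negP => ux.
  move/eqP : zx; apply; rewrite /z plateau_eq0 ?mul0r//.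
  rewrite normrM (gtr0_norm b0) mulrC -ler_pdivrMr//; apply: ltW.
  by rewrite (_ : 1 + 1 = 2).
apply: (le_trans (sobolev_norm_le_energy oO bO p1 Wz)); apply: ler_wpM2l.
  by rewrite addr_ge0// powR_ge0.
apply: (energy_dominated p1 mOm _ Wz.1 Wu.1 Wv.1 Wphi.1).
- by rewrite addr_ge0.
- move=> x _; apply: (le_trans (zv x)).
  have aux (a c d : R) : 0 <= a -> 0 <= c -> 0 <= d -> c <= (1 + C1) * (a + c + d) by move=> *; nra.
  by apply: aux.
move=> x i _; rewrite /cgrad !mxE.
have h1 : `|cutoff_l b (M + 1) dA (u x) (ratio_map e (v x) (phi x))| <= C1.
  rewrite /cutoff_l clip_id; last exact: ltW.
  rewrite -mulrA normrM -[leRHS]mulr1; apply: ler_pM => //.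
  rewrite normrM (gtr0_norm b0); apply: le_trans bM.
  by apply: ler_wpM2l; [exact: ltW|exact: yM].
have h2 : `|cutoff_r 1 b dM (u x) (ratio_map e (v x) (phi x))| <= 1.
  rewrite /cutoff_r (clip_derive1 sM (yM1 x)) mulr1 (ger0_norm (plateau_ge0 _ _)).
  exact: plateau_le1.
have h3 := @ratio_l_bound R e (v x) (phi x) e0; have h4 := @ratio_r_bound R e (v x) (phi x) e0.
have aux (c1 c2 c3 c4 a1 a2 a3 : R) : `|c1| <= C1 -> `|c2| <= 1 -> `|c3| <= 1 -> `|c4| <= 1 ->
    `|c1 * a1 + c2 * (c3 * a2 + c4 * a3)| <= (1 + C1) * (`|a1| + `|a2| + `|a3|).
  move=> k1 k2 k3 k4; apply: (le_trans (ler_normD _ _)); rewrite !normrM.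
  have k5 := ler_normD (c3 * a2) (c4 * a3); rewrite !normrM in k5.
  have q1 : `|c1| * `|a1| <= C1 * `|a1| by apply: ler_wpM2r.
  have q2 : `|c3| * `|a2| <= 1 * `|a2| by apply: ler_wpM2r.
  have q3 : `|c4| * `|a3| <= 1 * `|a3| by apply: ler_wpM2r.
  have q4 : `|c2| * `|c3 * a2 + c4 * a3| <= 1 * `|c3 * a2 + c4 * a3| by apply: ler_wpM2r.
  have q5 : 0 <= C1 * `|a2| by apply: mulr_ge0.
  have q6 : 0 <= C1 * `|a3| by apply: mulr_ge0.
  have q7 := normr_ge0 a1.
  rewrite mulrDl mul1r !mulrDr; lra.
exact: (aux _ _ _ _ _ _ _ h1 h2 h3 h4).
Qed.

(** The equation on V_u bounds the pairing with z_k by the norm of the functional - Delta_p u - h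
    times that of z_k, which is uniformly bounded; the limit of the pairings is half the pairing
    with v. *)
Lemma f_in_dual_critical : f_in_dual Omega p f u.
Proof.
have [dA [sA [C1 hC1]]] := plateau_smooth N (1 : R).
have [_ [C hC]] := dual_neg_plaplacian.
(* B bounds the p-th powers of the norms of the approximants: N + 1 bounds the energy of v when nrm
   v <= 1, and 4^p (1 + (N + 1)) that of phi_k = (phi_k - v) + v. The norms are then at most 1 + B
   since a <= 1 + a^p. *)
pose B : R := (1 + N.+1%:R `^ p) * (((1 + C1) * 4) `^ p *
  (EO u (gr u) + N.+1%:R + 4 `^ p * (1 + N.+1%:R))).
suff key v : A_space Omega p f u v -> nrm v <= 1 -> pairing_f Omega f u v <= 2 * (`|C| * (1 + B)).
  apply: (@le_lt_trans _ _ (2 * (`|C| * (1 + B)))%:E); last exact: ltry.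
  apply: ge_ereal_sup => _ [v [Av nv] <-]; rewrite lee_fin; exact: key.
move=> [hv If] nv; have Wv := W0gr hv; have Wu := W0gr hu.
have Ev : EO v (gr v) <= N.+1%:R.
  apply: (le_trans (energy_le_sobolev_norm oO bO p1 Wv)); rewrite -[leRHS]mulr1.
  apply: ler_wpM2l; first exact: ler0n.
  by have := powR_mono p1 (sobolev_norm_ge0 _ _ _) nv; rewrite powR1.
have [phi_ tphi Ephi] := W0_fast Wv.
have /choice[M_ hM] : forall k, exists M : R, 0 <= M /\ forall x, `|phi_ k x| <= M.
  move=> k; have [M hM] := test_bounded (tphi k); exists `|M|; split; first exact: normr_ge0.
  by move=> x; apply: (le_trans (hM x)); exact: ler_norm.
(* b_k must tend to 0, so that the plateau tends to 1, and satisfy b_k M_k <= 1; adding M_k to the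
   denominator achieves both. *)
pose e_ k : R := k.+1%:R^-1; pose b_ k := (k.+1%:R + M_ k)^-1.
have e0 k : 0 < e_ k by rewrite invr_gt0.
have d0 k : 0 < k.+1%:R + M_ k by rewrite ltr_pwDl//; exact: (hM k).1.
have b0 k : 0 < b_ k by rewrite invr_gt0.
have bM k : b_ k * M_ k <= 1 by rewrite ler_pdivrMl// mulr1 lerDr ler0n.
have step k := V_approx_step sA hC1 (e0 k) (b0 k) (hM k).1 (bM k) hv (tphi k) (hM k).2.
pose z_ k x := plateau 1 (b_ k * u x) * ratio_map (e_ k) (v x) (phi_ k x).
have Wphi k := test_W0 oO bO p1 (tphi k).
have Ephi1 k : EO (phi_ k) (tgrad (phi_ k)) <= 4 `^ p * (1 + N.+1%:R).
  have h2 := energy_add mOm p1 (LpJ_sub mOm p1 (Wphi k).1 Wv.1) Wv.1.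
  have -> : EO (phi_ k) (tgrad (phi_ k)) = EO (fun x => phi_ k x - v x + v x)
      (fun x => tgrad (phi_ k) x - gr v x + gr v x).
    by apply: f_equal2; apply/funext => x; rewrite subrK.
  apply: (le_trans h2); apply: ler_wpM2l; first exact: powR_ge0.
  apply: lerD Ev; apply: (le_trans (Ephi k)).
  by rewrite exprn_ile1// ?invr_ge0// invf_le1 ?ler1n.
have C10 : 0 <= C1 by exact: le_trans (hC1 0).
have nz k : nrm (z_ k) <= 1 + B.
  have [_ _ hk] := step k; apply: (le_trans (ler_1DpowR p1 (sobolev_norm_ge0 _ _ _))).
  rewrite lerD2l; apply: (le_trans hk); apply: ler_wpM2l; first by rewrite addr_ge0// powR_ge0.
  apply: ler_wpM2l; first exact: powR_ge0.
  by apply: lerD (Ephi1 k); rewrite lerD2l.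
have pz k : pairing_f Omega f u (z_ k) <= `|C| * (1 + B).
  have [Vz _ _] := step k; rewrite -(V_space_equation Vz).
  have [hz _ _] := Vz; apply: (le_trans (ler_norm _)); apply: (le_trans (hC _ hz)).
  apply: (@le_trans _ _ (`|C| * nrm (z_ k))).
    by apply: ler_wpM2r; [exact: sobolev_norm_ge0|exact: ler_norm].
  by apply: ler_wpM2l; [exact: normr_ge0|exact: nz].
have ce : e_ k @[k --> \oo] --> 0 by exact: cvg_harmonic.
have cb : b_ k @[k --> \oo] --> 0.
  apply: (squeeze_cvgr _ (cvg_cst 0) ce); apply: nearW => k; rewrite (ltW (b0 k)) /=.
  by rewrite lef_pV2 ?posrE// lerDl; exact: (hM k).1.
have [? [_ _ cphi _]] := fast_cvg mOm p1 (fun k => LpJ_sub mOm p1 (Wphi k).1 Wv.1) Ephi.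
have mfu : measurable_fun (Omega : set T) (fun x : T => f x (u x)).
  exact: (measurable_caratheodory mOm leb_complete hf.1 hf.2 Wu.1.1.1).
have mz k : measurable_fun (Omega : set T) (z_ k : T -> R).
  by have [[_ [mz _ _] _] _ _] := step k; exact: mz.
have mfz k : measurable_fun (Omega : set T) (fun x : T => f x (u x) * z_ k x).
  exact: (measurable_funM mfu (mz k)).
have mfv : measurable_fun (Omega : set T) (fun x : T => 2^-1 * (f x (u x) * v x)).
  exact: (measurable_funM (measurable_cst _) (measurable_funM mfu Wv.1.1.1)).
have cz : {ae mu, forall x, Omega x ->
    f x (u x) * z_ k x @[k --> \oo] --> 2^-1 * (f x (u x) * v x)}.
  apply: ae_mp cphi => x hx Ox.
  have -> : 2^-1 * (f x (u x) * v x) = f x (u x) * (1 * (2^-1 * v x)) by rewrite mul1r mulrCA.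
  apply: cvgMr; apply: cvgM; first exact: plateau_cvg1.
  by apply: ratio_cvg => //; apply/subr_cvg0; exact: hx.
(* The majorant |f(x, u) v| is integrable precisely because v belongs to A_u. *)
have dom : {ae mu, forall x, Omega x ->
    forall k, (`|f x (u x) * z_ k x|%:E <= `|f x (u x) * v x|%:E)%E}.
  apply: aeW => x _ k; rewrite lee_fin 2!(normrM (f x (u x))); apply: ler_wpM2l; first exact: normr_ge0.
  by have [_ zv _] := step k; exact: zv.
have [_ _ cI] := @Rintegral_cvg_dominated _ T R mu Omega mOm (fun k x => f x (u x) * z_ k x)
  (fun x => 2^-1 * (f x (u x) * v x)) (fun x => `|f x (u x) * v x|%:E) mfz mfv cz (Ig_abs If) dom.
rewrite (@RintegralZl _ T R mu Omega _ _ mOm If) in cI.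
rewrite -ler_pdivrMl//.
apply: (ler_cvg_to cI (cvg_cst (`|C| * (1 + B)))); apply: nearW => k; exact: pz.
Qed.

Lemma critical_weak_solution : weak_solution Omega p f h u.
Proof.
split; [exact: hu|exact: f_in_dual_critical|].
exists (fun v => neg_plaplacian Omega p u v - h v); last by move=> v _; rewrite subrK.
by split; [exact: dual_neg_plaplacian|exact: V_space_equation].
Qed.

End main.

Theorem theorem6 (R : realType) (N : nat) (Omega : set 'rV[R]_N.+1)
    (p : R) (h : ('rV[R]_N.+1 -> R) -> R) (f : 'rV[R]_N.+1 -> R -> R)
    (hOmega : bounded_domain Omega)
    (hp : 1 < p)
    (hh : dual_W1p0 Omega p h)
    (hf : caratheodory Omega f)
    (hfloc : forall r : R, 0 < r -> L1loc Omega (sup_abs f r))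
    (u : 'rV[R]_N.+1 -> R)
    (hu : W1p0 Omega p u)
    (hcrit : critical_point (W1p0 Omega p)
               (fun v w => sobolev_norm Omega p (v \- w)) (Phi Omega p f h) u)
    (hPsi : Psi Omega f u \is a fin_num) :
  weak_solution Omega p f h u.
Proof.
by have [oO _ _ bO] := hOmega; exact: critical_weak_solution.
Qed.
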